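(* Assume the reference-KKT-point, regularity-and-compatibility, nonlinearity, approximability, trace-residual-bound and local-neighborhood hypotheses of the context, that $\alpha>\alpha_0$, and that the radius in the local-neighborhood hypothesis satisfies $\rho\le\rho_0$. Suppose the trained network triple $\widehat z_N=(Y_\theta,\Lambda_\phi,U_\psi)\in\mathcal H_N$ satisfies \[ \mathcal L_{\rm ind}(\widehat z_N)\le\inf_{z\in\mathcal H_N}\mathcal L_{\rm ind}(z)+\epsilon_{\rm opt}^2 \] for some $\epsilon_{\rm opt}\ge0$, and let the collocation points satisfy the space-filling assumption of the context. Set $C_{\rm train}:=\max_\bullet C_{n_\bullet}^{1/2}$, with the sample-dependent quadrature constants $C_{n_\bullet}$ of the context. Then, with probability at least $1-\sum_\bullet\sqrt{n_\bullet}\,(1-1/\sqrt{n_\bullet})^{n_\bullet}$ (sum over the seven residuals), \[ \|(e_y,e_\lambda,e_u)\|_{\mathcal E}\lesssim C_{\rm stab}\Bigl[C_{\rm train}\bigl(\epsilon_{\rm net}(N)+\epsilon_{\rm opt}\bigr)+\mathcal E_{\rm quad}\Bigr]+C'_{\rm stab}M_{\rm bc}, \] where $e_y:=y^*-Y_\theta$, $e_\lambda:=\lambda^*-\Lambda_\phi$, $e_u:=u^*-U_\psi|_\Sigma$.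
   Context: Notation: $A\lesssim B$ means $A\le CB$ with $C>0$ possibly depending on fixed problem data and fixed loss weights but independent of network resolution, training tolerance and collocation sample sizes. Setting. $d\ge1$; $\Omega\subset\mathbb R^d$ is a bounded domain with $C^{2+\beta}$ boundary for some $\beta\in(0,1)$; $T>0$, $Q:=\Omega\times(0,T)$, $\Sigma:=\partial\Omega\times(0,T)$; $n$ is the outward unit normal and $\partial_nv:=\nabla_xv\cdot n$ (for $d=1$ integrals over $\partial\Omega$ use counting measure). Fix $\nu>0$, $\alpha>0$, $g,y_d\in L^2(Q)$, $y_0\in L^2(\Omega)$, $f:\mathbb R\to\mathbb R$. The control problem is to minimize $J(y,u)=\frac12\int_Q|y-y_d|^2dx\,dt+\frac\alpha2\int_\Sigma|u|^2ds\,dt$ over $u\in L^2(\Sigma)$ subject to $\partial_ty-\nu\Delta y+f(y)=g$ in $Q$, $y=u$ on $\Sigma$, $y(\cdot,0)=y_0$ in $\Omega$, the state equation being understood in the transposition (very weak) sense (by duality against a regular backward dual problem with homogeneous Dirichlet and terminal data), the state belonging at least to $L^2(Q)$. The KKT system is: $\partial_ty-\nu\Delta y+f(y)-g=0$ and $-\partial_t\lambda-\nu\Delta\lambda+f'(y)\lambda+(y-y_d)=0$ in $Q$; $\alpha u+\nu\partial_n\lambda=0$, $y=u$, $\lambda=0$ on $\Sigma$; $y(\cdot,0)=y_0$, $\lambda(\cdot,T)=0$ in $\Omega$. Hölder spaces. $C^{\beta,\beta/2}(\overline Q)$: Hölder continuity of order $\beta$ in $x$ and $\beta/2$ in $t$.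 $C^{2+\beta,1+\beta/2}(\overline Q)$: additionally second spatial derivatives and the first time derivative lie in $C^{\beta,\beta/2}(\overline Q)$. $C^{2+\beta,1+\beta/2}(\Sigma)$ is the analogous space on the lateral boundary manifold. Reference-KKT-point hypothesis: the problem admits a local optimal pair $(y^*,u^* )$ and an adjoint $\lambda^*$ (all fixed) solving the KKT system, the state equation in the transposition sense, the adjoint equation in the standard variational sense, the stationarity relation in $L^2(\Sigma)$ (under the next hypothesis all equations and traces are classical). Regularity-and-compatibility hypothesis: $\partial\Omega\in C^{2+\beta}$, $y_0\in C^{2+\beta}(\overline\Omega)$, $g,y_d\in C^{\beta,\beta/2}(\overline Q)$, $u^*\in C^{2+\beta,1+\beta/2}(\Sigma)$, and $y_0=u^*(\cdot,0)$, $\partial_tu^*(\cdot,0)=\nu\Delta y_0-f(y_0)+g(\cdot,0)$ on $\partial\Omega$. Nonlinearity hypothesis: $f\in C^2(\mathbb R)$, $f'(s)\ge-c_f$ for all $s$ for some $c_f\ge0$, and $f''$ is bounded on bounded sets. Approximability hypothesis: $\mathcal H_N$ denotes the product class of network triples $(Y,\Lambda,U)$ of feedforward $\tanh$ networks on $\overline Q$ at resolution $N\in\mathbb N$. With $\widetilde u^*$ a fixed extension of $u^*$ from $\Sigma$ to $\overline Q$, there is a sequence $\epsilon_{\rm net}(N)\to0$ with $\inf_{\theta,\psi,\phi}(\|y^*-Y_\theta\|_{W^{2,\infty}(Q)}+\|\lambda^*-\Lambda_\phi\|_{W^{2,\infty}(Q)}+\|\widetilde u^*-U_\psi\|_{W^{1,\infty}(Q)})\le\epsilon_{\rm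 net}(N)$ over $\mathcal H_N$, where $W^{k,\infty}(Q)$ is the isotropic Sobolev space in all $d+1$ space-time variables. Residuals. $\mathcal R_y:=\partial_tY_\theta-\nu\Delta Y_\theta+f(Y_\theta)-g$ and $\mathcal R_\lambda:=-\partial_t\Lambda_\phi-\nu\Delta\Lambda_\phi+f'(Y_\theta)\Lambda_\phi+Y_\theta-y_d$ on $Q$; $\mathcal R_u:=\alpha U_\psi+\nu\partial_n\Lambda_\phi$, $R^y_{\rm bc}:=(Y_\theta-U_\psi)|_\Sigma$, $R^\lambda_{\rm bc}:=\Lambda_\phi|_\Sigma$ on $\Sigma$; $R^y_{\rm ic}:=Y_\theta(\cdot,0)-y_0=:-e_{y,0}$ and $R^\lambda_T:=\Lambda_\phi(\cdot,T)$ on $\Omega$. These are the seven residuals $\bullet$, with sampling domains $D_\bullet\in\{Q,\Sigma,\Omega\}$ of dimension $d_\bullet\in\{d+1,d\}$. Trace-residual-bound hypothesis: along the sequence of trained networks, $\|R^y_{\rm bc}\|_{C^{2+\beta,1+\beta/2}(\Sigma)}$, $\|R^\lambda_{\rm bc}\|_{C^{2+\beta,1+\beta/2}(\Sigma)}$, $\|R^\lambda_T\|_{C^{2+\beta}(\overline\Omega)}\le M_{\rm bc}$ for some $M_{\rm bc}<\infty$ independent of network size. (The corner agreement $R^\lambda_{\rm bc}(x,T)=R^\lambda_T(x)$, $x\in\partial\Omega$, is automatic.) Local-neighborhood hypothesis: for the trained triples considered there is $\rho>0$ with $\|Y_\theta-y^*\|_{L^\infty(Q)}+\|\Lambda_\phi-\lambda^*\|_{L^\infty(Q)}\le\rho$;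 moreover there is a compact interval $I$ containing the ranges of $y^*$ and all trained states considered on which $f''$ is Lipschitz. Loss. For each residual, $\mathcal L_\bullet$ is the empirical mean of $|\bullet|^2$ over its collocation points: $N_{\rm int}$ interior points in $Q$ (for $\mathcal R_y,\mathcal R_\lambda$), $N_{\rm bc}$ boundary points in $\Sigma$ (for $\mathcal R_u,R^y_{\rm bc},R^\lambda_{\rm bc}$), $N_{\rm ic}$ initial points in $\Omega$ (for $R^y_{\rm ic}$), $N_{\rm T}$ terminal points in $\Omega$ (for $R^\lambda_T$); $n_\bullet$ is the sample size of $\bullet$. $\mathcal L_{\rm ind}$ is the weighted sum of the seven $\mathcal L_\bullet$ with fixed strictly positive weights. Space-filling assumption: the interior, initial and terminal points are i.i.d. draws from probability distributions with density bounded above and below on their domains; boundary points are sampled independently on each connected component of $\Sigma$ with componentwise densities bounded above and below. Residuals may share a batch; no independence between the corresponding error events is assumed. Quadrature constants. With $\|v\|^2_{L^2_{\rm av}(D)}:=|D|^{-1}\int_D|v|^2$ and $\beta_\bullet\in(0,1]$ the Hölder exponent of $\bullet$, $C_{n_\bullet}=O(\sqrt{n_\bullet})$ and $C'$ (depending on the Hölder seminorm of the residual of the fixed network and the density bounds) are constants such that, for each $\bullet$, with probability at least $1-\sqrt{n_\bullet}(1-1/\sqrt{n_\bullet})^{n_\bullet}$, $\|\bullet\|^2_{L^2_{\rm av}(D_\bullet)}\le C_{n_\bullet}\mathcal L_\bullet+C'n_\bullet^{-\beta_\bullet/d_\bullet}$. $\mathcal E_{\rm quad}$ is the square root of the sum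 of the seven additive terms $C'n_\bullet^{-\beta_\bullet/d_\bullet}$. Error norm: $\|(e_y,e_\lambda,e_u)\|_{\mathcal E}^2:=\|e_y\|_{L^2(Q)}^2+\|e_\lambda\|_{L^2(0,T;H^1(\Omega))}^2+\|e_u\|_{L^2(\Sigma)}^2$. Stability constants. Let $a:=f'(y^* )$, $M_a:=\|a\|_{L^\infty(Q)}$, $\kappa:=f''(y^* )\lambda^*$, $M_\kappa:=\sup_{\overline Q}|\kappa|$. $C_2,C_3>0$ are constants depending only on $\nu,\Omega,T,c_f,M_a$, and $\alpha_0:=4\sqrt2\,\nu(1+M_\kappa)\sqrt{C_2}\,C_3$. For $\alpha>\alpha_0$, $C_{\rm stab}$ (depending on $\nu,\Omega,T,c_f,M_a,M_\kappa,\alpha$) and $C'_{\rm stab}$ (depending additionally on a parabolic Schauder constant for the operator with coefficient $a$) are constants such that, for arbitrary $F_y,F_\lambda\in L^2(Q)$, every solution of $\partial_te_y-\nu\Delta e_y+ae_y=F_y$ in $Q$, $e_y=e_u-R^y_{\rm bc}$ on $\Sigma$, $e_y(\cdot,0)=e_{y,0}$; $-\partial_te_\lambda-\nu\Delta e_\lambda+ae_\lambda+(\kappa+1)e_y=F_\lambda$ in $Q$, $e_\lambda=-R^\lambda_{\rm bc}$ on $\Sigma$, $e_\lambda(\cdot,T)=-R^\lambda_T$; $\alpha e_u+\nu\partial_ne_\lambda=-\mathcal R_u$ on $\Sigma$, satisfies $\|(e_y,e_\lambda,e_u)\|_{\mathcal E}\le C_{\rm stab}(\|e_{y,0}\|_{L^2(\Omega)}+\|F_y\|_{L^2(Q)}+\|F_\lambda\|_{L^2(Q)}+\|\mathcal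 R_u\|_{L^2(\Sigma)}+\|R^y_{\rm bc}\|_{L^2(\Sigma)})+C'_{\rm stab}M_{\rm bc}$. Finally $\rho_0=1/(2C_{\rm stab}C_{\rm nl})>0$ is a radius, depending only on the reference KKT point, the Lipschitz bound for $f''$ and the preceding constants, such that $\rho\le\rho_0$ implies for the trained triple $\|(y^*-Y_\theta,\lambda^*-\Lambda_\phi,u^*-U_\psi|_\Sigma)\|_{\mathcal E}\le2C_{\rm stab}(\|e_{y,0}\|_{L^2(\Omega)}+\|\mathcal R_y\|_{L^2(Q)}+\|\mathcal R_\lambda\|_{L^2(Q)}+\|\mathcal R_u\|_{L^2(\Sigma)}+\|R^y_{\rm bc}\|_{L^2(\Sigma)})+2C'_{\rm stab}M_{\rm bc}$. *)

(* Defs.v *)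
(* Conventions.
   - R^n is 'rV[R]_n; its library norm is the sup norm, so Euclidean lengths
     are written enorm.
   - Space-time is 'rV[R]_n * R, a point being p = (x, t).  measurableTypeR R
     is R with its Borel sigma-algebra; it only occurs where a measurable
     structure is needed.
   - The spatial dimension is d = m.+1, so that d >= 1 by construction.
   - Functions on a subset of space-time are total functions, of which only
     the values on that subset matter.
   - Norms that may be infinite take values in \bar R. *)
From HB Require Import structures.
From mathcomp Require Import all_boot all_order all_algebra.
From mathcomp Require Import all_classical all_reals all_analysis.
From mathcomp Require Import ess_sup_inf.

Set Implicit Arguments.
Unset Strict Implicit.
Unset Printing Implicit Defensive.

Import Order.TTheory GRing.Theory Num.Theory.
Import numFieldNormedType.Exports.

Local Open Scope classical_set_scope.
Local Open Scope ring_scope.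

(* The sigma-algebra of R^n is generated by the coordinates, i.e. it is the
   Borel one. *)
Section rV_measurable.
Context {R : realType} (n : nat).
Let coors : 'I_n -> 'rV[R]_n -> measurableTypeR R := fun i x => x ord0 i.
Let rV_set0 : g_sigma_preimage coors set0. Proof. exact: sigma_algebra0. Qed.
Let rV_setC A : g_sigma_preimage coors A -> g_sigma_preimage coors (~` A).
Proof. exact: sigma_algebraC. Qed.
Let rV_bigcup (F : (set 'rV[R]_n)^nat) : (forall i, g_sigma_preimage coors (F i)) ->
  g_sigma_preimage coors (\bigcup_i (F i)).
Proof. exact: sigma_algebra_bigcup. Qed.
HB.instance Definition _ := @isMeasurable.Build default_measure_display
  'rV[R]_n (g_sigma_preimage coors) rV_set0 rV_setC rV_bigcup.
End rV_measurable.


Section consrow.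
Context {R : realType} (n : nat).
Definition cons_row (p : R * 'rV[R]_n) : 'rV[R]_n.+1 :=
  \row_i oapp (fun j => p.2 ord0 j) p.1 (unlift ord0 i).
Definition uncons_row (v : 'rV[R]_n.+1) : R * 'rV[R]_n :=
  (v ord0 ord0, \row_j v ord0 (lift ord0 j)).
Lemma uncons_rowK : cancel uncons_row cons_row.
Proof.
move=> v; apply/rowP => i; rewrite mxE; case: unliftP => [j ->|->] /=; by rewrite ?mxE.
Qed.
Lemma cons_rowK : cancel cons_row uncons_row.
Proof.
case=> a v; rewrite /uncons_row /cons_row mxE unlift_none /=; congr pair.
by apply/rowP => j; rewrite !mxE liftK.
Qed.
Lemma measurable_coord m (i : 'I_m) :
  measurable_fun [set: 'rV[R]_m] (fun v : 'rV[R]_m => v ord0 i : measurableTypeR R).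
Proof.
move=> _ Y mY; rewrite setTI; apply: sub_sigma_algebra => /=.
by rewrite -bigcup_seq/=; exists i; rewrite ?inE /= ?mem_index_enum//; exists Y => //; rewrite setTI.
Qed.
Lemma measurable_fun_coordP d (T : measurableType d) m (f : T -> 'rV[R]_m) :
  (forall i, measurable_fun [set: T] (fun x => f x ord0 i : measurableTypeR R)) ->
  measurable_fun [set: T] f.
Proof.
move=> mf.
pose G := \big[setU/set0]_(i < m) preimage_set_system setT
  (fun v : 'rV[R]_m => v ord0 i : measurableTypeR R) measurable.
apply: (@measurability _ _ T 'rV[R]_m setT f G) => //.
move=> _ [A + <-].
rewrite /G -bigcup_seq => -[i _] [B mB] <-; rewrite !setTI -[X in measurable X]setTI.
exact: mf.
Qed.
End consrow.

Section step.
Context {R : realType} (n : nat).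
Lemma measurable_cons_row :
  measurable_fun [set: measurableTypeR R * 'rV[R]_n] (@cons_row R n).
Proof.
apply: measurable_fun_coordP => i; case: (unliftP ord0 i) => [j ->|->].
  apply: (eq_measurable_fun (fun p : measurableTypeR R * 'rV[R]_n => p.2 ord0 j : measurableTypeR R)).
    by move=> p _; rewrite /cons_row mxE liftK.
  exact: (measurableT_comp (measurable_coord j) measurable_snd).
apply: (eq_measurable_fun (fun p : measurableTypeR R * 'rV[R]_n => p.1 : measurableTypeR R)).
  by move=> p _; rewrite /cons_row mxE unlift_none.
exact: measurable_fst.
Qed.

Lemma measurable_uncons_row : measurable_fun [set: 'rV[R]_n.+1]
  (@uncons_row R n : _ -> measurableTypeR R * 'rV[R]_n).
Proof.
apply: measurable_fun_pair; first exact: measurable_coord.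
apply: measurable_fun_coordP => i.
apply: (eq_measurable_fun (fun v : 'rV[R]_n.+1 => v ord0 (lift ord0 i) : measurableTypeR R)).
  by move=> p _; rewrite mxE.
exact: measurable_coord.
Qed.

Variable mu : {sigma_finite_measure set 'rV[R]_n -> \bar R}.
Definition leb_step : set 'rV[R]_n.+1 -> \bar R :=
  pushforward (@lebesgue_measure R \x mu)%E (@cons_row R n).

Let leb_step0 : leb_step set0 = 0%E.
Proof. by rewrite /leb_step /pushforward preimage_set0 measure0. Qed.
Let leb_step_ge0 A : (0 <= leb_step A)%E.
Proof. by rewrite /leb_step /pushforward measure_ge0. Qed.
Let leb_step_additive : semi_sigma_additive leb_step.
Proof.
have mpre (A : set 'rV[R]_n.+1) : measurable A -> measurable (@cons_row R n @^-1` A : set (measurableTypeR R * _)).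
  by move=> mA; rewrite -[X in measurable X]setTI; exact: measurable_cons_row.
move=> F mF tF mUF; rewrite /leb_step /pushforward preimage_bigcup.
apply: measure_semi_sigma_additive.
- by move=> k; exact: mpre.
- apply/trivIsetP => /= i j _ _ ij; rewrite -preimage_setI.
  by move/trivIsetP : tF => /(_ _ _ _ _ ij) ->//; rewrite preimage_set0.
- by rewrite -preimage_bigcup; exact: mpre.
Qed.
HB.instance Definition _ := isMeasure.Build _ _ _ leb_step leb_step0 leb_step_ge0 leb_step_additive.
Let leb_step_sigma_finite : sigma_finite setT leb_step.
Proof.
have /sigma_finiteP[F [TF ndF Foo]] := sigma_finiteT (@lebesgue_measure R).
have /sigma_finiteP[G [TG ndG Goo]] := sigma_finiteT mu.
exists (fun k => @uncons_row R n @^-1` (F k `*` G k)).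
  rewrite -preimage_bigcup predeqE => v; split=> // _.
  have [i _ Fi] : (\bigcup_i F i) (uncons_row v).1 by rewrite -TF.
  have [j _ Gj] : (\bigcup_i G i) (uncons_row v).2 by rewrite -TG.
  exists (maxn i j) => //; split.
    by move: Fi; exact/subsetPset/ndF/leq_maxl.
  by move: Gj; exact/subsetPset/ndG/leq_maxr.
move=> k; have [mF F_oo] := Foo k; have [mG G_oo] := Goo k; split.
  by rewrite -[X in measurable X]setTI; apply: measurable_uncons_row => //;
    exact: measurableX.
rewrite /leb_step /pushforward -comp_preimage.
have -> : @uncons_row R n \o @cons_row R n = id.
  by apply/funext => p; exact: cons_rowK.
by rewrite preimage_id product_measure1E// lte_mul_pinfty// ge0_fin_numE.
Qed.
HB.instance Definition _ := Measure_isSigmaFinite.Build _ _ _ leb_step leb_step_sigma_finite.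
End step.

Fixpoint lebesgue_rV {R : realType} (n : nat) :
    {sigma_finite_measure set 'rV[R]_n -> \bar R} :=
  match n with
  | 0 => [the {sigma_finite_measure set 'rV[R]_0 -> \bar R}
           of @dirac _ _ (0 : 'rV[R]_0) R]
  | n'.+1 => [the {sigma_finite_measure set 'rV[R]_n'.+1 -> \bar R}
               of leb_step (@lebesgue_rV R n')]
  end.

Definition lebesgue_st {R : realType} (n : nat) :
    set ('rV[R]_n * measurableTypeR R) -> \bar R :=
  (lebesgue_rV n \x @lebesgue_measure R)%E.
HB.instance Definition _ (R : realType) n := Measure.on (@lebesgue_st R n).
Arguments lebesgue_st {R} n _.

Section hausdorff.
Context {R : realType} {n : nat}.
Implicit Types (A : set 'rV[R]_n) (k : nat).
Local Open Scope ereal_scope.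

Definition enorm (x : 'rV[R]_n) : R :=
  Num.sqrt (\sum_(i < n) (x ord0 i ^+ 2)%R)%R.

Definition ediam A : \bar R :=
  ereal_sup [set (enorm (x - y))%:E | x in A & y in A].

(* volume of the k-dimensional Euclidean ball of diameter ediam A; for k = 0
   it counts A as one point, whence H^0 is the counting measure *)
Definition hausdorff_gauge k A : \bar R :=
  if A == set0 then 0
  else lebesgue_rV k [set y : 'rV[R]_k |
         Num.sqrt (\sum_(i < k) (y ord0 i ^+ 2)%R)%R <= 2^-1]%R * ediam A ^+ k.

Definition hausdorff_pre k (delta : R) A : \bar R :=
  ereal_inf [set \sum_(i <oo) hausdorff_gauge k (F i) |
    F in [set F : nat -> set 'rV[R]_n |
      A `<=` \bigcup_i F i /\ forall i, ediam (F i) <= delta%:E]].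

(* This is an outer measure on R^n, whose restriction to Borel sets is the
   k-dimensional Hausdorff measure; it is used below only through integrals,
   which evaluate it on Borel sets. *)
Definition hausdorff k A : \bar R :=
  ereal_sup [set hausdorff_pre k delta A | delta in [set delta : R | (0 < delta)%R]].

End hausdorff.

(* surface measure times dt on (hypersurface of R^(m+1)) x R *)
Definition surface_st {R : realType} (m : nat) :
    set ('rV[R]_m.+1 * measurableTypeR R) -> \bar R :=
  (hausdorff m \x @lebesgue_measure R)%E.
Arguments surface_st {R} m _.

Section L2.
Context {d : measure_display} {T : measurableType d} {R : realType}.
Variables (mu : set T -> \bar R) (D : set T).
Implicit Type v : T -> R.
Local Open Scope ereal_scope.

Definition L2sq v : \bar R := \int[mu]_(x in D) ((v x) ^+ 2)%:E.
Definition L2norm v : \bar R := L2sq v `^ 2^-1.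
Definition in_L2 v : Prop := measurable_fun D v /\ L2sq v < +oo.
Definition L2avsq v : \bar R := ((fine (mu D))^-1)%:E * L2sq v.

End L2.

Section calculus.
Context {R : realType} {n : nat}.
Local Notation X := 'rV[R]_n.
Local Notation XT := ('rV[R]_n * R)%type.
Implicit Types (v : XT -> R) (w : X -> R).

Definition dir_t : XT := (0, 1).
Definition dir_x (i : 'I_n) : XT := (delta_mx ord0 i, 0).
Definition dt v : XT -> R := fun p => 'D_dir_t v p.
Definition dx (i : 'I_n) v : XT -> R := fun p => 'D_(dir_x i) v p.
Definition laplace_x v : XT -> R := fun p => \sum_(i < n) dx i (dx i v) p.

Definition ds (i : 'I_n) w : X -> R := fun x => 'D_(delta_mx ord0 i) w x.
Definition laplace w : X -> R := fun x => \sum_(i < n) ds i (ds i w) x.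

Definition C11 (U : set XT) v : Prop := forall p, U p ->
  [/\ {for p, continuous v},
      derivable v p dir_t, {for p, continuous (dt v)} &
      forall i, derivable v p (dir_x i) /\ {for p, continuous (dx i v)}].

Definition C21 (U : set XT) v : Prop :=
  C11 U v /\ forall p, U p -> forall i j,
    derivable (dx i v) p (dir_x j) /\ {for p, continuous (dx j (dx i v))}.

(* value at p of the continuous extension of g from A to its closure *)
Definition ext {S : topologicalType} (A : set S) (g : S -> R) (p : S) : R :=
  lim (g q @[q --> within A (nbhs p)]).

End calculus.

Section holder.
Context {R : realType} {n : nat}.
Local Notation X := 'rV[R]_n.
Local Notation XT := ('rV[R]_n * R)%type.
Local Open Scope ereal_scope.

(* Pairs of equal points contribute 0 to the seminorms, as 0 / 0 = 0. *)
Definition holder_norm (A : set X) (b : R) (w : X -> R) : \bar R :=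
  ereal_sup [set `|w x|%:E | x in A] +
  ereal_sup [set (`|w x - w y| / enorm (x - y) `^ b)%:E | x in A & y in A].

Definition parabolic_holder_norm (A : set XT) (b : R) (v : XT -> R) : \bar R :=
  ereal_sup [set `|v p|%:E | p in A] +
  ereal_sup [set (`|v p - v q| /
     (enorm (p.1 - q.1) `^ b + `|p.2 - q.2| `^ (b / 2)))%:E | p in A & q in A].

(* Hoelder bounds of the derivatives on an open set are equivalent to Hoelder
   bounds, with the same constants, of their extensions to its closure. *)
Definition holder2_norm (D : set X) (b : R) (w : X -> R) : \bar R :=
  holder_norm (closure D) b w
  + \sum_(i < n) holder_norm D b (ds i w)
  + \sum_(i < n) \sum_(j < n) holder_norm D b (ds j (ds i w)).

(* w belongs to C^{2+b}(closure D), with norm at most M *)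
Definition holder2_le (D : set X) (b : R) (w : X -> R) (M : R) : Prop :=
  (forall x, D x -> forall i, derivable w x (delta_mx ord0 i) /\
     forall j, derivable (ds i w) x (delta_mx ord0 j)) /\
  holder2_norm D b w <= M%:E.

Definition parabolic_holder2_norm (U : set XT) (b : R) (v : XT -> R) : \bar R :=
  parabolic_holder_norm (closure U) b v
  + \sum_(i < n) parabolic_holder_norm U b (dx i v)
  + \sum_(i < n) \sum_(j < n) parabolic_holder_norm U b (dx j (dx i v))
  + parabolic_holder_norm U b (dt v).

(* v belongs to C^{2+b,1+b/2}(closure U), with norm at most M *)
Definition parabolic_holder2_le (U : set XT) (b : R) (v : XT -> R) (M : R) :
    Prop :=
  (forall p, U p -> derivable v p dir_t /\ forall i, derivable v p (dir_x i) /\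
     forall j, derivable (dx i v) p (dir_x j)) /\
  parabolic_holder2_norm U b v <= M%:E.

End holder.

Section sobolev_inf.
Context {R : realType} {n : nat}.
Local Notation XT := ('rV[R]_n * R)%type.
Variable U : set XT.
Implicit Type v : XT -> R.

(* None is the time direction; a multi-index is a list of directions *)
Definition dir (i : option 'I_n) : XT := oapp dir_x dir_t i.
Definition diter (s : seq (option 'I_n)) v : XT -> R :=
  foldr (fun i g => fun p => 'D_(dir i) g p) v s.

(* k times continuously differentiable with compact support in U; testing
   weak derivatives of order k with these or with smooth functions is
   equivalent, by mollification *)
Definition test_function (k : nat) (phi : XT -> R) : Prop :=
  [/\ forall s, (size s <= k)%N -> continuous (diter s phi),
      forall s i p, (size s < k)%N -> derivable (diter s phi) p (dir i) &
      exists K, [/\ compact K, K `<=` U & forall p, ~ K p -> phi p = 0]].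

Definition weak_derivative (s : seq (option 'I_n)) v (w : XT -> R) : Prop :=
  forall phi, test_function (size s) phi ->
    (\int[lebesgue_st n]_(p in U) (v p * diter s phi p)%:E =
     ((-1) ^+ size s)%:E * \int[lebesgue_st n]_(p in U) (w p * phi p)%:E)%E.

(* W^{k,oo}(U) norm, U open: the largest L^oo norm of the weak derivatives of
   order at most k in all space-time variables (+oo if one of them does not
   exist or is unbounded) *)
Definition sobolev_inf_norm (k : nat) v : \bar R :=
  ereal_inf [set M%:E | M in [set M : R | 0 <= M /\
    exists w : seq (option 'I_n) -> XT -> R, forall s, (size s <= k)%N ->
      [/\ measurable_fun (U : set ('rV[R]_n * measurableTypeR R)) (w s),
          weak_derivative s v (w s) &
          {ae lebesgue_st n, forall p, U p -> `|w s p| <= M}]]].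

Definition Linf_norm v : \bar R :=
  ess_sup (lebesgue_st n) (fun p => (`|v p| * \1_U p)%:E).

End sobolev_inf.

Section networks.
Context {R : realType}.

Definition tanh (x : R) : R := (expR x - expR (- x)) / (expR x + expR (- x)).

(* feedforward networks with n inputs and one output *)
Inductive mlp : nat -> Type :=
| Output n (W : 'cV[R]_n) (b : R) : mlp n
| Hidden n k (W : 'M[R]_(n, k)) (b : 'rV[R]_k) (rest : mlp k) : mlp n.

Fixpoint mlp_eval n (net : mlp n) : 'rV[R]_n -> R :=
  match net with
  | Output _ W b => fun x => (x *m W) ord0 ord0 + b
  | Hidden _ _ W b rest => fun x => mlp_eval rest (map_mx tanh (x *m W + b))
  end.

Definition is_tanh_network n (v : 'rV[R]_n * R -> R) : Prop :=
  exists net : mlp n.+1, forall p, v p = mlp_eval net (cons_row (p.2, p.1)).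

End networks.

Section geometry.
Context {R : realType} {m : nat}.
Local Notation X := 'rV[R]_m.+1.

(* Boundary chart: coordinates z = (x - origin) frame, the first of which is
   the vertical one, in which the domain is locally {height > graph}. *)
Record chart := Chart {
  chart_origin : X ;
  chart_frame : 'M[R]_m.+1 ;
  chart_graph : 'rV[R]_m -> R ;
  chart_radius : R ;
  chart_height : R }.

Definition chart_coord (c : chart) (x : X) : R * 'rV[R]_m :=
  uncons_row ((x - chart_origin c) *m chart_frame c).

Definition chart_base (c : chart) : set 'rV[R]_m :=
  [set y | `|y| < chart_radius c].

Definition chart_cylinder (c : chart) : set X :=
  [set x | chart_base c (chart_coord c x).2 /\
           `|(chart_coord c x).1| < chart_height c].

Definition chart_param (c : chart) (y : 'rV[R]_m) : X :=
  chart_origin c + cons_row (chart_graph c y, y) *m (chart_frame c)^T.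

Definition boundary (Om : set X) : set X := closure Om `\` Om.

Definition chart_of (Om : set X) (beta : R) (c : chart) : Prop :=
  [/\ chart_frame c *m (chart_frame c)^T = 1%:M,
      0 < chart_radius c /\ 0 < chart_height c,
      exists M, holder2_le (chart_base c) beta (chart_graph c) M,
      forall y, chart_base c y -> `|chart_graph c y| < chart_height c &
      forall x, chart_cylinder c x ->
        let z := chart_coord c x in
        (Om x <-> chart_graph c z.2 < z.1) /\
        (boundary Om x <-> z.1 = chart_graph c z.2)].

(* finite atlas of the compact boundary of Om *)
Definition atlas_of (Om : set X) (beta : R) K (atlas : 'I_K -> chart) : Prop :=
  (forall k, chart_of Om beta (atlas k)) /\
  forall x, boundary Om x -> exists k, chart_cylinder (atlas k) x.

Definition outward_unit_normal K (atlas : 'I_K -> chart) (nrm : X -> X) :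
    Prop :=
  forall k y, let c := atlas k in chart_base c y ->
    nrm (chart_param c y) =
    (Num.sqrt (1 + \sum_(j < m) ds j (chart_graph c) y ^+ 2))^-1 *:
    (cons_row (-1, \row_j ds j (chart_graph c) y) *m (chart_frame c)^T).

(* v belongs to C^{2+beta,1+beta/2} of the lateral boundary, with norm (the
   maximum of the norms in the charts) at most M *)
Definition lateral_holder2_le K (atlas : 'I_K -> chart) (T beta : R)
    (v : X * R -> R) (M : R) : Prop :=
  forall k, parabolic_holder2_le (chart_base (atlas k) `*` `]0, T[) beta
    (fun q => v (chart_param (atlas k) q.1, q.2)) M.

End geometry.
Arguments chart : clear implicits.

(* Data of the optimal control problem in dimension d = m.+1.  pb_atlas is a
   fixed atlas of the boundary, through which Hoelder norms on the lateral
   boundary are computed, and pb_normal the outward unit normal. *)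
Record problem (R : realType) (m : nat) := Problem {
  pb_Omega : set 'rV[R]_m.+1 ;
  pb_natlas : nat ;
  pb_atlas : 'I_pb_natlas -> chart R m ;
  pb_normal : 'rV[R]_m.+1 -> 'rV[R]_m.+1 ;
  pb_T : R ;
  pb_beta : R ;
  pb_nu : R ;
  pb_alpha : R ;
  pb_f : R -> R ;
  pb_g : 'rV[R]_m.+1 * R -> R ;
  pb_yd : 'rV[R]_m.+1 * R -> R ;
  pb_y0 : 'rV[R]_m.+1 -> R }.

(* (y, lambda, u), resp. (Y, Lambda, U) *)
Record triple (R : realType) (m : nat) := Triple {
  st : 'rV[R]_m.+1 * R -> R ;
  adj : 'rV[R]_m.+1 * R -> R ;
  ctl : 'rV[R]_m.+1 * R -> R }.

Inductive residual : Type :=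
  Res_y | Res_lambda | Res_u | Res_bc_y | Res_bc_lambda | Res_ic_y | Res_T_lambda.

Definition residuals : seq residual :=
  [:: Res_y; Res_lambda; Res_u; Res_bc_y; Res_bc_lambda; Res_ic_y; Res_T_lambda].

Section control_problem.
Context {R : realType} {m : nat}.
Variable pb : problem R m.
Local Notation X := 'rV[R]_m.+1.
Local Notation XT := ('rV[R]_m.+1 * R)%type.
Local Notation Om := (pb_Omega pb).
Local Notation T := (pb_T pb).
Local Notation nu := (pb_nu pb).
Local Notation alpha := (pb_alpha pb).
Local Notation beta := (pb_beta pb).
Local Notation f := (pb_f pb).
Local Notation g := (pb_g pb).
Local Notation yd := (pb_yd pb).
Local Notation y0 := (pb_y0 pb).
Local Notation f' := (derive1 (pb_f pb)).
Local Notation f'' := (derive1n 2 (pb_f pb)).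

Definition cylinder : set XT := Om `*` `]0, T[.
Definition lateral : set XT := boundary Om `*` `]0, T[.
Local Notation Q := cylinder.
Local Notation Sigma := lateral.

Definition normal_derivative (v : XT -> R) (p : XT) : R :=
  \sum_(i < m.+1) ext Q (dx i v) p * pb_normal pb p.1 ord0 i.

Local Notation muQ := (lebesgue_st m.+1).
Local Notation muS := (surface_st m).
Local Notation muO := (lebesgue_rV m.+1).

Definition well_posed_data : Prop :=
  [/\ open Om, connected Om, bounded_set Om & Om !=set0] /\
  [/\ 0 < beta < 1, atlas_of Om beta (pb_atlas (p := pb)),
      outward_unit_normal (pb_atlas (p := pb)) (pb_normal pb) &
      [/\ 0 < T, 0 < nu & 0 < alpha]] /\
  [/\ in_L2 muQ Q g, in_L2 muQ Q yd & in_L2 muO Om y0].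

(** Weak formulations *)

(* Transposition form of dt y - nu Lap y + h = F in Q, y = u on Sigma,
   y(., 0) = yi in Omega: duality against the functions phi (restrictions to
   the closed cylinder of C^{2,1} functions on R^(d+1)) that vanish on Sigma
   and at t = T, i.e. against the regular solutions of the backward problems
   -dt phi - nu Lap phi = psi with homogeneous Dirichlet and terminal data. *)
Definition transposition_solution (y h F u : XT -> R) (yi : X -> R) : Prop :=
  forall phi : XT -> R, C21 setT phi ->
    (forall p, Sigma p -> phi p = 0) -> (forall x, Om x -> phi (x, T) = 0) ->
    (\int[muQ]_(p in Q)
        (y p * (- dt phi p - nu * laplace_x phi p) + h p * phi p)%:E =
     \int[muQ]_(p in Q) (F p * phi p)%:E
     + \int[muO]_(x in Om) (yi x * phi (x, 0))%:E
     - nu%:E * \int[muS]_(p in Sigma) (u p * normal_derivative phi p)%:E)%E.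

(* Variational form of -dt l - nu Lap l + a l = F in Q, l = b on Sigma,
   l(., T) = lT in Omega, where G is the (weak) spatial gradient of l and q
   the normal derivative of l on Sigma.  The first identity says at once that
   G is the weak gradient of l and that l has trace b; the second one is
   tested with functions that vanish at t = 0 but not necessarily on Sigma,
   and hence also identifies q. *)
Definition variational_backward_solution (a F b : XT -> R) (lT : X -> R)
    (l : XT -> R) (G : 'I_m.+1 -> XT -> R) (q : XT -> R) : Prop :=
  [/\ in_L2 muQ Q l, forall i, in_L2 muQ Q (G i), in_L2 muS Sigma q,
      forall psi i, C11 setT psi ->
        (\int[muQ]_(p in Q) (G i p * psi p + l p * dx i psi p)%:E =
         \int[muS]_(p in Sigma)
            (b p * psi p * pb_normal pb p.1 ord0 i)%:E)%E &
      forall phi, C11 setT phi -> (forall x, Om x -> phi (x, 0) = 0) ->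
        (\int[muQ]_(p in Q)
           (l p * dt phi p + nu * (\sum_(i < m.+1) G i p * dx i phi p)
            + a p * l p * phi p - F p * phi p)%:E =
         \int[muO]_(x in Om) (lT x * phi (x, T))%:E
         + nu%:E * \int[muS]_(p in Sigma) (q p * phi p)%:E)%E].

(** The reference KKT point *)

Definition cost (y u : XT -> R) : \bar R :=
  ((2^-1)%:E * L2sq muQ Q (fun p => y p - yd p)%R
   + (alpha / 2)%:E * L2sq muS Sigma u)%E.

Definition admissible (y u : XT -> R) : Prop :=
  [/\ in_L2 muQ Q y, in_L2 muS Sigma u,
      muQ.-integrable Q (fun p => (f (y p))%:E) &
      transposition_solution y (f \o y) g u y0].

Definition local_optimal_pair (y u : XT -> R) : Prop :=
  admissible y u /\
  exists r : R, 0 < r /\ forall y' u' : XT -> R, admissible y' u' ->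
    (L2norm muS Sigma (fun p => u' p - u p)%R < r%:E)%E ->
    (cost y u <= cost y' u')%E.

Definition classical_KKT (z : triple R m) : Prop :=
  let y := st z in let lambda := adj z in let u := ctl z in
  [/\ C21 Q y, C21 Q lambda,
      {within closure Q, continuous y} /\ {within closure Q, continuous lambda} &
      forall p, Sigma p -> forall i,
        cvg (dx i lambda q @[q --> within Q (nbhs p)])] /\
  [/\ forall p, Q p -> dt y p - nu * laplace_x y p + f (y p) - g p = 0,
      forall p, Q p -> - dt lambda p - nu * laplace_x lambda p
                       + f' (y p) * lambda p + (y p - yd p) = 0,
      forall p, Sigma p -> [/\ alpha * u p + nu * normal_derivative lambda p = 0,
                               y p = u p & lambda p = 0] &
      forall x, Om x -> y (x, 0) = y0 x /\ lambda (x, T) = 0].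

Definition reference_KKT_point (z : triple R m) : Prop :=
  [/\ local_optimal_pair (st z) (ctl z),
      variational_backward_solution (f' \o st z) (fun p => yd p - st z p)
        (fun=> 0) (fun=> 0) (adj z) (fun i => dx i (adj z))
        (normal_derivative (adj z)),
      L2norm muS Sigma
        (fun p => alpha * ctl z p + nu * normal_derivative (adj z) p) = 0%E &
      classical_KKT z].

Definition regularity_and_compatibility (u : XT -> R) : Prop :=
  [/\ exists M, holder2_le Om beta y0 M,
      (parabolic_holder_norm (closure Q) beta g < +oo)%E,
      (parabolic_holder_norm (closure Q) beta yd < +oo)%E,
      exists M, lateral_holder2_le (pb_atlas (p := pb)) T beta u M &
      forall x, boundary Om x -> y0 x = u (x, 0) /\
        (h^-1 * (u (x, h) - u (x, 0))) @[h --> 0^'+] -->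
          nu * ext Om (laplace y0) x - f (y0 x) + g (x, 0)].

Definition nonlinearity (cf : R) : Prop :=
  [/\ forall s, derivable f s 1, forall s, derivable f' s 1, continuous f'',
      0 <= cf /\ forall s, - cf <= f' s &
      forall M : R, exists B, forall s, `|s| <= M -> `|f'' s| <= B].

(** Networks and residuals *)

Definition product_class (HY HL HU : nat -> set (XT -> R)) (N : nat) :
    set (triple R m) :=
  [set z | [/\ HY N (st z), HL N (adj z) & HU N (ctl z)]].

Definition approximability (zs : triple R m) (uext : XT -> R)
    (H : nat -> set (triple R m)) (eps : nat -> R) : Prop :=
  [/\ {within closure Q, continuous uext},
      forall p, Sigma p -> uext p = ctl zs p,
      eps @ \oo --> 0 &
      forall N,
        (ereal_inf [set sobolev_inf_norm Q 2 (fun p => st zs p - st z p)%R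
                      + sobolev_inf_norm Q 2 (fun p => adj zs p - adj z p)%R
                      + sobolev_inf_norm Q 1 (fun p => uext p - ctl z p)%R
                    | z in H N] <= (eps N)%:E)%E].

(* residuals on Omega ignore the time coordinate of p *)
Definition resid (z : triple R m) (r : residual) (p : XT) : R :=
  match r with
  | Res_y => dt (st z) p - nu * laplace_x (st z) p + f (st z p) - g p
  | Res_lambda => - dt (adj z) p - nu * laplace_x (adj z) p
                  + f' (st z p) * adj z p + st z p - yd p
  | Res_u => alpha * ctl z p + nu * normal_derivative (adj z) p
  | Res_bc_y => st z p - ctl z p
  | Res_bc_lambda => adj z p
  | Res_ic_y => st z (p.1, 0) - y0 p.1
  | Res_T_lambda => adj z (p.1, T)
  end.

Definition err_y0 (z : triple R m) (x : X) : R := - resid z Res_ic_y (x, 0).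

Definition trace_residual_bound (M : R) (z : triple R m) : Prop :=
  [/\ lateral_holder2_le (pb_atlas (p := pb)) T beta (resid z Res_bc_y) M,
      lateral_holder2_le (pb_atlas (p := pb)) T beta (resid z Res_bc_lambda) M &
      holder2_le Om beta (fun x => resid z Res_T_lambda (x, 0)) M].

Definition local_neighborhood (zs : triple R m) (rho a b : R)
    (z : triple R m) : Prop :=
  (Linf_norm Q (fun p => st z p - st zs p)%R
   + Linf_norm Q (fun p => adj z p - adj zs p)%R <= rho%:E)%E /\
  forall p, closure Q p -> a <= st z p <= b.

Definition lipschitz_interval (zs : triple R m) (a b : R) : Prop :=
  (forall p, closure Q p -> a <= st zs p <= b) /\
  exists L, forall s t, a <= s <= b -> a <= t <= b ->
    `|f'' s - f'' t| <= L * `|s - t|.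

(** Stability *)

(* G is the spatial gradient of el *)
Definition error_norm (ey el : XT -> R) (G : 'I_m.+1 -> XT -> R)
    (eu : XT -> R) : \bar R :=
  ((L2sq muQ Q ey + (L2sq muQ Q el + \sum_(i < m.+1) L2sq muQ Q (G i))
    + L2sq muS Sigma eu) `^ 2^-1)%E.

Definition triple_error (zs z : triple R m) : \bar R :=
  let el := (fun p => adj zs p - adj z p) in
  error_norm (fun p => st zs p - st z p) el (fun i => dx i el)
             (fun p => ctl zs p - ctl z p).

Definition lin_a (zs : triple R m) : XT -> R := fun p => f' (st zs p).
Definition lin_kappa (zs : triple R m) : XT -> R :=
  fun p => f'' (st zs p) * adj zs p.
Definition M_a (zs : triple R m) : R := fine (Linf_norm Q (lin_a zs)).
Definition M_kappa (zs : triple R m) : R :=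
  sup [set `|lin_kappa zs p| | p in closure Q].

Definition alpha0 (C2 C3 : R) (zs : triple R m) : R :=
  4 * Num.sqrt 2 * nu * (1 + M_kappa zs) * Num.sqrt C2 * C3.

Definition linearized_solution (zs z : triple R m) (Fy Fl ey el : XT -> R)
    (G : 'I_m.+1 -> XT -> R) (eu : XT -> R) : Prop :=
  [/\ in_L2 muQ Q ey, in_L2 muS Sigma eu,
      transposition_solution ey (fun p => lin_a zs p * ey p) Fy
        (fun p => eu p - resid z Res_bc_y p) (err_y0 z) &
      exists q,
        variational_backward_solution (lin_a zs)
          (fun p => Fl p - (lin_kappa zs p + 1) * ey p)
          (fun p => - resid z Res_bc_lambda p)
          (fun x => - resid z Res_T_lambda (x, 0)) el G q /\
        L2norm muS Sigma
          (fun p => alpha * eu p + nu * q p + resid z Res_u p) = 0%E].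

Definition stability_constants (zs : triple R m)
    (H : nat -> set (triple R m)) (Cstab Cstab' : R) : Prop :=
  forall N z M, H N z -> trace_residual_bound M z ->
  forall Fy Fl, in_L2 muQ Q Fy -> in_L2 muQ Q Fl ->
  forall ey el G eu, linearized_solution zs z Fy Fl ey el G eu ->
  (error_norm ey el G eu <=
    Cstab%:E * (L2norm muO Om (err_y0 z) + L2norm muQ Q Fy + L2norm muQ Q Fl
                + L2norm muS Sigma (resid z Res_u)
                + L2norm muS Sigma (resid z Res_bc_y))
    + (Cstab' * M)%:E)%E.

Definition stability_radius (zs : triple R m) (H : nat -> set (triple R m))
    (a b Cstab Cstab' rho0 : R) : Prop :=
  forall N z M rho, H N z -> trace_residual_bound M z ->
  local_neighborhood zs rho a b z -> rho <= rho0 ->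
  (triple_error zs z <=
    (2 * Cstab)%:E * (L2norm muO Om (err_y0 z)
                      + L2norm muQ Q (resid z Res_y)
                      + L2norm muQ Q (resid z Res_lambda)
                      + L2norm muS Sigma (resid z Res_u)
                      + L2norm muS Sigma (resid z Res_bc_y))
    + (2 * Cstab' * M)%:E)%E.

(** Sampling and loss *)

Record collocation (W : Type) := Collocation {
  N_int : nat ; N_bc : nat ; N_ic : nat ; N_T : nat ;
  pt_int : 'I_N_int -> W -> XT ;
  pt_bc : 'I_N_bc -> W -> XT ;
  pt_ic : 'I_N_ic -> W -> X ;
  pt_T : 'I_N_T -> W -> X }.

Definition sample_size W (S : collocation W) (r : residual) : nat :=
  match r with
  | Res_y | Res_lambda => N_int S
  | Res_u | Res_bc_y | Res_bc_lambda => N_bc S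
  | Res_ic_y => N_ic S
  | Res_T_lambda => N_T S
  end.

Definition loss W (S : collocation W) (w : W) (z : triple R m) (r : residual) :
    R :=
  (match r with
   | Res_y | Res_lambda =>
       \sum_(j < N_int S) `|resid z r (pt_int (c := S) j w)| ^+ 2
   | Res_u | Res_bc_y | Res_bc_lambda =>
       \sum_(j < N_bc S) `|resid z r (pt_bc (c := S) j w)| ^+ 2
   | Res_ic_y => \sum_(j < N_ic S) `|resid z r (pt_ic (c := S) j w, 0)| ^+ 2
   | Res_T_lambda => \sum_(j < N_T S) `|resid z r (pt_T (c := S) j w, 0)| ^+ 2
   end) / (sample_size S r)%:R.

Definition loss_ind (wt : residual -> R) W (S : collocation W) (w : W)
    (z : triple R m) : R :=
  \sum_(r <- residuals) wt r * loss S w z r.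

Section space_filling.
Context {dW : measure_display} {W : measurableType dW} (P : probability W R).

Definition mutually_independent d (E : measurableType d) n (Z : 'I_n -> W -> E) :
    Prop :=
  forall A : 'I_n -> set E, (forall j, measurable (A j)) ->
    (P [set w | forall j, A j (Z j w)] = \prod_(j < n) P (Z j @^-1` A j))%E.

Definition bounded_density d (E : measurableType d) (D : set E) (rho : E -> R) :
    Prop :=
  measurable_fun D rho /\
  exists c1 c2, 0 < c1 /\ forall x, D x -> c1 <= rho x <= c2.

Definition has_density d (E : measurableType d) (mu : set E -> \bar R)
    (D : set E) (rho : E -> R) (Z : W -> E) : Prop :=
  [/\ measurable_fun setT Z, forall w, D (Z w) &
      forall A, measurable A ->
        (P (Z @^-1` A) = \int[mu]_(x in D `&` A) (rho x)%:E)%E].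

Definition iid_points d (E : measurableType d) (mu : set E -> \bar R)
    (D : set E) n (Z : 'I_n -> W -> E) : Prop :=
  mutually_independent Z /\
  exists rho, bounded_density D rho /\ forall j, has_density mu D rho (Z j).

(* The component of Sigma in which the j-th boundary point is drawn is the
   one over the connected component of the boundary of Omega containing
   site j; on each component, rho is the probability density of the points
   drawn there. *)
Definition stratified_points n
    (Z : 'I_n -> W -> 'rV[R]_m.+1 * measurableTypeR R) : Prop :=
  mutually_independent Z /\
  exists (site : 'I_n -> X) rho,
    let comp x := connected_component (boundary Om) x in
    [/\ forall j, boundary Om (site j),
        forall x, boundary Om x -> exists j, comp (site j) x,
        bounded_density (Sigma : set ('rV[R]_m.+1 * measurableTypeR R)) rho &
        forall j, has_density muS (comp (site j) `*` `]0, T[) rho (Z j)].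

Definition space_filling (S : collocation W) : Prop :=
  [/\ iid_points muQ Q (pt_int (c := S)), stratified_points (pt_bc (c := S)),
      iid_points muO Om (pt_ic (c := S)) & iid_points muO Om (pt_T (c := S))].

End space_filling.

(** Quadrature *)

Definition residual_L2avsq (z : triple R m) (r : residual) : \bar R :=
  match r with
  | Res_y | Res_lambda => L2avsq muQ Q (resid z r)
  | Res_u | Res_bc_y | Res_bc_lambda => L2avsq muS Sigma (resid z r)
  | Res_ic_y | Res_T_lambda => L2avsq muO Om (fun x => resid z r (x, 0))
  end.

Definition residual_domain (r : residual) : set XT :=
  match r with
  | Res_y | Res_lambda => Q
  | Res_u | Res_bc_y | Res_bc_lambda => Sigma
  | Res_ic_y | Res_T_lambda => Om `*` [set 0]
  end.

Definition residual_dim (r : residual) : nat :=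
  match r with Res_y | Res_lambda => m.+2 | _ => m.+1 end.

Definition residual_holder (z : triple R m) (r : residual) (b : R) : Prop :=
  exists L, forall p q, residual_domain r p -> residual_domain r q ->
    `|resid z r p - resid z r q| <=
      L * Num.sqrt (enorm (p.1 - q.1) ^+ 2 + (p.2 - q.2) ^+ 2) `^ b.

Definition quad_rate W (S : collocation W) (b : residual -> R) (r : residual) :
    R :=
  (sample_size S r)%:R `^ (- (b r / (residual_dim r)%:R)).

Definition failure_probability (n : nat) : R :=
  Num.sqrt n%:R * (1 - (Num.sqrt n%:R)^-1) ^+ n.

(* C n is the constant C_n of each residual; C' may depend on the network at
   hand, through the Hoelder seminorm of its residual. *)
Definition quadrature_constants {dW : measure_display} {W : measurableType dW}
    (P : probability W R) (S : collocation W) (b : residual -> R)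
    (zhat : W -> triple R m) (C : residual -> nat -> R)
    (C' : residual -> triple R m -> R) : Prop :=
  forall r : residual,
  [/\ 0 < b r <= 1 /\ forall w, residual_holder (zhat w) r (b r),
      (forall n, 0 <= C r n) /\
        exists K, forall n, (0 < n)%N -> C r n <= K * Num.sqrt n%:R,
      forall z, 0 <= C' r z &
      exists E : set W, [/\ measurable E,
        ((1 - failure_probability (sample_size S r))%:E <= P E)%E &
        forall w, E w ->
          (residual_L2avsq (zhat w) r <=
           (C r (sample_size S r) * loss S w (zhat w) r
            + C' r (zhat w) * quad_rate S b r)%:E)%E]].

Definition C_train W (S : collocation W) (C : residual -> nat -> R) : R :=
  \big[Num.max/0]_(r <- residuals) Num.sqrt (C r (sample_size S r)).

Definition quad_error W (S : collocation W) (b : residual -> R)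
    (C' : residual -> triple R m -> R) (z : triple R m) : R :=
  Num.sqrt (\sum_(r <- residuals) C' r z * quad_rate S b r).

End control_problem.

(* Main.v *)
Require Import Defs.
From HB Require Import structures.
From mathcomp Require Import all_boot all_order all_algebra.
From mathcomp Require Import all_classical all_reals all_analysis.
From mathcomp Require Import measurable_realfun.
From mathcomp Require Import zify ring lra.

(** Near-minimality of the empirical loss compares the trained network with
    every other network of the class, and the approximability assumption
    provides one, z, within e of the reference point in Sobolev norm, for any
    e above eps_net N.  Subtracting the KKT equations, each residual of z is
    at most a constant times e, hence so is the square root of every term of
    its empirical loss.  The losses of the trained network are therefore of
    order (eps_net N + eps_opt)^2; the quadrature inequalities, valid together
    outside an event whose probability is estimated by a union bound, turn
    them into bounds on the L^2 norms of the residuals, and the stability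
    estimate into a bound on the error.

    Two analytic points are hidden in this argument.

    The empirical loss samples residuals at points, whereas the Sobolev norm
    only controls weak derivatives almost everywhere.  Reference solution and
    networks have continuous classical derivatives in the open cylinder
    (Ck_tanh_network, C21_sub), and integration by parts against bump
    functions supported near a point shows that a continuous derivative is
    bounded at that point by any essential bound of the weak one
    (integration_by_parts_compact, weak_bound_pointwise,
    sobolev_C21_bounds).  Continuity then carries the bounds to the lateral
    boundary and to the initial and terminal times (closure_bound,
    ext_bound).

    The quadrature inequalities bound averages, and an average bounds an
    integral only over a domain of finite measure.  For the lateral boundary
    this requires the Hausdorff measure of the boundary of Omega to be
    finite.  Hausdorff measure is shown to be a measure on Borel sets by
    Caratheodory's criterion (caratheodory_halfspace), and the boundary is
    covered by finitely many Lipschitz images of cubes, one for each chart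
    (chart_param_lipschitz, lipschitz_image_lty). *)

Set Implicit Arguments.
Unset Strict Implicit.
Unset Printing Implicit Defensive.

Import Order.TTheory GRing.Theory Num.Theory.
Import numFieldNormedType.Exports.

Local Open Scope classical_set_scope.
Local Open Scope ring_scope.

(** * Borel sets of space-time *)

Section Borel.
Context {R : realType}.

Local Notation mXT n := ('rV[R]_n * measurableTypeR R)%type.

Lemma rational_approx (x e : R) : 0 < e -> exists q : rat, `|x - ratr q| < e.
Proof.
move=> e0; have /rat_in_itvoo[q] : x - e < x + e by lra.
rewrite in_itv /= => /andP[h1 h2]; exists q.
by rewrite ltr_norml; apply/andP; split; lra.
Qed.

Lemma ball_XT n (p q : 'rV[R]_n * R) (e : R) : 0 < e ->
  (forall i, `|p.1 ord0 i - q.1 ord0 i| < e) -> `|p.2 - q.2| < e -> ball p e q.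
Proof.
move=> e0 h1 h2; split => //; split => // i j.
by rewrite (ord1 i); exact: h1.
Qed.

(** The sigma-algebra is generated by coordinates, and an open set is the union
    of the countably many boxes with rational centre and radius 1/(k+1) that
    it contains. *)
Lemma open_measurable_XT n (U : set ('rV[R]_n * R)) :
  open U -> measurable (U : set (mXT n)).
Proof.
move=> oU.
pose B (c : 'rV[rat]_n * rat * nat) : set (mXT n) :=
  [set p : mXT n |
      (forall i, `|p.1 ord0 i - ratr (c.1.1 ord0 i)| < c.2.+1%:R^-1 :> R)
      /\ `|(p.2 : R) - ratr c.1.2| < c.2.+1%:R^-1 :> R].
pose B' c := if asbool (B c `<=` U) then B c else set0.
have -> : (U : set (mXT n)) = \bigcup_(c in setT) B' c.
  apply/seteqP; split => [p Up|p [c _]]; last first.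
    by rewrite /B'; case: asboolP => // + Bp; exact.
  have /nbhs_ballP[e /= e0 pU] : nbhs p U by exact: open_nbhs_nbhs.
  have e20 : 0 < e / 2 by rewrite divr_gt0.
  have [k _ /(_ k (leqnn k)) ke] := near_infty_natSinv_lt (PosNum e20).
  have k0 : 0 < k.+1%:R^-1 :> R by rewrite invr_gt0.
  have /choice[q hq] : forall i, exists q : rat,
    `|p.1 ord0 i - ratr q| < k.+1%:R^-1 by move=> i; exact: rational_approx.
  have [s hs] := rational_approx p.2 k0.
  exists ((\row_i q i), s, k) => //; rewrite /B'.
  case: asboolP => [_|]; first by split => // i; rewrite mxE.
  case=> z [z1 z2]; apply: pU; apply: ball_XT => //=.
    move=> i; have {}z1 := z1 i; have {}hq := hq i; rewrite mxE in z1.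
    rewrite [e]splitr; rewrite (le_lt_trans (ler_distD (ratr (q i)) _ _))//.
    apply: ltrD; first exact: lt_trans ke.
    by rewrite distrC; exact: lt_trans ke.
  rewrite [e]splitr; rewrite (le_lt_trans (ler_distD (ratr s) _ _))//.
  apply: ltrD; first exact: lt_trans ke.
  by rewrite distrC; exact: lt_trans ke.
apply: countable_bigcupT_measurable => // c; rewrite /B'; case: asboolP => // _.
have mint (a r : R) :
    measurable ([set x : R | `|x - a| < r] : set (measurableTypeR R)).
  suff -> : [set x : R | `|x - a| < r] = `]a - r, a + r[%classic by [].
  apply/seteqP; split => x /=; rewrite in_itv /= ltr_distl.
    by [].
  by [].
have -> : B c = (\bigcap_(i in setT) (fun p : mXT n => p.1 ord0 i : measurableTypeR R)
     @^-1` [set x : R | `|x - ratr (c.1.1 ord0 i)| < c.2.+1%:R^-1 :> R])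
   `&` snd @^-1` [set x : R | `|x - ratr c.1.2| < c.2.+1%:R^-1 :> R].
  by apply/seteqP; split => p [h1 h2]; split => // i; [move=> _; exact: h1|exact: h1].
apply: measurableI.
  apply: fin_bigcap_measurable; first exact: finite_finset.
  move=> i _; rewrite -[X in measurable X]setTI.
  by apply: (measurableT_comp (measurable_coord i) measurable_fst) => //; exact: mint.
by rewrite -[X in measurable X]setTI; apply: measurable_snd => //; exact: mint.
Qed.

Lemma continuous_measurable_XT n (v : 'rV[R]_n * R -> R) : continuous v ->
  measurable_fun [set: mXT n] (v : mXT n -> measurableTypeR R).
Proof.
move=> cv; apply: (measurability _ (RGenOpens.measurableE R)).
move=> _ [_ [a [b ->] <-]]; rewrite setTI; apply: open_measurable_XT.
by move/continuousP : cv; apply; exact: interval_open.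
Qed.

Lemma continuous_measurable_rV n (v : 'rV[R]_n -> R) : continuous v ->
  measurable_fun [set: 'rV[R]_n] (v : _ -> measurableTypeR R).
Proof.
move=> cv.
have cv1 : continuous (v \o (fst : 'rV[R]_n * R -> _)).
  by move=> p; apply: continuous_comp; [exact: cvg_fst|exact: cv].
have mpair : measurable_fun setT (fun x : 'rV[R]_n => (x, 0) : mXT n).
  by apply: measurable_fun_pair; [exact: measurable_id|exact: measurable_cst].
exact: (measurableT_comp (continuous_measurable_XT cv1) mpair).
Qed.

End Borel.

(** * Boxes *)

Section Boxes.
Context {R : realType}.
Local Open Scope ereal_scope.

Lemma lebesgue_rVS n (A : set 'rV[R]_n.+1) :
  lebesgue_rV n.+1 A =
  (@lebesgue_measure R \x lebesgue_rV n) (@cons_row R n @^-1` A).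
Proof. by []. Qed.

(** Balls of the sup norm, written coordinatewise so that they are products of
    intervals also in dimension 0. *)
Definition box n (c : 'rV[R]_n) (r : R) : set 'rV[R]_n :=
  [set x | forall i, (`|x ord0 i - c ord0 i| < r)%R].

Lemma measurable_interval (c r : R) :
  measurable ([set x : R | (`|x - c| < r)%R] : set (measurableTypeR R)).
Proof.
suff -> : [set x : R | (`|x - c| < r)%R] = `](c - r)%R, (c + r)%R[%classic by [].
by apply/seteqP; split => x /=; rewrite in_itv /= ltr_distl.
Qed.

Lemma lebesgue_interval (c r : R) : (0 < r)%R ->
  lebesgue_measure [set x : R | (`|x - c| < r)%R] = (r *+ 2)%:E.
Proof.
move=> r0.
have -> : [set x : R | (`|x - c| < r)%R] = `](c - r)%R, (c + r)%R[%classic.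
  by apply/seteqP; split => x /=; rewrite in_itv /= ltr_distl.
rewrite lebesgue_measure_itv /= lte_fin ifT; last by lra.
by rewrite -EFinB; congr EFin; rewrite mulr2n; ring.
Qed.

Lemma measurable_box n (c : 'rV[R]_n) r : measurable (box c r).
Proof.
have -> : box c r = \bigcap_(i in setT)
    (fun x : 'rV[R]_n => x ord0 i : measurableTypeR R) @^-1`
       [set x : R | (`|x - c ord0 i| < r)%R].
  by apply/seteqP; split => x h i; [move=> _; exact: h|exact: h].
apply: fin_bigcap_measurable; first exact: finite_finset.
move=> i _; rewrite -[X in measurable X]setTI.
by apply: (measurable_coord i) => //; exact: measurable_interval.
Qed.

Lemma cons_row_box n (c : 'rV[R]_n.+1) r :
  @cons_row R n @^-1` (box c r) =
  [set x : R | (`|x - c ord0 ord0| < r)%R] `*` box (uncons_row c).2 r.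
Proof.
apply/seteqP; split => [[x y] /= h|[x y] /= [h1 h2] i].
  split => /=; first by have := h ord0; rewrite mxE unlift_none.
  by move=> i; have := h (lift ord0 i); rewrite !mxE liftK.
rewrite mxE; case: unliftP => [j ->|->] //=.
by have := h2 j; rewrite /= mxE.
Qed.

(** By induction on the dimension, since cons_row maps the product of an interval
    and a box onto a box. *)
Lemma lebesgue_box n (c : 'rV[R]_n) r : (0 < r)%R ->
  lebesgue_rV n (box c r) = ((r *+ 2) ^+ n)%:E.
Proof.
move=> r0; elim: n c => [|n IH] c.
  by rewrite /= diracE mem_set// => -[].
rewrite lebesgue_rVS cons_row_box product_measure1E; last 2 first.
  exact: measurable_interval.
  exact: measurable_box.
by rewrite [X in X * _]lebesgue_interval// IH -EFinM exprS.
Qed.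

Lemma coord_le_norm n (x : 'rV[R]_n) i : (`|x ord0 i| <= `|x|)%R.
Proof.
rewrite [leRHS]mx_normrE.
exact: (le_bigmax _ (fun ij : 'I_1 * 'I_n => `|x ij.1 ij.2|%R) (ord0, i)).
Qed.

Lemma norm_le_coord n (x : 'rV[R]_n) M : (0 <= M)%R ->
  (forall i, (`|x ord0 i| <= M)%R) -> (`|x| <= M)%R.
Proof.
move=> M0 h; rewrite [leLHS]mx_normrE; apply: bigmax_le => // -[i j] _ /=.
by rewrite (ord1 i).
Qed.

Lemma bounded_box n (A : set 'rV[R]_n) : bounded_set A ->
  exists2 M : R, (0 < M)%R & A `<=` box 0%R M.
Proof.
move=> [M [Mreal AM]]; exists (`|M| + 2)%R; first by have := normr_ge0 M; lra.
move=> x Ax i; rewrite mxE subr0 (le_lt_trans (coord_le_norm x i))//.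
have := AM (`|M| + 1)%R; have := ler_norm M => h /(_ _ x Ax) /= h2.
by have := h2 ltac:(lra); lra.
Qed.

Lemma lebesgue_rV_bounded_lty n (A : set 'rV[R]_n) : measurable A ->
  bounded_set A -> lebesgue_rV n A < +oo.
Proof.
move=> mA /bounded_box[M M0 AM].
apply: (@le_lt_trans _ _ (lebesgue_rV n (box 0%R M))).
  by apply: le_measure => //; rewrite inE//; exact: measurable_box.
by rewrite lebesgue_box// ltry.
Qed.

Definition box_XT n (p : 'rV[R]_n * R) (r : R) : set ('rV[R]_n * R) :=
  box p.1 r `*` [set t | (`|t - p.2| < r)%R].

Lemma measurable_box_XT n (p : 'rV[R]_n * R) r :
  measurable (box_XT p r : set ('rV[R]_n * measurableTypeR R)).
Proof.
by apply: measurableX; [exact: measurable_box|exact: measurable_interval].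
Qed.

Lemma lebesgue_box_XT n (p : 'rV[R]_n * R) r : (0 < r)%R ->
  lebesgue_st n (box_XT p r) = ((r *+ 2) ^+ n.+1)%:E.
Proof.
move=> r0; rewrite /lebesgue_st product_measure1E; last 2 first.
  exact: measurable_box.
  exact: measurable_interval.
by rewrite [X in X * _]lebesgue_box// [X in _ * X]lebesgue_interval// -EFinM exprSr.
Qed.

End Boxes.

(** * Integrals of derivatives with compact support *)

Section Divergence.
Context {R : realType}.
Local Notation mXT n := ('rV[R]_n * measurableTypeR R)%type.

(** Only derivatives in the direction e are involved, which is what makes the
    notion stable under restriction to lines and slices parallel to e. *)
Definition C1_along (V : normedModType R) (e : V) (g : V -> R) : Prop :=
  [/\ continuous g, forall p, derivable g p e & continuous ('D_e g)].

(** Difference quotients along e in W are difference quotients along e' in V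
    when phi maps lines directed by e to lines directed by e'.  All chain rules
    for slices and lines are instances. *)
Lemma growth_rate_slice (V W : normedModType R) (phi : W -> V) (g : V -> R)
    (w e : W) (e' : V) :
  (forall h : R, phi (h *: e + w) = h *: e' + phi w) ->
  (fun h : R => h^-1 *: ((g \o phi \o shift w) (h *: e) - (g \o phi) w)) =
  (fun h => h^-1 *: ((g \o shift (phi w)) (h *: e') - g (phi w))).
Proof. by move=> hphi; apply/funext => h; rewrite /= /shift /= hphi. Qed.

Lemma C1_along_slice (V W : normedModType R) (phi : W -> V) (g : V -> R)
    (e : W) (e' : V) : continuous phi ->
  (forall (h : R) w, phi (h *: e + w) = h *: e' + phi w) ->
  C1_along e' g ->
  C1_along e (g \o phi) /\ 'D_e (g \o phi) = 'D_e' g \o phi.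
Proof.
move=> cphi hphi [cg dg cDg].
have DE : 'D_e (g \o phi) = 'D_e' g \o phi.
  apply/funext => w; rewrite /derive /=.
  by have /= -> := growth_rate_slice g (hphi^~ w).
split => //; split.
- by move=> w; apply: continuous_comp; [exact: cphi|exact: cg].
- move=> w; rewrite /derivable.
  by have -> := growth_rate_slice g (hphi^~ w); exact: dg.
- by rewrite DE => w; apply: continuous_comp; [exact: cphi|exact: cDg].
Qed.

Lemma derive_near0 (V : normedModType R) (e : V) (g : V -> R) p :
  (\near p, g p = 0) -> 'D_e g p = 0.
Proof.
move=> g0; rewrite (@near_eq_derive _ _ _ _ (cst 0)) ?derive_cst//.
Qed.

Lemma integrable_bounded_support d (T : measurableType d)
    (mu : {measure set T -> \bar R}) (A : set T) (k : T -> R) (C : R) :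
  measurable A -> (mu A < +oo)%E ->
  measurable_fun setT (k : T -> measurableTypeR R) ->
  (forall x, `|k x| <= C) -> (forall x, ~ A x -> k x = 0) ->
  mu.-integrable setT (EFin \o k).
Proof.
move=> mA Aoo mk kC k0.
have -> : EFin \o k = (EFin \o k) \_ A.
  by apply/funext => x; rewrite patchE; case: ifPn => //; rewrite notin_setE => /k0 /= ->.
apply: (integrable_mkcond (EFin \o k) mA).1.
apply: (measurable_bounded_integrable mA Aoo).
  exact: measurable_funTS.
exists C; split; first exact: num_real.
by move=> M CM x _ /=; rewrite (le_trans (kC x)) ?ltW.
Qed.

Lemma continuous_support_bounded n (k : 'rV[R]_n -> R) M : continuous k ->
  (forall x, ~ box 0 M x -> k x = 0) -> exists C, forall x, `|k x| <= C.
Proof.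
move=> ck k0.
have cK : compact [set x : 'rV[R]_n | forall i, `[- M, M]%classic (x ord0 i)].
  by apply: (@rV_compact R n (fun=> `[- M, M]%classic)) => i; exact: segment_compact.
have /compact_bounded [C [_ hC]] := continuous_compact (continuous_subspaceT ck) cK.
exists (`|C| + 1) => x.
have CC : C < `|C| + 1 by have := ler_norm C; lra.
have [Bx|/k0->] := pselect (box 0 M x).
  apply: (hC _ CC); exists x => // i.
  by have := Bx i; rewrite mxE subr0 /= in_itv/= ltr_norml => /andP[/ltW-> /ltW->].
by rewrite normr0 addr_ge0.
Qed.

Lemma continuous_support_bounded_XT n (k : 'rV[R]_n * R -> R) M : continuous k ->
  (forall x, ~ box_XT 0 M x -> k x = 0) -> exists C, forall x, `|k x| <= C.
Proof.
move=> ck k0.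
have cK : compact ([set x : 'rV[R]_n | forall i, `[- M, M]%classic (x ord0 i)]
    `*` `[- M, M]%classic).
  by apply: compact_setX; [apply: (@rV_compact R n (fun=> `[- M, M]%classic)) => i|]; exact: segment_compact.
have /compact_bounded [C [_ hC]] := continuous_compact (continuous_subspaceT ck) cK.
exists (`|C| + 1) => x.
have CC : C < `|C| + 1 by have := ler_norm C; lra.
have [[Bx Bt]|/k0->] := pselect (box_XT 0 M x).
  apply: (hC _ CC); exists x => //; split => [i|] /=.
    by have := Bx i; rewrite mxE subr0 /= in_itv/= ltr_norml => /andP[/ltW-> /ltW->].
  by move: Bt; rewrite /= subr0 in_itv/= ltr_norml => /andP[/ltW-> /ltW->].
by rewrite normr0 addr_ge0.
Qed.

(** The fundamental theorem of calculus on an interval containing the support. *)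
Lemma integral_derive0_R (g : R -> R) M : C1_along (1 : R) g ->
  (forall x, M < `|x| -> g x = 0) ->
  (\int[@lebesgue_measure R]_x ('D_1 g x)%:E = 0)%E.
Proof.
move=> [cg dg cDg] g0.
pose b := `|M| + 1; have b0 : 0 < b by rewrite /b; have := normr_ge0 M; lra.
have bM : M < b by rewrite /b; have := ler_norm M; lra.
have Dg0 x : M < `|x| -> 'D_1 g x = 0.
  move=> Mx; apply: derive_near0; near=> y; apply: g0.
  near: y; apply: (@cvgr_norm_gt _ _ _ _ _ id x) => //; exact: cvg_id.
have -> : (fun x => ('D_1 g x)%:E) = (fun x => ('D_1 g x)%:E) \_ `[- b, b].
  apply/funext => x; rewrite patchE; case: ifPn => //.
  rewrite notin_setE /= in_itv/= => /negP; rewrite -ler_norml -ltNge => h.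
  by rewrite Dg0// (lt_trans bM).
rewrite -integral_mkcond (@continuous_FTC2 _ _ g).
- by rewrite !g0 ?subee// ?normrN gtr0_norm.
- by lra.
- exact: continuous_subspaceT.
- split => [x _|| ]; [exact: dg| |].
    by apply: cvg_at_right_filter; exact: cg.
  by apply: cvg_at_left_filter; exact: cg.
- by move=> x _; rewrite derive1E.
Unshelve. all: by end_near. Qed.
End Divergence.

Section DivergenceProduct.
Context {R : realType}.
Local Notation mXT n := ('rV[R]_n * measurableTypeR R)%type.

Lemma cons_row_continuous n : continuous (@cons_row R n).
Proof.
move=> p A /nbhs_ballP[e /= e0 pA]; apply/nbhs_ballP; exists e => //=.
move=> q [h1 [_ h2]]; apply: pA; split => // i j.
by rewrite !mxE; case: unliftP => [k _|_] //=.
Qed.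

Lemma pair_continuousl (V W : topologicalType) (w : W) :
  continuous (fun v : V => (v, w)).
Proof. by move=> v; apply: cvg_pair; [exact: cvg_id|exact: cvg_cst]. Qed.

Lemma pair_continuousr (V W : topologicalType) (v : V) :
  continuous (fun w : W => (v, w)).
Proof. by move=> w; apply: cvg_pair; [exact: cvg_cst|exact: cvg_id]. Qed.

Lemma box_le n (x : 'rV[R]_n) M M' : M <= M' -> box 0 M x -> box 0 M' x.
Proof. by move=> MM h i; apply: lt_le_trans (h i) MM. Qed.

(** Outside a slightly larger box the function vanishes in a neighbourhood. *)
Lemma derive_support_rV n (e : 'rV[R]_n) (g : 'rV[R]_n -> R) M :
  (forall x, ~ box 0 M x -> g x = 0) ->
  forall x, ~ box 0 (M + 1) x -> 'D_e g x = 0.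
Proof.
move=> g0 x nx; apply: derive_near0.
apply/nbhs_ballP; exists 1 => //= y [_ xy]; apply: g0 => By; apply: nx => i.
have := By i; have := xy ord0 i; rewrite /ball /= !mxE !subr0 => h1 h2.
rewrite -(subrK (y ord0 i) (x ord0 i)) (le_lt_trans (ler_normD _ _))//.
by lra.
Qed.

Lemma derive_support_XT n (e : 'rV[R]_n * R) (g : 'rV[R]_n * R -> R) M :
  (forall x, ~ box_XT 0 M x -> g x = 0) ->
  forall x, ~ box_XT 0 (M + 1) x -> 'D_e g x = 0.
Proof.
move=> g0 x nx; apply: derive_near0.
apply/nbhs_ballP; exists 1 => //= y [[_ xy] xyt].
apply: g0 => -[By Byt]; apply: nx; split => /=.
  move=> i; have := By i; have := xy ord0 i; rewrite /ball /= !mxE !subr0 => h1 h2.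
  rewrite -(subrK (y.1 ord0 i) (x.1 ord0 i)) (le_lt_trans (ler_normD _ _))//.
  by lra.
move: Byt xyt; rewrite /ball /= !subr0 => h1 h2.
rewrite -(subrK y.2 x.2) (le_lt_trans (ler_normD _ _))//.
by lra.
Qed.

(** Moving along the first coordinate axis moves only the head of cons_row; the
    companion statement moves only its tail. *)
Lemma cons_row_delta0 n (y : 'rV[R]_n) (h r : R) :
  cons_row (h *: (1 : R) + r, y) = h *: delta_mx ord0 ord0 + cons_row (r, y).
Proof.
apply/rowP => i; rewrite !mxE; case: unliftP => [j ->|->] /=.
  by rewrite mulr0 add0r.
by [].
Qed.

Lemma cons_row_delta_lift n (y : 'rV[R]_n) (h r : R) i :
  cons_row (r, h *: delta_mx ord0 i + y) =
  h *: delta_mx ord0 (lift ord0 i) + cons_row (r, y).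
Proof.
apply/rowP => k; rewrite !mxE; case: unliftP => [j ->|->] /=.
  by rewrite !mxE (inj_eq lift_inj).
by rewrite mulr0 add0r.
Qed.

Lemma integrable_cons_row n (k : 'rV[R]_n.+1 -> R) M : continuous k ->
  (forall x, ~ box 0 M x -> k x = 0) ->
  (@lebesgue_measure R \x lebesgue_rV n)%E.-integrable setT
    (EFin \o k \o @cons_row R n).
Proof.
move=> ck k0; have [C kC] := continuous_support_bounded ck k0.
apply: (@integrable_bounded_support R _ (measurableTypeR R * 'rV[R]_n)%type
  (@lebesgue_measure R \x lebesgue_rV n)%E
  ([set r : R | `|r| < `|M| + 1] `*` box 0 (`|M| + 1)) (k \o @cons_row R n) C) => //.
- apply: measurableX; last exact: measurable_box.
  have := measurable_interval 0 (`|M| + 1); congr (measurable _).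
  by apply/funext => x /=; rewrite subr0.
- have M0 : 0 < `|M| + 1 by rewrite ltr_wpDl.
  have -> : [set r : R | `|r| < `|M| + 1] = [set r : R | `|r - 0| < `|M| + 1].
    by apply/funext => x /=; rewrite subr0.
  rewrite [X in (X < _)%E]product_measure1E; last 2 first.
    exact: measurable_interval.
    exact: measurable_box.
  by rewrite [X in (X * _)%E]lebesgue_interval// lebesgue_box// -EFinM ltry.
- exact: (measurableT_comp (continuous_measurable_rV ck) (@measurable_cons_row R n)).
- by move=> p; exact: kC.
- move=> [r y] /= nry; apply: k0 => h; apply: nry.
  have h' : box 0 (`|M| + 1) (cons_row (r, y)).
    by apply: box_le h; have := ler_norm M; lra.
  split => /=; first by have := h' ord0; rewrite !mxE unlift_none subr0.
  by move=> i; have := h' (lift ord0 i); rewrite !mxE liftK.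
Qed.

Lemma integral_lebesgue_rVS n (k : 'rV[R]_n.+1 -> R) M : continuous k ->
  (forall x, ~ box 0 M x -> k x = 0) ->
  (\int[lebesgue_rV n.+1]_x (k x)%:E =
   \int[@lebesgue_measure R \x lebesgue_rV n]_p (k (cons_row p))%:E)%E.
Proof.
move=> ck k0; rewrite /= /leb_step.
rewrite (integral_pushforward (@measurable_cons_row R n)) ?preimage_setT//.
  by apply/measurable_EFinP; exact: continuous_measurable_rV.
exact: (integrable_cons_row ck k0).
Qed.

(** By induction on the dimension and Fubini's theorem: integrate first in the
    variable r when the direction is the first axis, and first in the remaining
    coordinates otherwise. *)
Lemma integral_derive0_rV n i (g : 'rV[R]_n -> R) M :
  C1_along (delta_mx ord0 i) g -> (forall x, ~ box 0 M x -> g x = 0) ->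
  (\int[lebesgue_rV n]_x ('D_(delta_mx ord0 i) g x)%:E = 0)%E.
Proof.
elim: n i g => [[]//|n IH] i g C1 g0.
have [cg dg cDg] := C1.
have D0 := @derive_support_rV _ (delta_mx ord0 i) _ _ g0.
have int := integrable_cons_row cDg D0.
rewrite (integral_lebesgue_rVS cDg D0).
have [j ij|i0] := unliftP ord0 i; last first.
  rewrite -integral21_prod_meas1//; apply: integral0_eq => y _.
  pose phi (r : R) := cons_row (r, y) : 'rV[R]_n.+1.
  have cphi : continuous phi.
    by move=> r; apply: continuous_comp; [exact: pair_continuousl|exact: cons_row_continuous].
  have [C1' DE] := @C1_along_slice R _ _ phi g (1 : R) (delta_mx ord0 i) cphi
     ltac:(by move=> h r; rewrite i0; exact: cons_row_delta0) C1.
  rewrite -[RHS](@integral_derive0_R R _ `|M| C1').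
    by apply: eq_integral => r _; congr EFin; exact: (esym (congr1 (@^~ r) DE)).
  move=> r Mr /=.
  apply: g0 => /(_ ord0); rewrite !mxE unlift_none/= subr0 => rM.
  by have := ler_norm M; lra.
rewrite -integral12_prod_meas1//; apply: integral0_eq => r _.
pose phi y := cons_row (r, y) : 'rV[R]_n.+1.
have cphi : continuous phi.
  by move=> y; apply: continuous_comp; [exact: pair_continuousr|exact: cons_row_continuous].
have [C1' DE] := @C1_along_slice R _ _ phi g (delta_mx ord0 j) (delta_mx ord0 i) cphi
     ltac:(by move=> h y; rewrite ij; exact: cons_row_delta_lift) C1.
rewrite -[RHS](IH j _ C1').
  by apply: eq_integral => y _; congr EFin; exact: (esym (congr1 (@^~ y) DE)).
move=> y ny /=.
apply: g0 => B; apply: ny => k.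
by have := B (lift ord0 k); rewrite !mxE liftK.
Qed.

Lemma integrable_XT n (k : 'rV[R]_n * R -> R) M : continuous k ->
  (forall x, ~ box_XT 0 M x -> k x = 0) ->
  (lebesgue_st n).-integrable setT (EFin \o k).
Proof.
move=> ck k0; have [C kC] := continuous_support_bounded_XT ck k0.
apply: (@integrable_bounded_support R _ (mXT n) (lebesgue_st n)
  (box_XT 0 (`|M| + 1)) k C) => //.
- exact: measurable_box_XT.
- by rewrite [X in (X < _)%E]lebesgue_box_XT ?ltry// ltr_wpDl.
- exact: continuous_measurable_XT.
- move=> x nx; apply: k0 => -[h1 h2]; apply: nx.
  have MM : M <= `|M| + 1 by have := ler_norm M; lra.
  by split; [exact: box_le h1|exact: lt_le_trans MM].
Qed.

(** Fubini's theorem again, the inner integral running over the factor that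
    contains the direction. *)
Lemma integral_derive0_XT n (o : option 'I_n) (g : 'rV[R]_n * R -> R) M :
  C1_along (dir o) g -> (forall x, ~ box_XT 0 M x -> g x = 0) ->
  (\int[lebesgue_st n]_p ('D_(dir o) g p)%:E = 0)%E.
Proof.
move=> C1 g0; have [cg dg cDg] := C1.
have int := integrable_XT cDg (@derive_support_XT n (dir o) g M g0).
case: o => [i|] in C1 dg cDg int *; rewrite /lebesgue_st.
  rewrite -integral21_prod_meas1//; apply: integral0_eq => t _.
  have [C1' DE] := @C1_along_slice R _ _ (fun x => (x, t)) g (delta_mx ord0 i)
    (dir (Some i)) (@pair_continuousl _ _ t)
    ltac:(by move=> h x; congr pair; rewrite /= scaler0 add0r) C1.
  rewrite -[RHS](integral_derive0_rV (M := M) C1').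
    by apply: eq_integral => x _; congr EFin; exact: (esym (congr1 (@^~ x) DE)).
  move=> x nx /=.
  by apply: g0 => -[].
rewrite -integral12_prod_meas1//; apply: integral0_eq => x _.
have [C1' DE] := @C1_along_slice R _ _ (fun t : R => (x, t)) g (1 : R)
    (dir None) (@pair_continuousr _ _ x)
    ltac:(by move=> h t; congr pair; rewrite /= scaler0 add0r) C1.
rewrite -[RHS](@integral_derive0_R R _ `|M| C1').
  by apply: eq_integral => t _; congr EFin; exact: (esym (congr1 (@^~ t) DE)).
move=> t Mt /=.
apply: g0 => -[_] /=; rewrite subr0 => tM.
by have := ler_norm M; lra.
Qed.

End DivergenceProduct.

(** * Directional smoothness *)

Section Ck.
Context {R : realType}.

(** Functions with continuous iterated derivatives up to order k in the
    directions e i.  Partial derivatives suffice for the weak formulations, and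
    the recursion on k makes closure under the algebraic operations immediate. *)
Fixpoint Ck (V : normedModType R) (I : Type) (e : I -> V) (k : nat) (v : V -> R)
    : Prop :=
  continuous v /\
  if k is k'.+1 then
    forall i, (forall p, derivable v p (e i)) /\ Ck e k' ('D_(e i) v)
  else True.

Section CkTheory.
Context (V : normedModType R) (I : Type) (e : I -> V).
Implicit Types (k : nat) (u v : V -> R).

Lemma Ck_continuous k v : Ck e k v -> continuous v.
Proof. by case: k => [|k] []. Qed.

Lemma CkS k v : continuous v ->
  (forall i, exists2 w : V -> R, forall p, is_derive p (e i) v (w p) & Ck e k w) ->
  Ck e k.+1 v.
Proof.
move=> cv h; split => // i; have [w dw Cw] := h i.
have -> : 'D_(e i) v = w by apply/funext => p; have dwp := dw p; rewrite derive_val.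
by split => // p; have [] := dw p.
Qed.

Lemma CkSW k v : Ck e k.+1 v -> Ck e k v.
Proof.
elim: k v => [|k IH] v; first by case.
by move=> [cv dv]; split => // i; have [d1 d2] := dv i; split => //; exact: IH.
Qed.

Lemma Ck_cst k (c : R) : Ck e k (cst c).
Proof.
elim: k c => [|k IH] c; first by split => //; exact: cst_continuous.
apply: CkS; first exact: cst_continuous.
by move=> i; exists (cst 0) => //; move=> p; exact: is_derive_cst.
Qed.

Lemma CkD k u v : Ck e k u -> Ck e k v -> Ck e k (fun p => u p + v p).
Proof.
elim: k u v => [|k IH] u v.
  by move=> [cu _] [cv _]; split => // p; apply: continuousD; [exact: cu|exact: cv].
move=> [cu du] [cv dv]; apply: CkS.
  by move=> p; apply: continuousD; [exact: cu|exact: cv].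
move=> i; have [du1 du2] := du i; have [dv1 dv2] := dv i.
exists (fun p => 'D_(e i) u p + 'D_(e i) v p); last exact: IH.
by move=> p; apply: is_deriveD; exact/derivableP.
Qed.

Lemma CkM k u v : Ck e k u -> Ck e k v -> Ck e k (fun p => u p * v p).
Proof.
elim: k u v => [|k IH] u v.
  by move=> [cu _] [cv _]; split => // p; apply: continuousM; [exact: cu|exact: cv].
move=> Cu Cv; have [cu du] := Cu; have [cv dv] := Cv; apply: CkS.
  by move=> p; apply: continuousM; [exact: cu|exact: cv].
move=> i; have [du1 du2] := du i; have [dv1 dv2] := dv i.
exists (fun p => u p * 'D_(e i) v p + v p * 'D_(e i) u p).
  by move=> p; apply: is_deriveM; exact/derivableP.
by apply: CkD; apply: IH => //; exact: CkSW.
Qed.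

Lemma Ck_sum k (J : Type) (r : seq J) (F : J -> V -> R) :
  (forall j, Ck e k (F j)) -> Ck e k (fun p => \sum_(j <- r) F j p).
Proof.
move=> CF; elim: r => [|j r IH].
  by under eq_fun do rewrite big_nil; exact: Ck_cst.
by under eq_fun do rewrite big_cons; exact: CkD.
Qed.

Lemma Ck_linear k (l : V -> R) : continuous l ->
  (forall (h : R) x y, l (h *: x + y) = h * l x + l y) -> Ck e k l.
Proof.
move=> cl hl; case: k => [|k]; first by split.
apply: CkS => // i; exists (cst (l (e i))); last exact: Ck_cst.
move=> p.
have lim0 : (fun h : R => h^-1 *: ((l \o shift p) (h *: e i) - l p)) @ 0^'
    --> l (e i).
  apply: cvg_near_cst; near=> h.
  have h0 : h != 0 by near: h; exact: nbhs_dnbhs_neq.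
  by rewrite /= /shift /= hl addrK /GRing.scale /= mulKf.
by apply: DeriveDef; [apply/cvg_ex; exists (l (e i))|exact: cvg_lim lim0].
Unshelve. all: by end_near. Qed.

(** The single direction of the real line, so that functions of one variable are
    an instance of Ck. *)
Definition along1 (_ : unit) : R := 1.

(** On the line through p directed by d this is the chain rule in one variable. *)
Lemma is_derive_along (v : V -> R) (F : R -> R) p d :
  derivable v p d -> derivable F (v p) 1 ->
  is_derive p d (F \o v) ('D_1 F (v p) * 'D_d v p).
Proof.
move=> dv dF.
pose psi (h : R) := h *: d + p : V.
have psi0 : psi 0 = p by rewrite /psi scale0r add0r.
have hpsi (h : R) : psi (h *: (1 : R) + 0) = h *: d + psi 0.
  by rewrite psi0 /psi addr0 [h *: 1]mulr1.
have rv := growth_rate_slice v hpsi.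
have rF := growth_rate_slice (F \o v) hpsi.
rewrite psi0 in rv rF.
have dw : derivable (v \o psi) 0 1 by rewrite /derivable rv; exact: dv.
have dF' : derivable F ((v \o psi) 0) 1 by rewrite /= psi0.
have := derive1_comp dw dF'; rewrite !derive1E /= psi0 => E.
apply: DeriveDef.
  have dc : derivable (F \o v \o psi) 0 1.
    apply/derivable1_diffP; apply: (@differentiable_comp _ _ _ _ (v \o psi) F).
      exact/derivable1_diffP.
    exact/derivable1_diffP.
  by rewrite /derivable -rF; exact: dc.
have -> : 'D_d (F \o v) p = 'D_1 (F \o v \o psi) 0 by rewrite /derive rF.
rewrite -[RHS](_ : 'D_1 F (v p) * 'D_1 (v \o psi) 0 = _).
  exact: E.
by congr (_ * _); rewrite /derive rv.
Qed.

End CkTheory.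

Lemma Ck_comp (V : normedModType R) (I : Type) (e : I -> V) k (F : R -> R) v :
  Ck along1 k F -> Ck e k v -> Ck e k (F \o v).
Proof.
elim: k F v => [|k IH] F v.
  by move=> [cF _] [cv _]; split => // p; apply: continuous_comp; [exact: cv|exact: cF].
move=> CF Cv; have [cF /(_ tt) [dF1 dF2]] := CF; have [cv dv] := Cv.
apply: CkS.
  by move=> p; apply: continuous_comp; [exact: cv|exact: cF].
move=> i; have [dv1 dv2] := dv i.
exists (fun p => ('D_1 F \o v) p * 'D_(e i) v p).
  by move=> p; apply: is_derive_along; [exact: dv1|exact: dF1].
by apply: CkM => //; apply: IH => //; exact: CkSW.
Qed.

(** The derivative of tanh is 1 - tanh^2, a polynomial in tanh. *)
Lemma Ck_tanh k : Ck along1 k (@tanh R).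
Proof.
have ep x : 0 < expR x + expR (- x) :> R by rewrite addr_gt0 ?expR_gt0.
have dE (x : R) : is_derive x 1 (fun x : R => expR (- x)) (- expR (- x)).
  by apply: is_derive_eq; rewrite mulrN mulr1.
have dth (x : R) : is_derive x 1 (@tanh R) (1 + (-1) * (tanh x * tanh x)).
  have e0 : (fun x : R => expR x + expR (- x)) x != 0 by rewrite gt_eqF ?ep.
  have d1 : is_derive x 1 (fun x : R => expR x - expR (- x)) (expR x + expR (- x)).
    by apply: is_derive_eq; rewrite opprK.
  have d2 : is_derive x 1 (fun x : R => expR x + expR (- x)) (expR x - expR (- x)).
    exact: is_derive_eq.
  have d3 : is_derive x 1 (fun x : R => (expR x + expR (- x))^-1)
      (- (expR x + expR (- x)) ^- 2 *: (expR x - expR (- x))).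
    have [d2' <-] := d2; apply: DeriveDef; first exact: derivableV.
    exact: deriveV.
    have [d4 d5] := is_deriveM d1 d3; apply: DeriveDef; [exact: d4|rewrite [LHS]d5].
  by rewrite /tanh /GRing.scale /=; field; rewrite gt_eqF ?ep.
have cth : continuous (@tanh R).
  move=> x; apply: differentiable_continuous; apply/derivable1_diffP.
  by have [] := dth x.
elim: k => [|k IH]; first by split.
apply: CkS => // -[]; exists (fun x => cst 1 x + cst (-1) x * (tanh x * tanh x)).
  by move=> x; exact: dth.
by apply: CkD; [exact: Ck_cst|apply: CkM; [exact: Ck_cst|exact: CkM]].
Qed.

(** The derivative of max(0, s)^(k+2) is (k+2) max(0, s)^(k+1); at 0 the
    difference quotient is itself a positive power of max(0, h), up to sign. *)
Lemma Ck_pospow k : Ck along1 k (fun s : R => Num.max 0 s ^+ k.+1).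
Proof.
have cm n : continuous (fun s : R => Num.max 0 s ^+ n).
  move=> s; apply: (@continuous_comp _ _ _ (fun s : R => Num.max 0 s) (fun s => s ^+ n)).
    by apply: continuous_max; [exact: cvg_cst|exact: cvg_id].
  exact: exprn_continuous.
elim: k => [|k IH]; first by split.
apply: CkS => // -[].
exists (fun s => cst k.+2%:R s * Num.max 0 s ^+ k.+1); last first.
  by apply: CkM => //; exact: Ck_cst.
move=> s; have [s0|s0|s0] : [\/ s < 0, s > 0 | s = 0].
  by case: (ltgtP s 0); [constructor 1|constructor 2|constructor 3].
- rewrite (max_l (ltW s0)) expr0n mulr0.
  apply: (@near_eq_is_derive _ _ _ (cst 0)).
  near=> x; rewrite max_l ?expr0n// ltW//; near: x.
  by apply: (@cvgr_lt _ _ _ _ id s) => //; exact: cvg_id.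
- rewrite (max_r (ltW s0)).
  have h : is_derive s 1 (fun x : R => x ^+ k.+2) (k.+2%:R * s ^+ k.+1).
    by apply: DeriveDef; [exact: exprn_derivable|rewrite exp_derive [LHS]mulr1].
  apply: (near_eq_is_derive _ h); near=> x; rewrite max_r// ltW//; near: x.
  by apply: (@cvgr_gt _ _ _ _ id s) => //; exact: cvg_id.
rewrite s0 maxxx expr0n mulr0.
have lim0 : (fun h : R => h^-1 *: (((fun s : R => Num.max 0 s ^+ k.+2) \o shift (0 : R))
      (h *: (1 : R))
     - Num.max 0 (0 : R) ^+ k.+2)) @ 0^' --> (0 : R).
  apply: (@cvg_trans _ ((fun h : R => Num.max 0 h ^+ k.+1) @ 0^')).
    apply: near_eq_cvg; near=> h.
    have h0 : h != 0 by near: h; exact: nbhs_dnbhs_neq.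
    rewrite /= /shift /= addr0 maxxx expr0n subr0 [h *: 1]mulr1 /GRing.scale /=.
    have [hp|hn] : h < 0 \/ 0 < h by apply/orP; rewrite -neq_lt.
      by rewrite (max_l (ltW hp)) !expr0n mulr0.
    by rewrite (max_r (ltW hn)) [in RHS]exprS mulKf.
  have := cm k.+1 0; rewrite /continuous_at maxxx expr0n.
  exact: cvg_within_filter.
by apply: DeriveDef; [apply/cvg_ex; exists 0|exact: cvg_lim lim0].
Unshelve. all: by end_near. Qed.

End Ck.

(** * Networks and bump functions *)

Section SmoothNetworks.
Context {R : realType}.

(** The induction is on the layers, with arbitrary functions of class C^k fed into
    the first one: the next layer then receives functions of the same kind. *)
Lemma Ck_mlp_eval (V : normedModType R) (I : Type) (e : I -> V) k n
    (net : mlp n) (a : V -> 'rV[R]_n) :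
  (forall j, Ck e k (fun p => a p ord0 j)) -> Ck e k (fun p => mlp_eval net (a p)).
Proof.
elim: net a => [{}n W b|{}n l W b rest IH] a Ca /=.
  apply: CkD; last exact: Ck_cst.
  under eq_fun do rewrite mxE.
  by apply: Ck_sum => j; apply: CkM => //; exact: Ck_cst.
apply: IH => j; under eq_fun do rewrite mxE.
apply: (Ck_comp (Ck_tanh k)); under eq_fun do rewrite !mxE.
apply: CkD; last exact: Ck_cst.
by apply: Ck_sum => i; apply: CkM => //; exact: Ck_cst.
Qed.

Lemma Ck_time n k : Ck (@dir R n) k (fun p => p.2).
Proof. by apply: Ck_linear => // p; exact: cvg_snd. Qed.

Lemma Ck_space n k i : Ck (@dir R n) k (fun p => p.1 ord0 i).
Proof.
apply: Ck_linear => [p|h x y]; last by rewrite !mxE.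
apply: (@continuous_comp _ _ _ fst (fun x : 'rV[R]_n => x ord0 i)).
  exact: cvg_fst.
exact: coord_continuous.
Qed.

Lemma Ck_tanh_network n k (v : 'rV[R]_n * R -> R) :
  is_tanh_network v -> Ck (@dir R n) k v.
Proof.
move=> [net vE]; have -> : v = fun p => mlp_eval net (cons_row (p.2, p.1)).
  exact/funext.
apply: Ck_mlp_eval => j; under eq_fun do rewrite mxE.
case: unliftP => [i _|_] /=; [exact: Ck_space|exact: Ck_time].
Qed.

(** Ck differentiates from the inside and diter from the outside, whence the
    induction on s from the right. *)
Lemma Ck_diter n k (v : 'rV[R]_n * R -> R) : Ck (@dir R n) k v ->
  (forall s, (size s <= k)%N -> continuous (diter s v)) /\
  (forall s i p, (size s < k)%N -> derivable (diter s v) p (dir i)).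
Proof.
elim: k v => [|k IH] v.
  by move=> [cv _]; split => // -[].
move=> [cv dv]; split => s; elim/last_ind: s => [|s i _] //.
- rewrite size_rcons ltnS => sk.
  rewrite /diter -cats1 foldr_cat /=.
  by have [_ Cd] := dv i; have [+ _] := IH _ Cd; apply.
- by move=> i p _; have [d _] := dv i; exact: d.
- move=> j p; rewrite size_rcons ltnS => sk.
  rewrite /diter -cats1 foldr_cat /=.
  by have [_ Cd] := dv i; have [_ +] := IH _ Cd; apply.
Qed.

Lemma Ck_C21 n (v : 'rV[R]_n * R -> R) U : Ck (@dir R n) 2 v -> C21 U v.
Proof.
move=> Cv; have [cv dv] := Cv; split.
  move=> p _; have [d1 [d2 _]] := dv None; split => //.
  - exact: cv.
  - exact: d2.
  - by move=> i; have [e1 [e2 _]] := dv (Some i); split; [exact: e1|exact: e2].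
move=> p _ i j; have [_ [_ e2]] := dv (Some i).
by have [f1 [f2 _]] := e2 (Some j); split; [exact: f1|exact: f2].
Qed.

End SmoothNetworks.

Section Bump.
Context {R : realType} {n : nat}.
Implicit Types (p q : 'rV[R]_n * R).

Definition sqdist p q : R :=
  \sum_(i < n) (q.1 ord0 i - p.1 ord0 i) ^+ 2 + (q.2 - p.2) ^+ 2.

(** A polynomial cut off at the sphere of radius r, raised to the power that makes
    it of class C^k. *)
Definition bump k p (r : R) q : R := Num.max 0 (r ^+ 2 - sqdist p q) ^+ k.+1.

Lemma Ck_bump k p r : Ck (@dir R n) k (bump k p r).
Proof.
apply: (Ck_comp (Ck_pospow k)).
apply: CkD; first exact: Ck_cst.
under eq_fun do rewrite -mulN1r.
apply: CkM; first exact: Ck_cst.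
apply: CkD; last first.
  under eq_fun do rewrite expr2.
  by apply: CkM; apply: CkD; (exact: Ck_time || exact: Ck_cst).
apply: Ck_sum => i; under eq_fun do rewrite expr2.
by apply: CkM; apply: CkD; (exact: Ck_space || exact: Ck_cst).
Qed.

Lemma bump_ge0 k p r q : 0 <= bump k p r q.
Proof. by rewrite /bump exprn_ge0// le_max lexx. Qed.

Lemma bump_out k p r q : 0 < r -> ~ box_XT p r q -> bump k p r q = 0.
Proof.
move=> r0 nq; rewrite /bump max_l ?expr0n// subr_le0 leNgt; apply/negP => d.
apply: nq; split => [i|] /=.
  rewrite -(ltr_pXn2r (n := 2))// ?nnegrE ?ltW// real_normK ?num_real//.
  apply: le_lt_trans d; rewrite /sqdist (bigD1 i)//= -addrA lerDl.
  by rewrite addr_ge0 ?sqr_ge0// sumr_ge0// => j _; exact: sqr_ge0.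
rewrite -(ltr_pXn2r (n := 2))// ?nnegrE ?ltW// real_normK ?num_real//.
apply: le_lt_trans d; rewrite /sqdist lerDr.
by rewrite sumr_ge0// => j _; exact: sqr_ge0.
Qed.

(** On a box of half-width s = r / (2 (n + 1)) the squared distance to p is at most
    (n + 1) s^2 <= r^2 / 2. *)
Lemma bump_in k p r : 0 < r -> exists2 s, 0 < s &
  exists2 c, 0 < c & forall q, box_XT p s q -> c <= bump k p r q.
Proof.
move=> r0; pose s := r / (2 * n.+1%:R).
have n0 : 0 < n.+1%:R :> R by rewrite ltr0n.
have n1 : 1 <= n.+1%:R :> R by rewrite ler1n.
have s0 : 0 < s by rewrite divr_gt0// mulr_gt0.
exists s => //; exists ((r ^+ 2 / 2) ^+ k.+1).
  by rewrite exprn_gt0// divr_gt0// exprn_gt0.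
move=> q [h1 h2].
have hs : sqdist p q <= n.+1%:R * s ^+ 2.
  rewrite -natr1 mulrDl mul1r; apply: lerD.
    rewrite mulr_natl -[n in _ *+ n]card_ord -sumr_const; apply: ler_sum => i _.
    by rewrite -real_normK ?num_real// lerXn2r ?nnegrE// ltW//; exact: h1.
  by rewrite -real_normK ?num_real// lerXn2r ?nnegrE// ltW//; exact: h2.
have hs2 : n.+1%:R * s ^+ 2 <= r ^+ 2 / 2.
  have -> : n.+1%:R * s ^+ 2 = (r ^+ 2 / 4) / n.+1%:R.
    by rewrite /s; field; rewrite gt_eqF.
  rewrite ler_pdivrMr//.
  have : r ^+ 2 * 1 <= r ^+ 2 * n.+1%:R by rewrite ler_pM2l// exprn_gt0.
  by rewrite mulr1; have := exprn_gt0 2 r0; lra.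
rewrite /bump lerXn2r ?nnegrE//.
- by rewrite divr_ge0// sqr_ge0.
- by rewrite le_max lexx.
- by rewrite le_max; apply/orP; right; lra.
Qed.

Lemma box_XT_sub_nbhs p (U : set ('rV[R]_n * R)) : nbhs p U ->
  exists2 r, 0 < r &
    exists K, [/\ compact K, K `<=` U & box_XT p r `<=` K].
Proof.
move=> /nbhs_ballP[e /= e0 pU]; exists (e / 2); first by rewrite divr_gt0.
exists ([set x : 'rV[R]_n | forall i,
          `[p.1 ord0 i - e / 2, p.1 ord0 i + e / 2]%classic (x ord0 i)]
        `*` `[p.2 - e / 2, p.2 + e / 2]%classic); split.
- apply: compact_setX; last exact: segment_compact.
  apply: (@rV_compact R n
    (fun i => `[p.1 ord0 i - e / 2, p.1 ord0 i + e / 2]%classic)) => i.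
  exact: segment_compact.
- move=> q [h1 h2]; apply: pU; apply: ball_XT => //.
    move=> i; have := h1 i; rewrite /= in_itv/= => /andP[a b].
    by rewrite ltr_norml; apply/andP; split; lra.
  move: h2; rewrite /= in_itv/= => /andP[a b].
  by rewrite ltr_norml; apply/andP; split; lra.
- move=> q [h1 h2]; split => [i|]; rewrite /= in_itv/=.
    by have := h1 i; rewrite ltr_distl => /andP[/ltW-> /ltW->].
  by move: h2; rewrite /= ltr_distl => /andP[/ltW-> /ltW->].
Qed.

Lemma test_bump k p (U : set ('rV[R]_n * R)) : nbhs p U ->
  exists2 r, 0 < r & test_function U k (bump k p r).
Proof.
move=> /box_XT_sub_nbhs[r r0 [K [cK KU rK]]]; exists r => //.
have [h1 h2] := Ck_diter (Ck_bump k p r); split => //.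
by exists K; split => // q nq; apply: bump_out => // /rK.
Qed.

End Bump.

(** * Weak derivatives bound classical ones *)

Section WeakToClassical.
Context {R : realType} {n : nat}.
Local Notation XT := ('rV[R]_n * R)%type.
Local Notation mXT := ('rV[R]_n * measurableTypeR R)%type.
Local Notation mu := (lebesgue_st n).
Implicit Types (U K : set XT) (v phi : XT -> R).

Lemma near_off_compact K p : compact K -> ~ K p -> \near p, ~ K p.
Proof.
move=> cK nKp.
have cl : closed K by apply: compact_closed => //; exact: norm_hausdorff.
by apply: open_nbhs_nbhs; split => //; exact: closed_openC.
Qed.

Lemma continuous_cutoff U K v phi : open U -> compact K -> K `<=` U ->
  (forall p, U p -> {for p, continuous v}) -> continuous phi ->
  (forall p, ~ K p -> phi p = 0) -> continuous (fun p => v p * phi p).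
Proof.
move=> oU cK KU cv cphi phi0 p.
have [Up|nUp] := pselect (U p).
  by apply: continuousM; [exact: cv|exact: cphi].
have nKp : ~ K p by move/KU.
have near0 : \near p, 0 = v p * phi p.
  by apply: filterS (near_off_compact cK nKp) => q /phi0 ->; rewrite mulr0.
rewrite /continuous_at (phi0 _ nKp) mulr0.
by apply: cvg_trans; [apply: near_eq_cvg near0|exact: cvg_cst].
Qed.

Lemma derive_off_compact K phi (e : XT) : compact K ->
  (forall p, ~ K p -> phi p = 0) -> forall p, ~ K p -> 'D_e phi p = 0.
Proof.
move=> cK phi0 p nKp; apply: derive_near0.
by apply: filterS (near_off_compact cK nKp) => q; exact: phi0.
Qed.

Lemma compact_box K : compact K -> exists M, forall p, ~ box_XT 0 M p -> ~ K p.
Proof.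
move=> /compact_bounded[M [_ hM]]; exists (`|M| + 2) => p nb Kp; apply: nb.
have : `|p| <= `|M| + 1 by apply: hM => //; have := ler_norm M; lra.
rewrite ge_max => /andP[h1 h2]; split => [i|] /=.
  by rewrite !mxE subr0 (le_lt_trans (coord_le_norm _ _))// (le_lt_trans h1)//; lra.
by rewrite subr0 (le_lt_trans h2)//; lra.
Qed.

Lemma integral_on_support U (k : XT -> R) : (forall p, ~ U p -> k p = 0) ->
  (\int[mu]_(p in U) (k p)%:E = \int[mu]_p (k p)%:E)%E.
Proof.
move=> k0; rewrite integral_mkcond; apply: eq_integral => p _.
by rewrite patchE; case: ifPn => //; rewrite notin_setE => /k0 ->.
Qed.

(** The product v phi, extended by 0, is C^1 on the whole space since phi vanishes
    near every point outside K; its derivative has integral 0. *)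
Lemma integration_by_parts_compact (o : option 'I_n) U K v phi :
  open U -> compact K -> K `<=` U ->
  (forall p, U p -> [/\ {for p, continuous v}, derivable v p (dir o) &
     {for p, continuous ('D_(dir o) v)}]) ->
  C1_along (dir o) phi -> (forall p, ~ K p -> phi p = 0) ->
  (\int[mu]_(p in U) (v p * 'D_(dir o) phi p)%:E =
   (-1)%:E * \int[mu]_(p in U) ('D_(dir o) v p * phi p)%:E)%E.
Proof.
move=> oU cK KU hv [cphi dphi cDphi] phi0.
have Dphi0 := derive_off_compact (dir o) cK phi0.
have [M KM] := compact_box cK.
have cv p : U p -> {for p, continuous v} by case/hv.
have cDv p : U p -> {for p, continuous ('D_(dir o) v)} by case/hv.
have c1 := continuous_cutoff oU cK KU cv cDphi Dphi0.
have c2 := continuous_cutoff oU cK KU cDv cphi phi0.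
pose g p := v p * phi p.
have dg p : is_derive p (dir o) g (v p * 'D_(dir o) phi p + 'D_(dir o) v p * phi p).
  have [Up|nUp] := pselect (U p).
    have [_ dv _] := hv _ Up.
    have [d1 d2] := is_deriveM (derivableP dv) (derivableP (dphi p)).
    apply: DeriveDef; first exact: d1.
    by rewrite [LHS]d2 [in RHS](mulrC ('D_(dir o) v p)).
  have nKp : ~ K p by move/KU.
  rewrite (phi0 _ nKp) (Dphi0 _ nKp) !mulr0 addr0.
  apply: (@near_eq_is_derive _ _ _ (cst 0)).
  by apply: filterS (near_off_compact cK nKp) => q /phi0 h; rewrite /g h mulr0.
have DgE : 'D_(dir o) g =
    fun p => v p * 'D_(dir o) phi p + 'D_(dir o) v p * phi p.
  by apply/funext => p; have [_ ->] := dg p.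
have C1g : C1_along (dir o) g.
  split.
  - exact: (continuous_cutoff oU cK KU cv cphi phi0).
  - by move=> p; have [] := dg p.
  - by rewrite DgE => p; apply: cvgD; [exact: c1|exact: c2].
have g0 p : ~ box_XT 0 M p -> g p = 0 by move=> /KM/phi0 h; rewrite /g h mulr0.
have : (\int[mu]_p ((v p * 'D_(dir o) phi p)%:E + ('D_(dir o) v p * phi p)%:E) = 0)%E.
  rewrite -[RHS](integral_derive0_XT C1g g0); apply: eq_integral => p _.
  by rewrite -EFinD; congr EFin; exact: (esym (congr1 (@^~ p) DgE)).
have i1 : mu.-integrable setT (EFin \o (fun p => v p * 'D_(dir o) phi p)).
  by apply: (integrable_XT c1 (M := M)) => p /KM/Dphi0 ->; rewrite mulr0.
have i2 : mu.-integrable setT (EFin \o (fun p => 'D_(dir o) v p * phi p)).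
  by apply: (integrable_XT c2 (M := M)) => p /KM/phi0 ->; rewrite mulr0.
rewrite integralD// !(@integral_on_support U); last 2 first.
- by move=> p nUp; rewrite phi0 ?mulr0// => /KU.
- by move=> p nUp; rewrite Dphi0 ?mulr0// => /KU.
have f1 := integrable_fin_num measurableT i1.
have f2 := integrable_fin_num measurableT i2.
rewrite /= in f1 f2.
by rewrite -(fineK f1) -(fineK f2) -EFinD -EFinM => -[h]; congr EFin; lra.
Qed.

(** If |G p0| > M, then |G| > M' > M near p0, with constant sign.  Testing with
    a bump supported there, the integral of G phi exceeds M' times that of phi in
    absolute value, while the integral of w phi is at most M times it. *)
Lemma weak_bound_pointwise k U (G w : XT -> R) M p0 : 0 <= M -> open U -> U p0 ->
  (forall p, U p -> {for p, continuous G}) ->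
  measurable_fun (U : set mXT) w ->
  {ae mu, forall p, U p -> `|w p| <= M} ->
  (forall phi, test_function U k phi ->
    (\int[mu]_(p in U) (G p * phi p)%:E = \int[mu]_(p in U) (w p * phi p)%:E)%E) ->
  `|G p0| <= M.
Proof.
move=> M0 oU Up0 cG mw wM Gw; rewrite leNgt; apply/negP => MG.
pose s : R := Num.sg (G p0); pose M' := (M + `|G p0|) / 2.
have MM' : M < M' by rewrite /M'; lra.
have M'G : M' < s * G p0 by rewrite /s -normrEsg /M'; lra.
pose V := U `&` [set p | M' < s * G p].
have nV : nbhs p0 V.
  apply: filterI; first exact: open_nbhs_nbhs.
  have csG : {for p0, continuous (fun p => s * G p)}.
    by apply: continuousM; [exact: cvg_cst|exact: cG].
  by apply: (cvgr_gt (s * G p0) csG).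
have [r r0 tV] := test_bump k nV.
pose phi := bump k p0 r.
have tU : test_function U k phi.
  case: tV => a b [K [cK KV K0]]; split => //; exists K; split => //.
  by move=> p /KV[].
have [K [cK KV phi0]] : exists K, [/\ compact K, K `<=` V & forall p, ~ K p -> phi p = 0].
  by case: tV.
have KU : K `<=` U by move=> p /KV[].
have [N KN] := compact_box cK.
have cphi : continuous phi := Ck_continuous (Ck_bump k p0 r).
have cGphi := continuous_cutoff oU cK KU cG cphi phi0.
have iphi : mu.-integrable setT (EFin \o phi).
  by apply: (integrable_XT cphi (M := N)) => p /KN/phi0.
have iGphi : mu.-integrable setT (EFin \o (fun p => G p * phi p)).
  by apply: (integrable_XT cGphi (M := N)) => p /KN/phi0 ->; rewrite mulr0.
pose I := (\int[mu]_p (phi p)%:E)%E.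
have fI : I \is a fin_num by exact: (integrable_fin_num measurableT iphi).
have phi_ge0 p : (0 <= (phi p)%:E)%E by rewrite lee_fin bump_ge0.
have I0 : (0 < I)%E.
  have [t t0 [c c0 hc]] := @bump_in R n k p0 r r0.
  have mb := measurable_box_XT p0 t.
  apply: (@lt_le_trans _ _ (\int[mu]_(p in box_XT p0 t) c%:E)%E).
    rewrite integral_cst// [X in (_ * X)%E]lebesgue_box_XT// -EFinM lte_fin.
    by rewrite mulr_gt0// exprn_gt0// mulrn_wgt0.
  have mphi : measurable_fun setT (EFin \o phi).
    by have /integrableP[] := iphi.
  apply: (@le_trans _ _ (\int[mu]_(p in box_XT p0 t) (phi p)%:E)%E).
    apply: ge0_le_integral => //.
    - by move=> p _; rewrite lee_fin ltW.
    - exact: measurable_funTS.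
  apply: (@ge0_subset_integral _ _ _ mu _ _ mb measurableT _ mphi).
    by move=> p _; exact: phi_ge0.
  exact: subsetT.
have mU : measurable (U : set mXT) by exact: open_measurable_XT.
have up : (`|\int[mu]_(p in U) (w p * phi p)%:E| <= M%:E * I)%E.
  have mwphi : measurable_fun (U : set mXT) (fun p => (w p * phi p)%:E).
    apply/measurable_EFinP; apply: measurable_funM => //.
    exact: measurable_funTS (continuous_measurable_XT cphi).
  apply: (le_trans (le_abse_integral _ _ _)) => //.
  rewrite -integralZl// -(@integral_on_support U); last first.
    by move=> p nUp; rewrite phi0 ?mulr0// => /KU.
  have mMphi : measurable_fun (U : set mXT) (fun p => (M * phi p)%:E).
    apply/measurable_EFinP; apply: measurable_funM => //.
    exact: measurable_funTS (continuous_measurable_XT cphi).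
  apply: ae_ge0_le_integral => //.
  - exact: measurableT_comp.
  - by move=> p Up; rewrite lee_fin mulr_ge0// bump_ge0.
  - have FF : Filter (almost_everywhere mu) := ae_filter_ringOfSetsType _.
    apply: filterS wM => p h Up; rewrite /= lee_fin normrM (ger0_norm (bump_ge0 _ _ _ _)).
    by rewrite ler_wpM2r ?bump_ge0//; exact: h.
have low : (M'%:E * I <= s%:E * \int[mu]_(p in U) (G p * phi p)%:E)%E.
  rewrite (@integral_on_support U); last first.
    by move=> p nUp; rewrite phi0 ?mulr0// => /KU.
  rewrite -!integralZl//.
  have isG : mu.-integrable setT (fun p => (s%:E * (G p * phi p)%:E)%E).
    exact: integrableZl.
  have iMphi : mu.-integrable setT (fun p => (M'%:E * (phi p)%:E)%E).
    exact: integrableZl.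
  apply: le_integral => // p _.
  rewrite -!EFinM lee_fin mulrA.
  have [Kp|/phi0->] := pselect (K p); last by rewrite !mulr0.
  by rewrite ler_wpM2r ?bump_ge0// ltW//; have [_] := KV p Kp.
have low' : (M'%:E * I <= `|\int[mu]_(p in U) (G p * phi p)%:E|)%E.
  apply: (le_trans low); apply: (le_trans (lee_abs _)).
  rewrite abseM -[leRHS]mul1e lee_wpmul2r// /= lee_fin.
  by rewrite /s normr_sg; case: (_ != 0); rewrite ?ler01.
have := le_trans low' _; rewrite Gw// => /(_ _ up).

have fI0 : 0 < fine I by rewrite fine_gt0// I0 ltey_eq fI.
by rewrite -(fineK fI) -!EFinM lee_fin ler_pM2r// leNgt MM'.
Qed.
End WeakToClassical.

Section SobolevPointwise.
Context {R : realType} {n : nat}.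
Local Notation XT := ('rV[R]_n * R)%type.
Local Notation mXT := ('rV[R]_n * measurableTypeR R)%type.
Local Notation mu := (lebesgue_st n).
Implicit Types (U : set XT) (v : XT -> R).

(** The infimum in the norm need not be attained, so the bound comes with a strict
    inequality. *)
Lemma sobolev_inf_normP k U v M : (sobolev_inf_norm U k v < M%:E)%E ->
  exists2 M', 0 <= M' <= M & exists w : seq (option 'I_n) -> XT -> R,
    forall s, (size s <= k)%N ->
      [/\ measurable_fun (U : set mXT) (w s), weak_derivative U s v (w s) &
          {ae mu, forall p, U p -> `|w s p| <= M'}].
Proof.
move=> /ereal_inf_lt[_ [M' [M'0 hw] <-]]; rewrite lte_fin => M'M.
by exists M' => //; rewrite M'0 ltW.
Qed.

Lemma sobolev_inf_norm_ge0 k U v : (0 <= sobolev_inf_norm U k v)%E.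
Proof. by apply: le_ereal_inf_tmp => _ [M [M0 _] <-]; rewrite lee_fin. Qed.

Lemma sobolev_bound0 k U v M : open U ->
  (forall p, U p -> {for p, continuous v}) ->
  (sobolev_inf_norm U k v < M%:E)%E -> forall p, U p -> `|v p| <= M.
Proof.
move=> oU cv /sobolev_inf_normP[M' /andP[M'0 M'M] [w hw]] p Up.
have [mw ww wM] := hw [::] isT.
apply: le_trans M'M; apply: (weak_bound_pointwise M'0 oU Up cv mw wM (k := 0)).
by move=> phi tphi; have := ww phi tphi; rewrite /= expr0 mul1e.
Qed.

Lemma test_function_C1 k U (phi : XT -> R) o s : test_function U k phi ->
  (size s < k)%N -> C1_along (dir o) (diter s phi).
Proof.
move=> [h1 h2 _] sk; split; first by apply: h1; exact: ltnW.
  by move=> p; exact: h2.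
exact: (h1 (o :: s)).
Qed.

Lemma sobolev_bound1 k U v M o : (0 < k)%N -> open U ->
  (forall p, U p -> [/\ {for p, continuous v}, derivable v p (dir o) &
     {for p, continuous ('D_(dir o) v)}]) ->
  (sobolev_inf_norm U k v < M%:E)%E -> forall p, U p -> `|'D_(dir o) v p| <= M.
Proof.
move=> k0 oU hv /sobolev_inf_normP[M' /andP[M'0 M'M] [w hw]] p Up.
have [mw ww wM] := hw [:: o] k0.
apply: le_trans M'M.
apply: (weak_bound_pointwise (G := 'D_(dir o) v) M'0 oU Up _ mw wM (k := 1)) => [q|phi tphi].
  by case/hv.
have := ww phi tphi; rewrite /= expr1.
have [_ _ [K [cK KU phi0]]] := tphi.
have C1phi := test_function_C1 (s := [::]) o tphi isT.
by rewrite (integration_by_parts_compact oU cK KU hv C1phi phi0) =>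
  /(congr1 (fun x => ((-1)%:E * x)%E)); rewrite !muleA -EFinM mulrNN mulr1 !mul1e.
Qed.

Lemma sobolev_bound2 U v M o : open U ->
  (forall p, U p -> [/\ {for p, continuous v}, derivable v p (dir o) &
     {for p, continuous ('D_(dir o) v)}]) ->
  (forall p, U p -> derivable ('D_(dir o) v) p (dir o) /\
     {for p, continuous ('D_(dir o) ('D_(dir o) v))}) ->
  (sobolev_inf_norm U 2 v < M%:E)%E ->
  forall p, U p -> `|'D_(dir o) ('D_(dir o) v) p| <= M.
Proof.
move=> oU hv hv2 /sobolev_inf_normP[M' /andP[M'0 M'M] [w hw]] p Up.
have [mw ww wM] := hw [:: o; o] isT.
apply: le_trans M'M.
apply: (weak_bound_pointwise (G := 'D_(dir o) ('D_(dir o) v)) M'0 oU Up _ mw wM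
  (k := 2)) => [q|phi tphi].
  by case/hv2.
have := ww phi tphi; rewrite /= expr2 mulrNN mulr1 mul1e => <-.
have [_ _ [K [cK KU phi0]]] := tphi.
have C1phi := test_function_C1 (s := [::]) o tphi isT.
have C1Dphi := test_function_C1 (s := [:: o]) o tphi isT.
have Dphi0 := derive_off_compact (dir o) cK phi0.
have hv' q : U q -> [/\ {for q, continuous ('D_(dir o) v)},
    derivable ('D_(dir o) v) q (dir o) &
    {for q, continuous ('D_(dir o) ('D_(dir o) v))}].
  by move=> Uq; have [_ _ a] := hv q Uq; have [b c] := hv2 q Uq.
rewrite [RHS](integration_by_parts_compact oU cK KU hv C1Dphi Dphi0).
rewrite [in RHS](integration_by_parts_compact oU cK KU hv' C1phi phi0).
by rewrite muleA -EFinM mulrNN mulr1 mul1e.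
Qed.

(** Second derivatives of the difference are derivatives of a function known only
    on U; openness of U makes that enough. *)
Lemma C21_sub U v w : open U -> C21 U v -> C21 U w ->
  [/\ C21 U (fun p => v p - w p),
      forall p, U p -> dt (fun p => v p - w p) p = dt v p - dt w p,
      forall p i, U p -> dx i (fun p => v p - w p) p = dx i v p - dx i w p &
      forall p, U p -> laplace_x (fun p => v p - w p) p
         = laplace_x v p - laplace_x w p].
Proof.
move=> oU [v1 v2] [w1 w2].
have nearU p : U p -> \near p, U p by move=> Up; exact: open_nbhs_nbhs.
have dtE p : U p -> dt (fun p => v p - w p) p = dt v p - dt w p.
  move=> Up; have [_ dv _ _] := v1 p Up; have [_ dw _ _] := w1 p Up.
  exact: (deriveB dv dw).
have dxE p i : U p -> dx i (fun p => v p - w p) p = dx i v p - dx i w p.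
  move=> Up; have [_ _ _ /(_ i)[dv _]] := v1 p Up.
  have [_ _ _ /(_ i)[dw _]] := w1 p Up.
  exact: (deriveB dv dw).
have near_dx p i : U p -> \near p, dx i v p - dx i w p = dx i (fun p => v p - w p) p.
  by move=> /nearU; apply: filterS => q Uq; rewrite dxE.
have dxxE p i j : U p -> dx j (dx i (fun p => v p - w p)) p =
    dx j (dx i v) p - dx j (dx i w) p.
  move=> Up; have [dv _] := v2 p Up i j; have [dw _] := w2 p Up i j.
  rewrite [LHS](near_eq_derive _ (g := fun p => dx i v p - dx i w p)).
    exact: (deriveB dv dw).
  by apply: filterS (near_dx p i Up).
have cont_near (F G : XT -> R) p : U p -> (forall q, U q -> F q = G q) ->
    {for p, continuous G} -> {for p, continuous F}.
  move=> Up FG cG; change (F @ p --> F p); rewrite (FG p Up).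
  apply: cvg_trans cG; apply: near_eq_cvg.
  by apply: filterS (nearU p Up) => q /FG.
split; [|exact: dtE|by move=> p i; exact: dxE|].
  split => p Up.
    have [cv dv cdv v1'] := v1 p Up; have [cw dw cdw w1'] := w1 p Up; split.
    - by apply: cvgB; [exact: cv|exact: cw].
    - exact: derivableB.
    - by apply: (cont_near _ _ p Up dtE); apply: cvgB; [exact: cdv|exact: cdw].
    - move=> i; have [a b] := v1' i; have [c e] := w1' i; split.
        exact: derivableB.
      apply: (cont_near _ _ p Up (fun q => dxE q i)).
      by apply: cvgB; [exact: b|exact: e].
  move=> i j; have [dv cdv] := v2 p Up i j; have [dw cdw] := w2 p Up i j; split.
    apply: (near_eq_derivable (near_dx p i Up)); exact: derivableB.
  apply: (cont_near _ _ p Up (fun q => dxxE q i j)).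
  by apply: cvgB; [exact: cdv|exact: cdw].
move=> p Up; rewrite /laplace_x -sumrB; apply: eq_bigr => i _; exact: dxxE.
Qed.

Lemma sobolev_C21_bounds U v M : open U -> C21 U v ->
  (sobolev_inf_norm U 2 v < M%:E)%E -> forall p, U p ->
  [/\ `|v p| <= M, `|dt v p| <= M, forall i, `|dx i v p| <= M &
      `|laplace_x v p| <= M *+ n].
Proof.
move=> oU [C1v C2v] vM p Up; split.
- apply: (sobolev_bound0 oU _ vM Up) => q Uq; by have [] := C1v q Uq.
- by apply: (sobolev_bound1 (o := None) _ oU _ vM Up) => // q /C1v[? ? ? _].
- by move=> i; apply: (sobolev_bound1 (o := Some i) _ oU _ vM Up) => // q /C1v[h _ _ /(_ i)[]]; split.
rewrite -[n in leRHS]card_ord -sumr_const; apply: le_trans (ler_norm_sum _ _ _) _.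
apply: ler_sum => i _.
apply: (sobolev_bound2 (o := Some i) oU _ _ vM Up) => q Uq.
  by have [h _ _ /(_ i)[]] := C1v q Uq; split.
exact: C2v.
Qed.
End SobolevPointwise.

(** * Hausdorff measure *)

Section HausdorffOuterMeasure.
Context {R : realType} {n : nat} (k : nat).
Local Open Scope ereal_scope.
Implicit Types (A B X : set 'rV[R]_n) (delta : R).

Lemma coord_le_enorm (x : 'rV[R]_n) i : (`|x ord0 i| <= enorm x)%R.
Proof.
rewrite -sqrtr_sqr ler_sqrt; last by apply: sumr_ge0 => j _; exact: sqr_ge0.
by rewrite (bigD1 i)//= lerDl sumr_ge0// => j _; exact: sqr_ge0.
Qed.

Lemma le_ediam A B : A `<=` B -> ediam A <= ediam B.
Proof.
move=> AB; apply: ereal_sup_le => _ [x Ax [y Ay <-]].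
by exists x; [exact: AB|exists y => //; exact: AB].
Qed.

Lemma ediam_ge0 A : A !=set0 -> 0 <= ediam A.
Proof.
move=> [x Ax]; apply: ereal_sup_ubound; exists x => //; exists x => //.
by rewrite subrr /enorm big1 ?sqrtr0// => i _; rewrite mxE expr0n.
Qed.

Lemma hausdorff_gauge0 : hausdorff_gauge k (set0 : set 'rV[R]_n) = 0.
Proof. by rewrite /hausdorff_gauge eqxx. Qed.

Lemma hausdorff_gauge_ge0 A : 0 <= hausdorff_gauge k A.
Proof.
rewrite /hausdorff_gauge; case: eqP => // /eqP/set0P A0.
by rewrite mule_ge0// expe_ge0// ediam_ge0.
Qed.

(** Sets of diameter at most delta form a semiring of sets, and hausdorff_pre is
    the outer measure that the gauge generates on it; the general theory of such
    outer measures applies. *)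
Definition small_sets delta : Type := 'rV[R]_n.

HB.instance Definition _ delta := Pointed.on (small_sets delta).

Let small delta : set (set (small_sets delta)) := [set A | ediam A <= delta%:E].
Arguments small : clear implicits.

Let small0 delta : small delta set0.
Proof.
rewrite /small /= /ediam (_ : [set _ | _ in _ & _ in _] = set0).
  by rewrite ereal_sup0 leNye.
by apply/seteqP; split => // x [y []].
Qed.

Let smallI delta : setI_closed (small delta).
Proof. by move=> A B hA hB; apply: le_trans hA; apply: le_ediam => x []. Qed.

Let smallD delta : semi_setD_closed (small delta).
Proof.
apply: setD_semi_setD_closed => A B hA hB.
by apply: le_trans hA; apply: le_ediam => x [].
Qed.

HB.instance Definition _ delta := @isSemiRingOfSets.Build default_measure_display
  (small_sets delta) (small delta) (@small0 delta) (@smallI delta) (@smallD delta).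

(** Coverings by measurable sets of the semiring are the coverings by sets of
    diameter at most delta. *)
Lemma hausdorff_preE delta A : hausdorff_pre k delta A =
  mu_ext (hausdorff_gauge k : set (small_sets delta) -> \bar R) A.
Proof.
rewrite /hausdorff_pre /mu_ext; congr ereal_inf.
by apply/seteqP; split => _ [F [F1 F2] <-]; exists F.
Qed.

Lemma hausdorff_pre0 delta : hausdorff_pre k delta (set0 : set 'rV[R]_n) = 0.
Proof.
rewrite hausdorff_preE; apply: (@mu_ext0 _ (small_sets delta)).
  exact: hausdorff_gauge0.
exact: hausdorff_gauge_ge0.
Qed.

Lemma hausdorff_pre_ge0 delta A : 0 <= hausdorff_pre k delta A.
Proof.
rewrite hausdorff_preE; apply: (@mu_ext_ge0 _ (small_sets delta)).
exact: hausdorff_gauge_ge0.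
Qed.

Lemma le_hausdorff_pre delta A B : A `<=` B ->
  hausdorff_pre k delta A <= hausdorff_pre k delta B.
Proof. by rewrite !hausdorff_preE; apply: (@le_mu_ext _ (small_sets delta)). Qed.

Lemma hausdorff_pre_subadditive delta :
  sigma_subadditive (hausdorff_pre k delta : set 'rV[R]_n -> \bar R).
Proof.
move=> F; rewrite hausdorff_preE; under eq_eseriesr do rewrite hausdorff_preE.
apply: (@mu_ext_sigma_subadditive _ (small_sets delta)).
exact: hausdorff_gauge_ge0.
Qed.

Lemma hausdorff_pre_anti delta delta' A : (delta <= delta')%R ->
  hausdorff_pre k delta' A <= hausdorff_pre k delta A.
Proof.
move=> dd; apply: ereal_inf_le_tmp => _ [F [F1 F2] <-]; exists F => //; split => // i.
by apply: le_trans (F2 i) _; rewrite lee_fin.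
Qed.

Lemma hausdorff_pre_le delta A : (0 < delta)%R ->
  hausdorff_pre k delta A <= hausdorff k A.
Proof. by move=> d0; apply: ereal_sup_ubound; exists delta. Qed.

Lemma hausdorff_le A (M : \bar R) :
  (forall delta, (0 < delta)%R -> hausdorff_pre k delta A <= M) ->
  hausdorff k A <= M.
Proof. by move=> h; apply: ge_ereal_sup => _ [delta d0 <-]; exact: h. Qed.

Lemma hausdorff0 : hausdorff k (set0 : set 'rV[R]_n) = 0.
Proof.
apply/eqP; rewrite eq_le; apply/andP; split.
  by apply: hausdorff_le => d _; rewrite hausdorff_pre0.
by apply: le_trans (hausdorff_pre_le set0 ltr01); rewrite hausdorff_pre0.
Qed.

Lemma hausdorff_ge0 A : 0 <= hausdorff k A.
Proof. exact: le_trans (hausdorff_pre_ge0 1 A) (hausdorff_pre_le A ltr01). Qed.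

Lemma le_hausdorff A B : A `<=` B -> hausdorff k A <= hausdorff k B.
Proof.
move=> AB; apply: hausdorff_le => d d0.
exact: le_trans (le_hausdorff_pre d AB) (hausdorff_pre_le B d0).
Qed.

Lemma hausdorff_subadditive :
  sigma_subadditive (hausdorff k : set 'rV[R]_n -> \bar R).
Proof.
move=> F; apply: hausdorff_le => d d0.
apply: le_trans (hausdorff_pre_subadditive d F) _.
apply: lee_nneseries => i *; [exact: hausdorff_pre_ge0|exact: hausdorff_pre_le].
Qed.

HB.instance Definition _ := isOuterMeasure.Build R 'rV[R]_n (hausdorff k)
  hausdorff0 hausdorff_ge0 le_hausdorff hausdorff_subadditive.

(** A set of diameter at most delta meets at most one of A and B, so a covering of
    the union splits into coverings of A and of B. *)
Lemma hausdorff_pre_separated delta eta A B : (delta < eta)%R ->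
  (forall x y, A x -> B y -> (eta <= enorm (x - y))%R) ->
  hausdorff_pre k delta A + hausdorff_pre k delta B
  <= hausdorff_pre k delta (A `|` B).
Proof.
move=> de sep; apply: le_ereal_inf_tmp => _ [F [FAB Fd] <-].
pose G A i := if asbool (F i `&` A !=set0) then F i else set0.
have Gd A' i : ediam (G A' i) <= delta%:E.
  apply: le_trans (Fd i); apply: le_ediam; rewrite /G.
  by case: asboolP => _; [exact: subset_refl|exact: sub0set].
have Gcov A' : A' `<=` A `|` B -> A' `<=` \bigcup_i G A' i.
  move=> sub x Ax; have [i _ Fx] := FAB x (sub x Ax).
  by exists i => //; rewrite /G asboolT//; exists x.
have pre_le A' : A' `<=` A `|` B ->
    hausdorff_pre k delta A' <= \sum_(i <oo) hausdorff_gauge k (G A' i).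
  move=> sub; apply: ereal_inf_lbound; exists (G A') => //.
  by split; [exact: Gcov|exact: Gd].
apply: le_trans (leeD (pre_le A (@subsetUl _ _ _)) (pre_le B (@subsetUr _ _ _))) _.
rewrite -nneseriesD; try by move=> *; exact: hausdorff_gauge_ge0.
apply: lee_nneseries => i *.
  by rewrite adde_ge0// hausdorff_gauge_ge0.
rewrite /G; case: asboolP => [[x [Fx Ax]]|_]; case: asboolP => [[y [Fy By]]|_].
- have : (enorm (x - y))%:E <= ediam (F i).
    by apply: ereal_sup_ubound; exists x => //; exists y.
  move=> /le_trans/(_ (Fd i)); rewrite lee_fin => h.
  by have := le_lt_trans h de; rewrite ltNge (sep _ _ Ax By).
- by rewrite hausdorff_gauge0 adde0.
- by rewrite hausdorff_gauge0 add0e.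
- by rewrite hausdorff_gauge0 add0e hausdorff_gauge_ge0.
Qed.

(** Pass to the supremum over both mesh sizes, replacing them by a common one below
    eta. *)
Lemma hausdorff_separated eta A B : (0 < eta)%R ->
  (forall x y, A x -> B y -> (eta <= enorm (x - y))%R) ->
  hausdorff k A + hausdorff k B <= hausdorff k (A `|` B).
Proof.
move=> eta0 sep.
have [->|Hoo] := eqVneq (hausdorff k (A `|` B)) +oo; first exact: leey.
have fin A' : A' `<=` A `|` B -> hausdorff k A' \is a fin_num.
  move=> sub; rewrite ge0_fin_numE ?hausdorff_ge0//.
  by apply: le_lt_trans (le_hausdorff sub) _; rewrite ltey.
have fA := fin A (@subsetUl _ _ _); have fB := fin B (@subsetUr _ _ _).
have fAB := fin _ (@subset_refl _ _).
have key d d' : (0 < d)%R -> (0 < d')%R ->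
    hausdorff_pre k d A + hausdorff_pre k d' B <= hausdorff k (A `|` B).
  move=> d0 d'0; pose e : R := Num.min (Num.min d d') (eta / 2)%R.
  have e0 : (0 < e)%R by rewrite /e !lt_min d0 d'0 divr_gt0.
  have ed : (e <= d)%R by rewrite /e !ge_min lexx.
  have ed' : (e <= d')%R by rewrite /e !ge_min lexx orbT.
  have ee : (e < eta)%R.
    have : (e <= eta / 2)%R by rewrite /e ge_min lexx orbT.
    by lra.
  apply: le_trans (leeD (hausdorff_pre_anti _ ed) (hausdorff_pre_anti _ ed')) _.
  exact: le_trans (hausdorff_pre_separated ee sep) (hausdorff_pre_le _ e0).
rewrite -leeBrDr//; apply: hausdorff_le => d d0.
rewrite leeBrDr// addeC -leeBrDr; last first.
  rewrite ge0_fin_numE ?hausdorff_pre_ge0//.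
  by apply: le_lt_trans (hausdorff_pre_le A d0) _; rewrite -ge0_fin_numE// hausdorff_ge0.
apply: hausdorff_le => d' d'0; rewrite leeBrDr; last first.
  rewrite ge0_fin_numE ?hausdorff_pre_ge0//.
  by apply: le_lt_trans (hausdorff_pre_le A d0) _; rewrite -ge0_fin_numE// hausdorff_ge0.
by rewrite addeC; exact: key.
Qed.

End HausdorffOuterMeasure.

Section HausdorffMeasure.
Context {R : realType} {n : nat} (k : nat).
Local Open Scope ereal_scope.
Implicit Types (A B X : set 'rV[R]_n).
Local Notation H := (hausdorff k : set 'rV[R]_n -> \bar R).

Lemma hausdorff_separated_coord i (b c : R) A B : (b < c)%R ->
  (forall x, A x -> (x ord0 i <= b)%R) -> (forall y, B y -> (c <= y ord0 i)%R) ->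
  H A + H B <= H (A `|` B).
Proof.
move=> bc hA hB; apply: (@hausdorff_separated _ _ _ (c - b)%R); first by rewrite subr_gt0.
move=> x y /hA hx /hB hy; apply: le_trans (coord_le_enorm (x - y) i).
rewrite !mxE distrC; apply: le_trans (ler_norm _); lra.
Qed.

Lemma inv_nat_lt (j : nat) : (j.+2%:R^-1 < j.+1%:R^-1 :> R)%R.
Proof. by rewrite ltf_pV2 ?posrE ?ltr0n// ltr_nat. Qed.

(** Caratheodory's argument for metric outer measures.  Let Y j be the part of X at
    height more than 1/(j+1) above the hyperplane, and Z j the slab between
    heights 1/(j+2) and 1/(j+1).  Slabs at distance two are separated, so the
    measures of the Z j have a finite sum; its tails bound what Y N leaves out of
    the upper part of X, and Y N is separated from the lower part. *)
Lemma caratheodory_halfspace i (c : R) :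
  H.-caratheodory [set x : 'rV[R]_n | (x ord0 i <= c)%R].
Proof.
set S := [set x | _]; apply: le_caratheodory_measurable => X.
change (H (X `&` S) + H (X `&` ~` S) <= H X).
have [->|Xoo] := eqVneq (H X) +oo; first exact: leey.
have fX : H X \is a fin_num.
  by rewrite ge0_fin_numE ?hausdorff_ge0// ltey.
pose t j : R := (j.+1%:R^-1)%R.
have tlt j : (t j.+1 < t j)%R by exact: inv_nat_lt.
pose Y j := X `&` [set x | (t j < x ord0 i - c)%R].
pose Z j := X `&` [set x | (t j.+1 < x ord0 i - c <= t j)%R].
have YX j : H (Y j) <= H X by apply: le_hausdorff => x [].
(* the slab Z j keeps Y j and Z j.+1 apart *)
have step j : H (Y j) + H (Z j.+1) <= H (Y j.+2).
  rewrite addeC.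
  apply: (@le_trans _ _ (H (Z j.+1 `|` Y j))).
    apply: (@hausdorff_separated_coord i (c + t j.+1) (c + t j)).
    - by rewrite ltrD2l.
    - by move=> x [_ /= /andP[_]]; lra.
    - by move=> x [_ /=]; lra.
  apply: le_hausdorff => x [[Xx /= /andP[h1 h2]]|[Xx /= h]]; split => //=.
  by have := tlt j; have := tlt j.+1; lra.
(* the previous inequality telescopes with step two *)
have partial N : \sum_(0 <= j < N) H (Z j.+1) <= H (Y N) + H (Y N.+1).
  elim: N => [|N IH]; first by rewrite big_geq// adde_ge0 ?hausdorff_ge0.
  rewrite big_nat_recr//=; apply: le_trans (leeD2r _ IH) _.
  by rewrite addeAC [leRHS]addeC leeD2r.
have sum_lty : \sum_(0 <= j <oo) H (Z j.+1) < +oo.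
  apply: (@le_lt_trans _ _ (H X + H X)).
    apply: lime_le; first by apply: is_cvg_nneseries => *; exact: hausdorff_ge0.
    by apply: nearW => N; apply: le_trans (partial N) (leeD (YX _) (YX _)).
  by rewrite lte_add_pinfty// -ge0_fin_numE ?hausdorff_ge0.
have tail := nneseries_tail_cvg sum_lty (fun j _ => hausdorff_ge0 k (Z j.+1)).
have cover N : X `&` ~` S `<=` Y N.+1 `|` \bigcup_j (Z (j + N).+1).
  move=> x [Xx /= /negP]; rewrite -ltNge => cx.
  have xc0 : (0 < x ord0 i - c)%R by rewrite subr_gt0.
  have [h|h] := ltP (t N.+1) (x ord0 i - c)%R; first by left.
  right.
  have ex : exists j, (t j < x ord0 i - c)%R.
    have [j _ /(_ j (leqnn j)) hj] := near_infty_natSinv_lt (PosNum xc0).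
    by exists j.
  case: (ex_minnP ex) => j hj jmin.
  have Nj : (N.+1 < j)%N.
    rewrite ltnNge; apply/negP => jN.
    have : (t N.+1 <= t j)%R by rewrite lef_pV2 ?posrE ?ltr0n// ler_nat ltnS.
    by rewrite leNgt (lt_le_trans hj h).
  exists (j - N.+2)%N => //.
  have -> : ((j - N.+2 + N).+1 = j.-1)%N by lia.
  split => //=; rewrite prednK; last by lia.
  rewrite hj /= leNgt; apply/negP => /jmin; lia.
(* the two parts Y N.+1 and X `&` S are separated by 1 / (N + 2) *)
have bound N : H (X `&` S) + H (X `&` ~` S) <= H X + \sum_(N <= j <oo) H (Z j.+1).
  rewrite -(nneseries_addn N (fun j => hausdorff_ge0 k (Z j.+1))).
  apply: (@le_trans _ _ (H (X `&` S) + (H (Y N.+1) + \sum_(0 <= j <oo) H (Z (j + N).+1)))).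
    rewrite leeD2l//; apply: le_trans (le_hausdorff k (cover N)) _.
    apply: le_trans (outer_measureU2 _ _ _) _.
    rewrite leeD2l//; exact: hausdorff_subadditive.
  rewrite addeA leeD2r//.
  apply: (@le_trans _ _ (H (X `&` S `|` Y N.+1))).
    apply: (@hausdorff_separated_coord i c (c + t N.+1)).
    - by rewrite ltrDl invr_gt0 ltr0n.
    - by move=> x [].
    - by move=> x [_ /=]; lra.
  by apply: le_hausdorff => x [[]|[]].
have cvX : H X + \sum_(N <= j <oo) H (Z j.+1) @[N --> \oo] --> H X + 0.
  by apply: cvgeD => //; [exact: fin_num_adde_defr|exact: cvg_cst].
rewrite -[leRHS]adde0; apply: (cvge_ge _ cvX); exact: nearW.
Qed.

(** The identity is measurable from the Caratheodory sigma-algebra since its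
    coordinates are, rays being generators. *)
Lemma measurable_caratheodory A : measurable A -> H.-caratheodory A.
Proof.
move=> mA.
have mid : measurable_fun setT (id : caratheodory_type H -> 'rV[R]_n).
  apply: measurable_fun_coordP => i.
  apply: (measurability _ (RGenOInfty.measurableE R)).
  move=> _ [_ [c ->] <-]; rewrite setTI.
  have : H.-caratheodory (~` [set x : 'rV[R]_n | (x ord0 i <= c)%R]).
    exact/caratheodory_measurable_setC/caratheodory_halfspace.
  congr (_.-caratheodory _).
  apply/seteqP; split => x /=; rewrite in_itv/= andbT ltNge; first by move/negP.
  by move/negP.
have := mid measurableT A mA; rewrite setTI; exact.
Qed.

Lemma hausdorff_sigma_additive : semi_sigma_additive H.
Proof.
move=> F mF tF mUF.
apply: (@caratheodory_measure_sigma_additive R 'rV[R]_n H F _ tF).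
  by move=> j; exact: measurable_caratheodory.
exact: measurable_caratheodory.
Qed.

HB.instance Definition _ := isMeasure.Build _ 'rV[R]_n R (hausdorff k)
  (hausdorff0 k) (hausdorff_ge0 k) hausdorff_sigma_additive.

End HausdorffMeasure.

(** * Surface measure of the boundary *)

Section LipschitzImage.
Context {R : realType}.
Local Open Scope ereal_scope.

Lemma outer_measure_big T (mu : {outer_measure set T -> \bar R}) (I : Type)
    (s : seq I) (A : I -> set T) :
  mu (\big[setU/set0]_(i <- s) A i) <= \sum_(i <- s) mu (A i).
Proof.
elim: s => [|i s IH]; first by rewrite !big_nil outer_measure0.
by rewrite !big_cons (le_trans (outer_measureU2 _ _ _))// leeD2l.
Qed.

Lemma bigsetU_in T (I : eqType) (s : seq I) (A : I -> set T) i x :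
  i \in s -> A i x -> (\big[setU/set0]_(i <- s) A i) x.
Proof.
elim: s => [//|j s IH]; rewrite inE big_cons => /orP[/eqP <-|si] Ax; first by left.
by right; exact: IH.
Qed.

(** Cover the set by itself. *)
Lemma hausdorff_pre_gauge n k (delta : R) (A : set 'rV[R]_n) :
  ediam A <= delta%:E -> hausdorff_pre k delta A <= hausdorff_gauge k A.
Proof.
move=> Ad; pose F (i : nat) : set 'rV[R]_n := if i is 0%N then A else set0.
apply: (@le_trans _ _ (\sum_(i <oo) hausdorff_gauge k (F i))).
  apply: ereal_inf_lbound; exists F => //; split.
    by move=> x Ax; exists 0%N.
  case=> //= i; apply: le_trans Ad; apply: le_ediam; exact: sub0set.
rewrite (nneseries_recl)//; last by move=> i _; exact: hausdorff_gauge_ge0.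
rewrite eseries0 ?adde0// => i i0 _.
by rewrite /F; case: i i0 => //= i _; rewrite hausdorff_gauge0.
Qed.

Lemma expe_le n (x : \bar R) (a : R) : 0 <= x -> x <= a%:E -> x ^+ n <= (a ^+ n)%:E.
Proof.
case: x => [x| |] //.
by rewrite -EFin_expe !lee_fin => x0 xa; rewrite lerXn2r ?nnegrE// (le_trans x0).
Qed.

HB.instance Definition _ n k (delta : R) := isOuterMeasure.Build R 'rV[R]_n
  (hausdorff_pre k delta) (hausdorff_pre0 k delta) (hausdorff_pre_ge0 k delta)
  (@le_hausdorff_pre R n k delta) (@hausdorff_pre_subadditive R n k delta).

Definition half_ball k : set 'rV[R]_k :=
  [set y | (Num.sqrt (\sum_(i < k) (y ord0 i ^+ 2)%R)%R <= 2^-1)%R].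
Arguments half_ball : clear implicits.

Lemma half_ball_lty k : lebesgue_rV k (half_ball k) < +oo.
Proof.
apply: lebesgue_rV_bounded_lty.
  have -> : half_ball k =
      (fun y : 'rV[R]_k => (enorm y : measurableTypeR R)) @^-1` `]-oo, 2^-1%R].
    by apply/seteqP; split => y /=; rewrite in_itv.
  rewrite -[X in measurable X]setTI.
  have : measurable_fun setT (fun y : 'rV[R]_k => (enorm y : measurableTypeR R)).
    apply: (@measurableT_comp _ _ _ _ _ _ (@Num.sqrt R)).
      exact: continuous_measurable_fun (@sqrt_continuous R).
    apply: measurable_sum => i; apply: measurable_funX; exact: measurable_coord.
  by apply => //; exact: measurable_itv.
exists 1%R; split; first exact: num_real.
move=> M M1 y hy /=; apply: norm_le_coord; first lra.
by move=> i; apply: le_trans (coord_le_enorm y i) _; apply: le_trans hy _; lra.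
Qed.

(** Cut the cube into N^k cells of side 2r/N.  Their images have diameter at most
    2rL/N, so their gauges are O(N^-k), and the total is bounded uniformly in N. *)
Lemma lipschitz_image_lty n k (phi : 'rV[R]_k -> 'rV[R]_n) (r L : R) :
  (0 < r)%R -> (0 <= L)%R ->
  (forall y y', (`|y| < r)%R -> (`|y'| < r)%R ->
     (enorm (phi y - phi y') <= L * `|y - y'|)%R) ->
  hausdorff k (phi @` [set y : 'rV[R]_k | (`|y| < r)%R]) < +oo.
Proof.
move=> r0 L0 lip.
pose V := fine (lebesgue_rV k (half_ball k)).
have V0 : (0 <= V)%R by rewrite fine_ge0.
have VE : lebesgue_rV k (half_ball k) = V%:E.
  by rewrite fineK// ge0_fin_numE// half_ball_lty.
apply: (@le_lt_trans _ _ (V * (L * (2 * r)) ^+ k)%:E); last exact: ltry.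
apply: hausdorff_le => delta d0.
have [N N0 hN] : exists2 N : nat, (0 < N)%N & (L * (2 * r) / N%:R <= delta)%R.
  pose q := (delta^-1 * (L * (2 * r)))%R.
  exists (Num.truncn q).+1 => //.
  rewrite ler_pdivrMr ?ltr0n// -ler_pdivrMl//.
  exact/ltW/truncnS_gt.
have N0' : (0 < N%:R :> R)%R by rewrite ltr0n.
pose cell (c : {ffun 'I_k -> 'I_N}) : set 'rV[R]_k := [set y : 'rV[R]_k | (`|y| < r)%R /\
  forall j, ((c j)%:R * (2 * r / N%:R) <= y ord0 j + r <= (c j).+1%:R * (2 * r / N%:R))%R].
have s0 : (0 < 2 * r / N%:R)%R by rewrite divr_gt0// mulr_gt0.
(* the coordinates of two points of a cell differ by at most its side *)
have cell_diam c : ediam (phi @` cell c) <= (L * (2 * r / N%:R))%:E.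
  apply: ge_ereal_sup => _ [_ [y [yr hy] <-] [_ [y' [y'r hy'] <-] <-]].
  rewrite lee_fin (le_trans (lip _ _ yr y'r))// ler_wpM2l//.
  apply: norm_le_coord; first exact: ltW.
  move=> j; rewrite !mxE ler_norml.
  have /andP[a1 a2] := hy j; have /andP[b1 b2] := hy' j.
  by move: a2 b2; rewrite -!natr1 !mulrDl !mul1r => a2 b2; apply/andP; split; lra.
have gauge_cell c : hausdorff_gauge k (phi @` cell c) <=
    (V * (L * (2 * r / N%:R)) ^+ k)%:E.
  rewrite /hausdorff_gauge; case: eqP => [_|/eqP/set0P ne].
    by rewrite lee_fin mulr_ge0// exprn_ge0// mulr_ge0// ltW.
  rewrite [X in X * _]VE EFinM lee_wpmul2l ?lee_fin//.
  by apply: expe_le; [exact: ediam_ge0|exact: cell_diam].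
have cover : phi @` [set y : 'rV[R]_k | (`|y| < r)%R] `<=`
    \big[setU/set0]_(c <- enum {ffun 'I_k -> 'I_N}) (phi @` cell c).
  move=> _ [y /= yr <-].
  have yj j : (0 < y ord0 j + r < 2 * r)%R.
    have := le_lt_trans (coord_le_norm y j) yr; rewrite ltr_norml.
    by move=> /andP[a b]; apply/andP; split; lra.
  pose s j := ((y ord0 j + r) / (2 * r / N%:R))%R.
  have sN j : (Num.truncn (s j) < N)%N.
    have /andP[a b] := yj j.
    rewrite -(ltr_nat R); apply: (@le_lt_trans _ _ (s j)).
      by rewrite truncn_le// divr_ge0// ltW.
    by rewrite /s ltr_pdivrMr// mulrCA divff ?mulr1 ?gt_eqF.
  pose c := [ffun j => Ordinal (sN j)].
  apply: (@bigsetU_in _ _ _ _ c); first by rewrite mem_enum.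
  exists y => //; split => // j; rewrite ffunE /=.
  have /andP[a b] := yj j.
  apply/andP; split.
    by rewrite -ler_pdivlMr// truncn_le divr_ge0// ltW.
  by rewrite -ler_pdivrMr//; exact/ltW/truncnS_gt.
apply: le_trans (le_hausdorff_pre k delta cover) _.
apply: le_trans (outer_measure_big _ _ _) _.
apply: (@le_trans _ _ (\sum_(c <- enum {ffun 'I_k -> 'I_N})
    (V * (L * (2 * r / N%:R)) ^+ k)%:E)).
  apply: lee_sum => c _; apply: le_trans (gauge_cell c).
  apply: hausdorff_pre_gauge; apply: le_trans (cell_diam c) _.
  by rewrite lee_fin mulrA.
rewrite big_enum sumEFin lee_fin sumr_const card_ffun !card_ord.
rewrite -[leLHS]mulr_natr natrX -(mulrA V) -exprMn.
by rewrite -(mulrA L) divfK// gt_eqF.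
Qed.

End LipschitzImage.

Section BoundaryMeasure.
Context {R : realType} {m : nat}.

(** Nonemptiness matters: over the empty set both suprema are -oo. *)
Lemma holder_norm_sup n (A : set 'rV[R]_n) b (w : 'rV[R]_n -> R) : A !=set0 ->
  (0 <= ereal_sup [set `|w x|%:E | x in A] <= holder_norm A b w)%E.
Proof.
move=> [x0 Ax0]; rewrite /holder_norm; apply/andP; split.
  by apply: le_ereal_sup_tmp; exists `|w x0|%:E; [exists x0|rewrite lee_fin].
apply: leeDl; apply: le_ereal_sup_tmp.
exists (`|w x0 - w x0| / enorm (x0 - x0) `^ b)%:E.
  by exists x0 => //; exists x0.
by rewrite lee_fin subrr normr0 mul0r.
Qed.

Lemma holder2_le_gradient n (D : set 'rV[R]_n) b w M : holder2_le D b w M ->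
  forall x i, D x -> `|ds i w x| <= M.
Proof.
move=> [_ nM] x i Dx.
have D0 : D !=set0 by exists x.
have cD0 : closure D !=set0 by exists x; exact: subset_closure.
have ge0 (A : set 'rV[R]_n) v : A !=set0 -> (0 <= holder_norm A b v)%E.
  by move=> /(holder_norm_sup b v)/andP[]; exact: le_trans.
rewrite -lee_fin; apply: le_trans nM.
have /andP[_ h] := holder_norm_sup b (ds i w) D0.
apply: (@le_trans _ _ (holder_norm D b (ds i w))).
  by apply: le_trans h; apply: ereal_sup_ubound; exists x.
rewrite /holder2_norm -addeA; apply: (@le_trans _ _ (\sum_(i < n) holder_norm D b (ds i w))%E).
  rewrite (bigD1 i) //; apply: leeDl; apply: sume_ge0 => j _; exact: ge0.
rewrite addeCA; apply: leeDl; apply: adde_ge0; first exact: ge0.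
by apply: sume_ge0 => j _; apply: sume_ge0 => l _; exact: ge0.
Qed.

Lemma lipschitz_coord n (D : set 'rV[R]_n) (w : 'rV[R]_n -> R) M i z (h : R) :
  0 <= h -> (forall x, D x -> derivable w x (delta_mx ord0 i)) ->
  (forall x, D x -> `|ds i w x| <= M) ->
  (forall s, 0 <= s <= h -> D (s *: delta_mx ord0 i + z)) ->
  `|w (h *: delta_mx ord0 i + z) - w z| <= M * h.
Proof.
move=> h0 dw wM hD.
pose psi (s : R) : 'rV[R]_n := s *: delta_mx ord0 i + z.
have hpsi (l s : R) : psi (l *: (1 : R) + s) = l *: delta_mx ord0 i + psi s.
  by rewrite /psi [l *: 1]mulr1 scalerDl addrA.
have dpsi s : 0 <= s <= h -> is_derive s 1 (w \o psi) (ds i w (psi s)).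
  move=> hs; have := growth_rate_slice w (hpsi ^~ s) => E.
  apply: DeriveDef; first by rewrite /derivable E; exact: dw (hD _ hs).
  by rewrite /derive E.
have cw : {within `[0, h], continuous (w \o psi)}.
  apply: derivable_within_continuous => s; rewrite in_itv/= => hs.
  by have [] := dpsi s hs.
have [|s sh] := @MVT_segment R (w \o psi) (fun s => ds i w (psi s)) 0 h h0 _ cw.
  by move=> s; rewrite in_itv/= => /andP[/ltW a /ltW b]; apply: dpsi; rewrite a b.
rewrite /= {2}/psi scale0r add0r subr0 => ->.
rewrite normrM (ger0_norm h0) ler_wpM2r//; apply: wM; apply: hD.
by move: sh; rewrite in_itv.
Qed.

(** Pass from y to x by changing one coordinate at a time; the intermediate points
    stay in the ball of the sup norm, and the mean value theorem applies on each
    segment. *)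
Lemma lipschitz_ball n (r M : R) (w : 'rV[R]_n -> R) : 0 <= M ->
  (forall x i, `|x| < r -> derivable w x (delta_mx ord0 i)) ->
  (forall x i, `|x| < r -> `|ds i w x| <= M) ->
  forall x y, `|x| < r -> `|y| < r -> `|w x - w y| <= n%:R * M * `|x - y|.
Proof.
move=> M0 dw wM x y xr yr.
have r0 : 0 < r by apply: le_lt_trans xr.
(* the first l coordinates of x followed by the others of y *)
pose z (l : nat) : 'rV[R]_n := \row_j (if (j < l)%N then x ord0 j else y ord0 j).
have ball_coord (v : 'rV[R]_n) :
    (forall j, Num.min (x ord0 j) (y ord0 j) <= v ord0 j
               <= Num.max (x ord0 j) (y ord0 j)) -> `|v| < r.
  move=> hv; apply: (@le_lt_trans _ _ (Num.max `|x| `|y|)); last by rewrite gt_max xr yr.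
  set C := Num.max _ _.
  have xC j : `|x ord0 j| <= C by rewrite le_max coord_le_norm.
  have yC j : `|y ord0 j| <= C by rewrite le_max (coord_le_norm y) orbT.
  apply: norm_le_coord => [|j]; first by rewrite le_max normr_ge0.
  have := xC j; have := yC j; rewrite !ler_norml => /andP[a b] /andP[c d].
  have /andP[e f] := hv j; rewrite (le_trans _ e) ?le_min ?a ?c//=.
  by rewrite (le_trans f)// ge_max b d.
have step (l : 'I_n) : `|w (z l.+1) - w (z l)| <= M * `|x - y|.
  have xyl : `|x ord0 l - y ord0 l| <= `|x - y|.
    by have := coord_le_norm (x - y) l; rewrite !mxE.
  have between (s : R) j (a b : R) : 0 <= s <= b - a -> Num.min a b <= s + a <= Num.max a b.
    by move=> /andP[s0 sb]; rewrite ge_min le_max; apply/andP; split; apply/orP;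
      [left; lra|right; lra].
  have zl1 j : j != l -> z l.+1 ord0 j = z l ord0 j.
    by move=> jl; rewrite !mxE ltnS leq_eqVlt (inj_eq val_inj) (negbTE jl).
  have inter j v : v = x ord0 j \/ v = y ord0 j ->
      Num.min (x ord0 j) (y ord0 j) <= v <= Num.max (x ord0 j) (y ord0 j).
    by case=> ->; rewrite ge_min le_max lexx ?orbT.
  have inz q j : z q ord0 j = x ord0 j \/ z q ord0 j = y ord0 j.
    by rewrite mxE; case: ifP; [left|right].
  have zll : z l ord0 l = y ord0 l by rewrite mxE ltnn.
  have zlS : z l.+1 ord0 l = x ord0 l by rewrite mxE ltnSn.
  have shift_row (s : R) (v : 'rV[R]_n) j :
      (s *: delta_mx ord0 l + v) ord0 j = (if j == l then s else 0) + v ord0 j.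
    by rewrite !mxE eqxx /=; case: eqP => _; rewrite ?mulr1 ?mulr0.
  have [yx|xy] := leP (y ord0 l) (x ord0 l).
    have h0 : 0 <= x ord0 l - y ord0 l by rewrite subr_ge0.
    have zE : z l.+1 = (x ord0 l - y ord0 l) *: delta_mx ord0 l + z l.
      apply/rowP => j; rewrite shift_row; case: eqP => [->|/eqP/zl1->].
        by rewrite zll zlS subrK.
      by rewrite add0r.
    rewrite zE; apply: le_trans (ler_wpM2l M0 xyl); rewrite (ger0_norm h0).
    apply: (@lipschitz_coord n [set x | `|x| < r]) => //.
    - by move=> v /dw.
    - by move=> v /wM.
    - move=> s sh; apply: ball_coord => j; rewrite shift_row.
      case: eqP => [->|_]; last by rewrite add0r; exact: inter (inz l j).
      by rewrite zll minC maxC; exact: between.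
  have h0 : 0 <= y ord0 l - x ord0 l by rewrite subr_ge0 ltW.
  have zE : z l = (y ord0 l - x ord0 l) *: delta_mx ord0 l + z l.+1.
    apply/rowP => j; rewrite shift_row; case: eqP => [->|/eqP/zl1->].
      by rewrite zll zlS subrK.
    by rewrite add0r.
  rewrite distrC [X in w X - _]zE; apply: le_trans (ler_wpM2l M0 xyl).
  rewrite (distrC (x ord0 l)) (ger0_norm h0).
  apply: (@lipschitz_coord n [set x | `|x| < r]) => //.
  - by move=> v /dw.
  - by move=> v /wM.
  - move=> s sh; apply: ball_coord => j; rewrite shift_row.
    case: eqP => [->|_]; last by rewrite add0r; exact: inter (inz l.+1 j).
    by rewrite zlS; exact: between.
have zn : z n = x by apply/rowP => j; rewrite mxE ltn_ord.
have z0 : z 0%N = y by apply/rowP => j; rewrite mxE.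
have tel : w x - w y = \sum_(l < n) (w (z l.+1) - w (z l)).
  by rewrite -zn -z0 -(telescope_sumr (fun l => w (z l)))// big_mkord.
rewrite tel (le_trans (ler_norm_sum _ _ _))//.
apply: (@le_trans _ _ (\sum_(l < n) M * `|x - y|)); first exact: ler_sum.
by rewrite sumr_const card_ord -mulrA mulr_natl.
Qed.

Lemma enorm_le_sum n (x : 'rV[R]_n) : enorm x <= \sum_(i < n) `|x ord0 i|.
Proof.
have S0 : 0 <= \sum_(i < n) `|x ord0 i| by apply: sumr_ge0.
rewrite /enorm -(ger0_norm S0) -sqrtr_sqr ler_sqrt ?sqr_ge0//.
rewrite expr2 mulr_suml; apply: ler_sum => i _.
rewrite -real_normK ?num_real// expr2 ler_wpM2l//.
by rewrite (bigD1 i)//= lerDl sumr_ge0.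
Qed.

(** The rows of F are unit vectors. *)
Lemma orthogonal_entry n (F : 'M[R]_n) : F *m F^T = 1%:M ->
  forall i j, `|F i j| <= 1.
Proof.
move=> FF i j.
have := congr1 (fun A : 'M[R]_n => A i i) FF; rewrite !mxE eqxx => h.
rewrite -(ler_pXn2r (n := 2))// ?nnegrE// expr1n real_normK ?num_real//.
rewrite -[leRHS](h : _ = 1) (bigD1 j)//= mxE expr2 lerDl sumr_ge0// => l _.
by rewrite mxE -expr2 sqr_ge0.
Qed.

Lemma chart_param_lipschitz Om b (c : chart R m) : chart_of Om b c ->
  exists2 L, 0 <= L & forall y y', `|y| < chart_radius c ->
    `|y'| < chart_radius c ->
    enorm (chart_param c y - chart_param c y') <= L * `|y - y'|.
Proof.
move=> [FF [r0 _] [M' GM] _ _].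
pose M := Num.max 0 M'; have M0 : 0 <= M by rewrite le_max lexx.
have grad x i : `|x| < chart_radius c -> `|ds i (chart_graph c) x| <= M.
  by move=> xr; rewrite le_max (holder2_le_gradient GM i xr) orbT.
have lipG := @lipschitz_ball m (chart_radius c) M (chart_graph c) M0
  (fun x i xr => (GM.1 x xr i).1) grad.
pose L := Num.max 1 (m%:R * M).
exists (m.+1%:R * (m.+1%:R * L)) => [|y y' yr y'r].
  by rewrite !mulr_ge0// /L le_max ler01.
pose d := cons_row (chart_graph c y, y) - cons_row (chart_graph c y', y').
have -> : chart_param c y - chart_param c y' = d *m (chart_frame c)^T.
  by rewrite /chart_param /d mulmxBl opprD addrACA subrr add0r.
have dL j : `|d ord0 j| <= L * `|y - y'|.
  rewrite /d !mxE; case: unliftP => [l _|_] /=.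
    have := coord_le_norm (y - y') l; rewrite !mxE => /le_trans; apply.
    by rewrite ler_peMl// /L le_max lexx.
  apply: le_trans (lipG _ _ yr y'r) _.
  by rewrite ler_wpM2r// /L le_max lexx orbT.
apply: le_trans (enorm_le_sum _) _.
have sumE (r : R) : m.+1%:R * r = \sum_(i < m.+1) r.
  by rewrite sumr_const card_ord mulr_natl.
rewrite -!mulrA [leRHS]sumE.
apply: ler_sum => i _; rewrite mxE (le_trans (ler_norm_sum _ _ _))//.
rewrite [leRHS]sumE.
apply: ler_sum => j _; rewrite normrM -[leRHS]mulr1.
by apply: ler_pM => //; rewrite mxE; exact: (orthogonal_entry FF).
Qed.

Lemma chart_param_coord (c : chart R m) x :
  chart_frame c *m (chart_frame c)^T = 1%:M ->
  (chart_coord c x).1 = chart_graph c (chart_coord c x).2 ->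
  x = chart_param c (chart_coord c x).2.
Proof.
move=> FF h; rewrite /chart_param -h -surjective_pairing /chart_coord uncons_rowK.
by rewrite -mulmxA FF mulmx1 addrC subrK.
Qed.

(** In chart coordinates a boundary point lies on the graph, so it is the image of
    its horizontal coordinates. *)
Lemma boundary_param (Om : set 'rV[R]_m.+1) b K (atlas : 'I_K -> chart R m) x :
  atlas_of Om b atlas -> boundary Om x -> exists k y,
    [/\ chart_base (atlas k) y, chart_cylinder (atlas k) x &
        x = chart_param (atlas k) y].
Proof.
move=> [hc hcov] bx; have [k xk] := hcov x bx.
have [FF _ _ _ /(_ x xk) [_ [h _]]] := hc k.
exists k, (chart_coord (atlas k) x).2; split => //; first by case: xk.
exact: chart_param_coord FF (h bx).
Qed.

Lemma hausdorff_boundary_lty (Om : set 'rV[R]_m.+1) b K (atlas : 'I_K -> chart R m) :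
  atlas_of Om b atlas -> (hausdorff m (boundary Om) < +oo)%E.
Proof.
move=> hat; have [hc _] := hat.
pose A k := chart_param (atlas k) @` chart_base (atlas k).
have cov : boundary Om `<=` \big[setU/set0]_(k <- enum 'I_K) A k.
  move=> x bx; have [k [y [yb _ xE]]] := boundary_param hat bx.
  by apply: (@bigsetU_in _ _ _ _ k); [rewrite mem_enum|exists y].
apply: (le_lt_trans (le_hausdorff m cov)).
apply: (le_lt_trans (outer_measure_big (hausdorff m) _ _)).
apply: lte_sum_pinfty => k _.
have [L L0 lip] := chart_param_lipschitz (hc k).
have [_ [r0 _] _ _ _] := hc k.
exact: (lipschitz_image_lty r0 L0 lip).
Qed.

Lemma open_measurable_rV n (U : set 'rV[R]_n) : open U -> measurable U.
Proof.
move=> oU.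
have oUT : open ((fst : 'rV[R]_n * R -> 'rV[R]_n) @^-1` U).
  by apply: open_comp => // p _; exact: cvg_fst.
have := open_measurable_XT oUT => mU.
have mpair : measurable_fun setT (fun x : 'rV[R]_n => (x, 0) : 'rV[R]_n * measurableTypeR R).
  by apply: measurable_fun_pair; [exact: measurable_id|exact: measurable_cst].
by have := mpair measurableT _ mU; rewrite setTI.
Qed.

Lemma measurable_boundary (Om : set 'rV[R]_m.+1) : open Om ->
  measurable (boundary Om).
Proof.
move=> oU; apply: measurableD; last exact: open_measurable_rV.
rewrite -[closure Om]setCK; apply: measurableC; apply: open_measurable_rV.
exact/closed_openC/closed_closure.
Qed.

(** The Hausdorff measure being a measure on Borel sets, the surface measure of the
    cylinder is the product of that of the boundary by the length T. *)
Lemma surface_cylinder_lty (Om : set 'rV[R]_m.+1) b K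
    (atlas : 'I_K -> chart R m) (T : R) : open Om -> atlas_of Om b atlas ->
  (surface_st m (boundary Om `*` `]0%R, T[) < +oo)%E.
Proof.
move=> oU hat; rewrite /surface_st product_measure1E; last 2 first.
  exact: measurable_boundary.
  exact: measurable_itv.
rewrite lte_mul_pinfty//.
- by rewrite ge0_fin_numE ?hausdorff_ge0// (hausdorff_boundary_lty hat).
by rewrite [X in (X < _)%E]lebesgue_measure_itv/=; case: ifP => _; rewrite ?ltry.
Qed.

End BoundaryMeasure.

(** * Bounds passed to closures, and null sets *)

Section Pointwise.
Context {R : realType}.

(** A strict violation at p would persist near p within the closure of A, hence at
    points of A. *)
Lemma closure_bound (S : topologicalType) (A : set S) (v : S -> R) e :
  {within closure A, continuous v} -> (forall p, A p -> `|v p| <= e) ->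
  forall p, closure A p -> `|v p| <= e.
Proof.
move=> /subspace_continuousP cv hA p cp; rewrite leNgt; apply/negP => vp.
have : \forall q \near within (closure A) (nbhs p), e < `|v q|.
  have cvp : v q @[q --> within (closure A) (nbhs p)] --> v p := cv p cp.
  exact: (cvgr_norm_gt (v p) cvp _ vp).
move=> /cp[q [Aq /(_ (subset_closure Aq))]] /=.
by rewrite ltNge hA.
Qed.

Lemma ext_bound (S : topologicalType) (A : set S) (F G : S -> R) p e :
  closure A p -> cvg (F q @[q --> within A (nbhs p)]) ->
  cvg (G q @[q --> within A (nbhs p)]) ->
  (forall q, A q -> `|F q - G q| <= e) -> `|ext A F p - ext A G p| <= e.
Proof.
move=> cp cF cG FG.
have PF : ProperFilter (within A (nbhs p)).
  apply: Build_ProperFilter_ex => P /cp[q [Aq Pq]].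
  by exists q; exact: Pq.
rewrite leNgt; apply/negP => vp.
have cFG : (F q - G q) @[q --> within A (nbhs p)] --> ext A F p - ext A G p.
  by apply: cvgB.
have : \forall q \near within A (nbhs p), e < `|F q - G q|.
  exact: (cvgr_norm_gt _ cFG _ vp).
move=> /cp[q [Aq /(_ Aq)]] /=.
by rewrite ltNge FG.
Qed.

Lemma lipschitz_of_derive_bound (h : R -> R) (B c : R) :
  (forall s, derivable h s 1) -> (forall s, `|s| <= c -> `|derive1 h s| <= B) ->
  forall s t, `|s| <= c -> `|t| <= c -> `|h s - h t| <= B * `|s - t|.
Proof.
move=> dh hB.
suff hle s t : `|s| <= c -> `|t| <= c -> s <= t -> `|h s - h t| <= B * `|s - t|.
  move=> s t sc tc; have [st|/ltW ts] := leP s t; first exact: hle.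
  by rewrite distrC (distrC s); exact: hle.
move=> sc tc st.
have dh1 (x : R) : is_derive x 1 h (derive1 h x).
  by rewrite derive1E; exact/derivableP.
have ch : {within `[s, t], continuous h}.
  by apply: derivable_within_continuous => x _; exact: dh.
have [x xst E] := MVT_segment st (fun x _ => dh1 x) ch.
rewrite distrC E normrM (distrC s) ler_wpM2r// hB//.
move: sc tc xst; rewrite in_itv/= !ler_norml => /andP[a b] /andP[a' b'] /andP[k l].
by apply/andP; split; lra.
Qed.

Import HBNNSimple.

(** For any nonnegative f, measurable or not, the integral is a supremum over
    simple functions below f, which all vanish off D. *)
Lemma ge0_null_integral d (T : measurableType d) (mu : {measure set T -> \bar R})
    (D : set T) (f : T -> \bar R) : measurable D -> mu D = 0%E ->
  (forall x, D x -> (0 <= f x)%E) -> (\int[mu]_(x in D) f x = 0)%E.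
Proof.
move=> mD D0 f0; apply/eqP; rewrite eq_le integral_ge0// andbT.
rewrite ge0_integralE//; apply: ge_ereal_sup => _ [h hf <-].
rewrite -integralT_nnsfun.
have mh : measurable_fun setT (EFin \o h) by exact/measurable_EFinP.
have -> : (fun x => (h x)%:E) = (EFin \o h) \_ D.
  apply/funext => x; rewrite patchE; case: ifPn => // xD.
  have := hf x; rewrite patchE (negbTE xD) => hx.
  by apply/eqP; rewrite eq_le hx lee_fin fun_ge0.
rewrite -integral_mkcond null_set_integral//; exact: measurable_funTS.
Qed.

(** If D is null, the normalising factor of the average is 0 and says nothing, but
    then the integral vanishes. *)
Lemma L2sq_le d (T : measurableType d) (mu : {measure set T -> \bar R})
    (D : set T) (v : T -> R) (B : R) : measurable D -> (mu D < +oo)%E ->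
  (L2avsq mu D v <= B%:E)%E -> 0 <= B ->
  (L2sq mu D v <= (fine (mu D) * B)%:E)%E.
Proof.
move=> mD Doo hB B0.
have fD : mu D \is a fin_num by rewrite ge0_fin_numE.
have [D0|D0] := eqVneq (mu D) 0%E.
  rewrite D0 mul0r.
  by rewrite /L2sq (ge0_null_integral mD D0)// => x _; rewrite lee_fin sqr_ge0.
have D0' : 0 < fine (mu D) by rewrite fine_gt0// lt0e D0 measure_ge0 Doo.
move: hB; rewrite /L2avsq => hB.
have := @lee_wpmul2l _ (fine (mu D))%:E _ _ _ hB.
rewrite lee_fin => /(_ (ltW D0')).
by rewrite muleA -EFinM divff ?gt_eqF// mul1e.
Qed.

End Pointwise.

(** * Residuals of approximating networks *)

(** The arithmetic common to the seven residuals: e stands for the distance to the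
    reference point and the other letters for the summands of the constant. *)
Lemma le_budget (R : realType) (x e a b c d g : R) :
  [/\ 0 <= e, 0 <= a, 0 <= b & 0 <= c] -> 0 <= d -> 0 <= g ->
  [\/ x <= e + a + d, x <= e + a + d + g + e, x <= c + b | x <= e + e] ->
  x <= 2 * e + a + b + c + d + g.
Proof. by move=> [? ? ? ?] ? ? [] ?; lra. Qed.

Section ResidualEstimates.
Context {R : realType} {m : nat}.
Variable pb : problem R m.
Local Notation X := 'rV[R]_m.+1.
Local Notation XT := ('rV[R]_m.+1 * R)%type.
Local Notation Om := (pb_Omega pb).
Local Notation T := (pb_T pb).
Local Notation nu := (pb_nu pb).
Local Notation alpha := (pb_alpha pb).
Local Notation f := (pb_f pb).
Local Notation f' := (derive1 (pb_f pb)).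
Local Notation Q := (cylinder pb).
Local Notation Sigma := (lateral pb).

Lemma open_cylinder : open Om -> open Q.
Proof.
move=> oOm.
have -> : Q = ((fst : XT -> X) @^-1` Om) `&` ((snd : XT -> R) @^-1` `]0, T[%classic).
  by apply/seteqP; split => p [].
apply: openI; apply: open_comp => //.
- by move=> p _; exact: cvg_fst.
- by move=> p _; exact: cvg_snd.
Qed.

(** The lateral boundary and both bases of the cylinder are covered by this. *)
Lemma closure_cylinder x t : 0 < T -> closure Om x -> 0 <= t <= T ->
  closure Q (x, t).
Proof.
move=> T0 cx /andP[t0 tT] A /nbhs_ballP[e /= e0 eA].
have [y [Oy [_ xy]]] := cx _ (nbhsx_ballx x e e0).
have [s sT st] : exists2 s, 0 < s < T & `|t - s| < e.
  have [->|t0'] := eqVneq t 0.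
    exists (Num.min (e / 2) (T / 2)).
      rewrite lt_min gt_min !divr_gt0//=; apply/orP; right; lra.
    rewrite sub0r normrN ger0_norm.
      by rewrite gt_min; apply/orP; left; lra.
    by rewrite le_min !divr_ge0// ltW.
  have [->|tT'] := eqVneq t T.
    exists (Num.max (T - e / 2) (T / 2)).
      rewrite lt_max gt_max; apply/andP; split; first by apply/orP; right; lra.
      by apply/andP; split; lra.
    have h1 : T - e / 2 <= Num.max (T - e / 2) (T / 2) by rewrite le_max lexx.
    have h2 : Num.max (T - e / 2) (T / 2) <= T by rewrite ge_max; apply/andP; split; lra.
    by rewrite ger0_norm ?subr_ge0//; lra.
  exists t; last by rewrite subrr normr0.
  by rewrite !lt_neqAle eq_sym t0' t0 tT' tT.
exists (y, s); split; first by split => //=; rewrite in_itv.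
by apply: eA; split => //; split.
Qed.

Lemma lateral_closure p : 0 < T -> Sigma p -> closure Q p.
Proof.
case: p => x t T0 [[cx _] /=]; rewrite in_itv/= => /andP[t0 tT].
by apply: closure_cylinder => //; rewrite !ltW.
Qed.

Lemma compact_closure_cylinder : bounded_set Om -> compact (closure Q).
Proof.
move=> bOm.
have [M M0 OmM] := bounded_box bOm.
pose K := [set x : X | forall i, `[- M, M]%classic (x ord0 i)] `*` `[0, T]%classic : set XT.
have cK : compact K.
  apply: compact_setX; last exact: segment_compact.
  by apply: (@rV_compact R _ (fun=> `[- M, M]%classic)) => i; exact: segment_compact.
apply: (subclosed_compact _ cK); first exact: closed_closure.
have clK : closed K by apply: compact_closed => //; exact: norm_hausdorff.
rewrite [X in _ `<=` X]((closure_id K).1 clK); apply: closure_subset.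
move=> [x t] [/OmM xM /=]; rewrite !in_itv/= => /andP[/ltW t0 /ltW tT].
split => [i|] /=; rewrite in_itv/= ?t0 ?tT//.
by have := xM i; rewrite mxE subr0 ltr_norml => /andP[/ltW-> /ltW->].
Qed.

Lemma bounded_on_closure (v : XT -> R) : bounded_set Om ->
  {within closure Q, continuous v} ->
  exists2 B, 0 <= B & forall p, closure Q p -> `|v p| <= B.
Proof.
move=> bOm cv.
have /compact_bounded[C [_ hC]] := continuous_compact cv (compact_closure_cylinder bOm).
exists (`|C| + 1); first by rewrite addr_ge0.
move=> p cp; apply: (hC (`|C| + 1)); last by exists p.
by have := ler_norm C; lra.
Qed.

(** A crude bound: the entries of the frame and the coordinates of the normalised
    vector are at most 1 in absolute value. *)
Lemma normal_bound p i : atlas_of Om (pb_beta pb) (pb_atlas (p := pb)) ->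
  outward_unit_normal (pb_atlas (p := pb)) (pb_normal pb) ->
  boundary Om p -> `|pb_normal pb p ord0 i| <= m.+1%:R.
Proof.
move=> hat hn bp.
have [k [y [yb _ ->]]] := boundary_param hat bp.
rewrite (hn k y yb); set c := pb_atlas k.
have [[FF _ _ _ _]] := hat.1 k.
set S := 1 + _; have S1 : 1 <= S by rewrite /S lerDl sumr_ge0// => j _; exact: sqr_ge0.
have sS : 0 < Num.sqrt S by rewrite sqrtr_gt0 (lt_le_trans ltr01).
set v := cons_row _.
have vS j : `|v ord0 j| <= Num.sqrt S.
  rewrite -sqrtr_sqr ler_sqrt; last by rewrite (le_trans ler01).
  rewrite /v mxE; case: unliftP => [l _|_] /=; last by rewrite sqrrN expr1n.
  rewrite mxE /S (bigD1 l)//= addrCA lerDl addr_ge0// sumr_ge0// => j' _.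
  exact: sqr_ge0.
rewrite mxE normrM (_ : `|(Num.sqrt S)^-1| = (Num.sqrt S)^-1); last first.
  by rewrite ger0_norm// invr_ge0 ltW.
rewrite ler_pdivrMl// [leRHS]mulrC.
rewrite mxE (le_trans (ler_norm_sum _ _ _))//.
have sumE (r : R) : m.+1%:R * r = \sum_(i < m.+1) r.
  by rewrite sumr_const card_ord mulr_natl.
rewrite [leRHS]sumE; apply: ler_sum => j _.
rewrite normrM -[leRHS]mulr1.
by apply: ler_pM => //; rewrite mxE; exact: (orthogonal_entry FF).
Qed.

Variables (zs z : triple R m) (uext : XT -> R).
Local Notation y := (st zs).
Local Notation lam := (adj zs).
Local Notation Y := (st z).
Local Notation Lam := (adj z).

(* B bounds the reference state and adjoint, [-c, c] contains the values of the
   states, and F1, F2 are Lipschitz constants of f and f' there; none of them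
   depends on the network z. *)
Variables (B c F1 F2 e : R).
Hypotheses (oOm : open Om) (T0 : 0 < T) (nu0 : 0 < nu) (alpha0 : 0 < alpha).
Hypothesis hat : atlas_of Om (pb_beta pb) (pb_atlas (p := pb)).
Hypothesis hn : outward_unit_normal (pb_atlas (p := pb)) (pb_normal pb).
Hypothesis kkt : classical_KKT pb zs.
Hypothesis yB : forall p, closure Q p -> `|y p| <= B.
Hypothesis lamB : forall p, closure Q p -> `|lam p| <= B.
Hypothesis f1c : forall s, `|s| <= c -> `|f' s| <= F1.
Hypothesis fL : forall s t, `|s| <= c -> `|t| <= c -> `|f s - f t| <= F1 * `|s - t|.
Hypothesis f'L : forall s t, `|s| <= c -> `|t| <= c -> `|f' s - f' t| <= F2 * `|s - t|.
Hypothesis e0 : 0 <= e.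
Hypothesis Bec : B + e <= c.
Hypothesis F10 : 0 <= F1.
Hypothesis F20 : 0 <= F2.
Hypothesis B0 : 0 <= B.
Hypothesis netY : is_tanh_network Y.
Hypothesis netL : is_tanh_network Lam.
Hypothesis netU : is_tanh_network (ctl z).
Hypothesis cu : {within closure Q, continuous uext}.
Hypothesis uE : forall p, Sigma p -> uext p = ctl zs p.
Hypothesis sY : (sobolev_inf_norm Q 2 (fun p => y p - Y p)%R < e%:E)%E.
Hypothesis sL : (sobolev_inf_norm Q 2 (fun p => lam p - Lam p)%R < e%:E)%E.
Hypothesis sU : (sobolev_inf_norm Q 1 (fun p => uext p - ctl z p)%R < e%:E)%E.

Definition residual_constant : R :=
  2 + m.+1%:R * nu + nu * m.+1%:R * m.+1%:R + alpha + F1 + F2 * B.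

Lemma within_sub (v w : XT -> R) : {within closure Q, continuous v} -> continuous w ->
  {within closure Q, continuous (fun p => v p - w p)}.
Proof.
move=> cv cw; apply/subspace_continuousP => p cp.
apply: cvgB; first by move/subspace_continuousP : cv; exact.
by apply: cvg_within_filter; exact: cw.
Qed.

(** Subtract from each residual the corresponding KKT equation, and estimate what
    remains by the distance of the network to the reference point: the equations
    are linear up to f, which is Lipschitz on the range of the states. *)
Lemma residual_bound r p :
  match r with
  | Res_y | Res_lambda => Q p
  | Res_u | Res_bc_y | Res_bc_lambda => Sigma p
  | Res_ic_y | Res_T_lambda => Om p.1
  end -> `|resid pb z r p| <= residual_constant * e.
Proof.
have oQ := open_cylinder oOm.
have [[C2y C2l [cy cl] cdl] [eqy eql eqS eqO]] := kkt.
have CY := Ck_tanh_network 2 netY; have CL := Ck_tanh_network 2 netL.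
have CU := Ck_tanh_network 0 netU.
have C2Y : C21 Q Y := Ck_C21 Q CY. have C2L : C21 Q Lam := Ck_C21 Q CL.
have [C2v dtv dxv lapv] := C21_sub oQ C2y C2Y.
have [C2l' dtl dxl lapl] := C21_sub oQ C2l C2L.
have bv := sobolev_C21_bounds oQ C2v sY.
have bl := sobolev_C21_bounds oQ C2l' sL.
have cbv : forall p, closure Q p -> `|y p - Y p| <= e.
  apply: closure_bound; last by move=> q /bv[].
  by apply: within_sub => //; exact: Ck_continuous CY.
have cbl : forall p, closure Q p -> `|lam p - Lam p| <= e.
  apply: closure_bound; last by move=> q /bl[].
  by apply: within_sub => //; exact: Ck_continuous CL.
have cbu : forall p, closure Q p -> `|uext p - ctl z p| <= e.
  have cv := within_sub cu (Ck_continuous CU).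
  apply: closure_bound => //; apply: (sobolev_bound0 oQ _ sU) => q Qq.
  have : {within Q, continuous (fun p => uext p - ctl z p)}.
    exact: continuous_subspaceW (@subset_closure _ Q) cv.
  by rewrite continuous_open_subspace//; apply; rewrite inE.
have Yc p0 : closure Q p0 -> `|Y p0| <= c.
  move=> cp; rewrite -(subKr (y p0) (Y p0)) (le_trans (ler_normB _ _))//.
  by rewrite (le_trans _ Bec)// lerD ?yB ?cbv.
have yc p0 : closure Q p0 -> `|y p0| <= c.
  by move=> cp; rewrite (le_trans (yB cp))// (le_trans _ Bec)// lerDl.
pose n : R := m.+1%:R.
have n0 : 0 <= n by exact: ler0n.
have nu0' := ltW nu0; have alpha0' := ltW alpha0.
have t1 : 0 <= n * nu * e by rewrite !mulr_ge0.
have t2 : 0 <= nu * n * n * e by rewrite !mulr_ge0.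
have t3 : 0 <= alpha * e by rewrite !mulr_ge0.
have t4 : 0 <= F1 * e by rewrite !mulr_ge0.
have t5 : 0 <= F2 * B * e by rewrite !mulr_ge0.
have KE : residual_constant * e = 2 * e + n * nu * e + nu * n * n * e
    + alpha * e + F1 * e + F2 * B * e.
  by rewrite /residual_constant -/n; ring.
rewrite KE.
have budget := le_budget (And4 e0 t1 t2 t3) t4 t5.
have lapE : nu * (e *+ m.+1) = n * nu * e by rewrite -mulr_natl -/n; ring.
case: r => /= hp.
- have cp := subset_closure hp.
  have [a0 a1 a2 a3] := bv _ hp; rewrite dtv// lapv// in a1 a3.
  have -> : dt Y p - nu * laplace_x Y p + f (Y p) - pb_g pb p =
      - (dt y p - dt Y p) + nu * (laplace_x y p - laplace_x Y p) + (f (Y p) - f (y p)).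
    by rewrite -[LHS]subr0 -(eqy p hp); ring.
  have b1 : `|nu * (laplace_x y p - laplace_x Y p)| <= n * nu * e.
    by rewrite normrM gtr0_norm// -lapE ler_wpM2l.
  have b2 : `|f (Y p) - f (y p)| <= F1 * e.
    apply: le_trans (fL (Yc _ cp) (yc _ cp)) _.
    by rewrite ler_wpM2l// distrC.
  rewrite (le_trans (ler_normD _ _))// (le_trans (lerD (ler_normD _ _) (lexx _)))// normrN.
  apply: budget; constructor 1; rewrite lerD// lerD//.
- have cp := subset_closure hp.
  have [a0 a1 a2 a3] := bl _ hp; rewrite dtl// lapl// in a1 a3.
  have -> : - dt Lam p - nu * laplace_x Lam p + f' (Y p) * Lam p + Y p - pb_yd pb p =
      (dt lam p - dt Lam p) + nu * (laplace_x lam p - laplace_x Lam p)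
      + (- (f' (Y p) * (lam p - Lam p))) + (f' (Y p) - f' (y p)) * lam p
      + (- (y p - Y p)).
    by rewrite -[LHS]subr0 -(eql p hp); ring.
  have b1 : `|nu * (laplace_x lam p - laplace_x Lam p)| <= n * nu * e.
    by rewrite normrM gtr0_norm// -lapE ler_wpM2l.
  have b2 : `|- (f' (Y p) * (lam p - Lam p))| <= F1 * e.
    by rewrite normrN normrM ler_pM// f1c// Yc.
  have b3 : `|(f' (Y p) - f' (y p)) * lam p| <= F2 * B * e.
    rewrite normrM -mulrA (mulrC B) mulrA ler_pM//; last exact: lamB.
    apply: le_trans (f'L (Yc _ cp) (yc _ cp)) _.
    by rewrite ler_wpM2l// distrC; exact: cbv.
  have b4 : `|- (y p - Y p)| <= e by rewrite normrN; exact: cbv.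
  apply: budget; constructor 2.
  by do 4!(apply: le_trans (ler_normD _ _) _; apply: lerD => //).
- have cp := lateral_closure T0 hp.
  have [equ _ _] := eqS p hp.
  have -> : alpha * ctl z p + nu * normal_derivative pb Lam p =
     - (alpha * (ctl zs p - ctl z p))
     + - (nu * (normal_derivative pb lam p - normal_derivative pb Lam p)).
    by rewrite -[LHS]subr0 -equ; ring.
  have b1 : `|- (alpha * (ctl zs p - ctl z p))| <= alpha * e.
    by rewrite normrN normrM gtr0_norm// ler_wpM2l// -uE//; exact: cbu.
  have b2 : `|- (nu * (normal_derivative pb lam p - normal_derivative pb Lam p))|
      <= nu * n * n * e.
    rewrite normrN normrM gtr0_norm// -!mulrA ler_wpM2l//.
    rewrite /normal_derivative -sumrB (le_trans (ler_norm_sum _ _ _))//.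
    have -> : n * (n * e) = \sum_(i < m.+1) n * e by rewrite sumr_const card_ord mulr_natl.
    apply: ler_sum => i _; rewrite -mulrBl normrM mulrC.
    apply: ler_pM => //; first by apply: normal_bound => //; case: hp.
    apply: ext_bound cp _ _ _.
    + exact: cdl.
    + have [_ CLi] := CL; have [_ [cdL _]] := CLi (Some i).
      by apply: (cvgP (dx i Lam p)); apply: cvg_within_filter; exact: cdL.
    + by move=> q Qq; have [_ _ h _] := bl q Qq; rewrite -dxl.
  rewrite (le_trans (ler_normD _ _))//.
  by apply: budget; constructor 3; exact: lerD.
- have cp := lateral_closure T0 hp.
  have [_ yu _] := eqS p hp.
  have -> : Y p - ctl z p = - (y p - Y p) + (uext p - ctl z p) by rewrite uE// yu; ring.
  rewrite (le_trans (ler_normD _ _))// normrN.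
  by apply: budget; constructor 4; rewrite lerD ?cbv ?cbu.
- have cp := lateral_closure T0 hp.
  have [_ _ l0] := eqS p hp.
  have := cbl _ cp; rewrite l0 sub0r normrN.
  by move=> h; apply: budget; constructor 4; rewrite (le_trans h)// lerDl.
- have cp : closure Q (p.1, 0).
    by apply: closure_cylinder => //; [exact: subset_closure|rewrite lexx ltW].
  have [y00 _] := eqO _ hp.
  have := cbv _ cp; rewrite y00 distrC.
  by move=> h; apply: budget; constructor 4; rewrite (le_trans h)// lerDl.
- have cp : closure Q (p.1, T).
    by apply: closure_cylinder => //; [exact: subset_closure|rewrite lexx ltW].
  have [_ l0] := eqO _ hp.
  have := cbl _ cp; rewrite l0 sub0r normrN.
  by move=> h; apply: budget; constructor 4; rewrite (le_trans h)// lerDl.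
Qed.

End ResidualEstimates.

(** * Union bound and averaged residuals *)

Section Residuals.
Context {R : realType}.

Lemma le_sum_residuals (F : residual -> R) r : (forall r, 0 <= F r) ->
  F r <= \sum_(r <- residuals) F r.
Proof.
move=> F0; rewrite /residuals !big_cons big_nil.
have := F0 Res_y; have := F0 Res_lambda; have := F0 Res_u; have := F0 Res_bc_y.
have := F0 Res_bc_lambda; have := F0 Res_ic_y; have := F0 Res_T_lambda.
by case: r; lra.
Qed.

Lemma le_max_residuals (F : residual -> R) r :
  F r <= \big[Num.max/0]_(r <- residuals) F r.
Proof.
by rewrite /residuals !big_cons big_nil; case: r; rewrite !le_max lexx ?orbT.
Qed.

Lemma in_bigsetU_residuals W (A : residual -> set W) r w : A r w ->
  (\big[setU/set0]_(r <- residuals) A r) w.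
Proof.
by rewrite /residuals !big_cons big_nil; case: r => Aw; rewrite /setU/=; tauto.
Qed.

(** The complement of the intersection is the union of the seven failure events,
    which need not be independent. *)
Lemma union_bound d (W : measurableType d) (P : probability W R)
    (E : residual -> set W) (q : residual -> R) :
  (forall r, measurable (E r)) -> (forall r, ((1 - q r)%:E <= P (E r))%E) ->
  exists F : set W, [/\ measurable F,
    ((1 - \sum_(r <- residuals) q r)%:E <= P F)%E & forall r w, F w -> E r w].
Proof.
move=> mE PE.
have h (s : seq residual) : measurable (\big[setU/set0]_(r <- s) ~` E r) /\
    (P (\big[setU/set0]_(r <- s) ~` E r) <= (\sum_(r <- s) q r)%:E)%E.
  elim: s => [|r s [mU PU]]; first by rewrite !big_nil measure0.
  have mC : measurable (~` E r) by exact: measurableC.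
  rewrite !big_cons; split; first exact: measurableU.
  apply: le_trans (measureU2 _ mC mU) _; rewrite EFinD; apply: leeD => //.
  rewrite [X in (X <= _)%E](probability_setC P (mE r)).
  have fE : P (E r) \is a fin_num by exact: fin_num_measure.
  by move: (PE r); rewrite -(fineK fE) -EFinB !lee_fin; lra.
have [mU PU] := h residuals.
exists (~` \big[setU/set0]_(r <- residuals) ~` E r); split.
- exact: measurableC.
- rewrite [X in (_ <= X)%E](probability_setC P mU).
  have fU : P (\big[setU/set0]_(r <- residuals) ~` E r) \is a fin_num.
    exact: fin_num_measure.
  by move: PU; rewrite -(fineK fU) -EFinB !lee_fin; lra.
- by move=> r w nU; apply: contrapT => nE; apply: nU; exact: (@in_bigsetU_residuals _ (fun r => ~` E r) r).
Qed.

(** The form in which the square root of a sum of squares is used below. *)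
Lemma L2norm_le d (T : measurableType d) (mu : set T -> \bar R) (D : set T)
    (v : T -> R) (a b : R) : 0 <= a -> 0 <= b ->
  (L2sq mu D v <= (a ^+ 2 + b ^+ 2)%:E)%E -> (0 <= L2sq mu D v)%E ->
  (L2norm mu D v <= (a + b)%:E)%E.
Proof.
move=> a0 b0 h h0; rewrite /L2norm.
have fL : L2sq mu D v \is a fin_num.
  by rewrite ge0_fin_numE// (le_lt_trans h) ?ltry.
move: h h0; rewrite -(fineK fL) !lee_fin => h h0.
rewrite ?poweR_EFin ?lee_fin powR12_sqrt// -(ger0_norm (addr_ge0 a0 b0)) -sqrtr_sqr.
rewrite ler_sqrt ?sqr_ge0//; apply: le_trans h _.
by have := mulr_ge0 a0 b0; nra.
Qed.

End Residuals.

Section Assembly.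
Context {R : realType} {m : nat}.
Variable pb : problem R m.
Local Notation XT := ('rV[R]_m.+1 * R)%type.
Local Notation Om := (pb_Omega pb).
Local Notation T := (pb_T pb).
Local Notation Q := (cylinder pb).
Local Notation Sigma := (lateral pb).

Definition residual_measure (r : residual) : \bar R :=
  match r with
  | Res_y | Res_lambda => lebesgue_st m.+1 Q
  | Res_u | Res_bc_y | Res_bc_lambda => surface_st m Sigma
  | Res_ic_y | Res_T_lambda => lebesgue_rV m.+1 Om
  end.

Definition residual_L2sq (z : triple R m) (r : residual) : \bar R :=
  match r with
  | Res_y | Res_lambda => L2sq (lebesgue_st m.+1) Q (resid pb z r)
  | Res_u | Res_bc_y | Res_bc_lambda => L2sq (surface_st m) Sigma (resid pb z r)
  | Res_ic_y | Res_T_lambda =>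
      L2sq (lebesgue_rV m.+1) Om (fun x => resid pb z r (x, 0))
  end.

Lemma residual_L2sq_le z r (B : R) : well_posed_data pb -> 0 <= B ->
  (residual_L2avsq pb z r <= B%:E)%E ->
  (residual_L2sq z r <= (fine (residual_measure r) * B)%:E)%E.
Proof.
move=> [[oOm _ bOm _] [[_ hat _ [T0 _ _]] _]] B0.
have mOm := open_measurable_rV oOm.
have Om_lty := lebesgue_rV_bounded_lty mOm bOm.
have mI : measurable (`]0, T[%classic : set (measurableTypeR R)).
  exact: measurable_itv.
have mQ : measurable (Q : set ('rV[R]_m.+1 * measurableTypeR R)).
  exact: open_measurable_XT (open_cylinder oOm).
have Q_lty : (lebesgue_st m.+1 Q < +oo)%E.
  rewrite /lebesgue_st [X in (X < _)%E](product_measure1E _ _ mOm mI).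
  rewrite lte_mul_pinfty//; first by rewrite ge0_fin_numE.
  by rewrite [X in (X < _)%E]lebesgue_measure_itv/=; case: ifP => _; rewrite ?ltry.
have mS : measurable (Sigma : set ('rV[R]_m.+1 * measurableTypeR R)).
  exact: (measurableX (measurable_boundary oOm) mI).
have S_lty := surface_cylinder_lty T oOm hat.
by case: r => h /=; exact: L2sq_le.
Qed.

End Assembly.

(** * Losses *)

Section Loss.
Context {R : realType} {m : nat}.
Variable pb : problem R m.

Definition residual_point (r : residual) (p : 'rV[R]_m.+1 * R) : Prop :=
  match r with
  | Res_y | Res_lambda => cylinder pb p
  | Res_u | Res_bc_y | Res_bc_lambda => lateral pb p
  | Res_ic_y | Res_T_lambda => pb_Omega pb p.1
  end.

Lemma mean_sqr_le n (F : 'I_n -> R) (a : R) : (0 < n)%N -> 0 <= a ->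
  (forall j, `|F j| <= a) -> (\sum_(j < n) `|F j| ^+ 2) / n%:R <= a ^+ 2.
Proof.
move=> n0 a0 Fa; rewrite ler_pdivrMr ?ltr0n//.
have -> : a ^+ 2 * n%:R = \sum_(j < n) a ^+ 2.
  by rewrite sumr_const card_ord mulr_natr.
by apply: ler_sum => j _; rewrite lerXn2r ?nnegrE.
Qed.

(** All sampling points lie in the domain of the residual, for every outcome. *)
Lemma loss_le d (W : measurableType d) (P : probability W R) (S : collocation W)
    w (z : triple R m) r (a : R) : space_filling pb P S -> (0 < sample_size S r)%N ->
  0 <= a -> (forall p, residual_point r p -> `|resid pb z r p| <= a) ->
  loss pb S w z r <= a ^+ 2.
Proof.
move=> [[_ [rho1 [_ hint]]] [_ [site [rho2 [hs _ _ hbc]]]]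
  [_ [rho3 [_ hic]]] [_ [rho4 [_ hT]]]].
have hb j : lateral pb (pt_bc (c := S) j w).
  have [_ /(_ w)[h1 h2] _] := hbc j; split => //.
  exact: connected_component_sub h1.
have hi j : cylinder pb (pt_int (c := S) j w) by have [_ /(_ w)] := hint j.
have h0 j : pb_Omega pb (pt_ic (c := S) j w) by have [_ /(_ w)] := hic j.
have h1 j : pb_Omega pb (pt_T (c := S) j w) by have [_ /(_ w)] := hT j.
rewrite /loss; case: r => n0 a0 ha; apply: mean_sqr_le => // j.
- exact: (ha _ (hi j)).
- exact: (ha _ (hi j)).
- exact: (ha _ (hb j)).
- exact: (ha _ (hb j)).
- exact: (ha _ (hb j)).
- exact: (ha (_, _) (h0 j)).
- exact: (ha (_, _) (h1 j)).
Qed.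

Lemma loss_ge0 W (S : collocation W) w (z : triple R m) r : 0 <= loss pb S w z r.
Proof.
by rewrite /loss; case: r; rewrite divr_ge0// sumr_ge0// => j _; exact: sqr_ge0.
Qed.

Lemma loss_le_loss_ind (wt : residual -> R) W (S : collocation W) w
    (z : triple R m) r : (forall r, 0 < wt r) ->
  loss pb S w z r <= (\sum_(r <- residuals) (wt r)^-1) * loss_ind pb wt S w z.
Proof.
move=> wt0.
have h : wt r * loss pb S w z r <= loss_ind pb wt S w z.
  apply: (le_sum_residuals (F := fun r => wt r * loss pb S w z r)) => r'.
  by rewrite mulr_ge0 ?loss_ge0// ltW.
have hw : (wt r)^-1 <= \sum_(r <- residuals) (wt r)^-1.
  by apply: (le_sum_residuals (F := fun r => (wt r)^-1)) => r'; rewrite invr_ge0 ltW.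
apply: (@le_trans _ _ ((wt r)^-1 * (wt r * loss pb S w z r))).
  by rewrite mulrA mulVf ?mul1r ?gt_eqF.
apply: ler_pM => //; first by rewrite invr_ge0 ltW.
by rewrite mulr_ge0 ?loss_ge0// ltW.
Qed.

End Loss.

(** Applied to the three Sobolev norms of the approximability assumption, whose
    infimum need not be attained. *)
Lemma ereal_inf_sum3_lt (R : realType) (T : Type) (A : set T) (F G K : T -> \bar R)
    (a b : R) : (forall z, 0 <= F z)%E -> (forall z, 0 <= G z)%E ->
  (forall z, 0 <= K z)%E ->
  (ereal_inf [set F z + G z + K z | z in A] <= a%:E)%E -> a < b ->
  exists z, [/\ A z, (F z < b%:E)%E, (G z < b%:E)%E & (K z < b%:E)%E].
Proof.
move=> F0 G0 K0 ha ab.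
have /ereal_inf_lt[_ [z Az <-] hz] :
    (ereal_inf [set F z + G z + K z | z in A] < b%:E)%E.
  by apply: le_lt_trans ha _; rewrite lte_fin.
exists z; split => //; apply: le_lt_trans hz.
- by rewrite -addeA leeDl// adde_ge0.
- by rewrite addeAC leeDr// adde_ge0.
- by rewrite leeDr// adde_ge0.
Qed.

(** Removes the slack d left by the infimum over networks. *)
Lemma quadratic_limit (R : realType) (x A eps b : R) : 0 <= A -> 0 <= eps ->
  (forall d, 0 < d <= 1 -> x <= A * (eps + d) ^+ 2 + b) -> x <= A * eps ^+ 2 + b.
Proof.
move=> A0 e0 h; apply/ler_addgt0Pr => eta eta0.
pose q := A * (2 * eps + 1) + 1.
have q0 : 0 < q by rewrite ltr_wpDl// mulr_ge0// addr_ge0// mulr_ge0.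
pose d := Num.min 1 (eta / q).
have d0 : 0 < d by rewrite /d lt_min ltr01 divr_gt0.
have d1 : d <= 1 by rewrite /d ge_min lexx.
have dq : d * q <= eta by rewrite -ler_pdivlMr// /d ge_min lexx orbT.
apply: le_trans (h d _) _; first by rewrite d0 d1.
have : A * (eps + d) ^+ 2 <= A * eps ^+ 2 + d * q.
  have -> : A * eps ^+ 2 + d * q = A * (eps ^+ 2 + d * (2 * eps + 1)) + d.
    by rewrite /q; ring.
  rewrite -[leLHS]addr0; apply: lerD; last exact: ltW.
  apply: ler_wpM2l => //.
  have : d * d <= d * 1 by rewrite ler_wpM2l// ltW.
  by rewrite mulr1 !expr2; lra.
by lra.
Qed.

(** * Small loss and small error *)

Section Approximants.
Context {R : realType} {m : nat}.
Variable pb : problem R m.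

(** The second derivative is bounded on [-c, c]; integrate it twice. *)
Lemma nonlinearity_lipschitz (c cf : R) : nonlinearity pb cf -> 0 <= c ->
  exists F1 F2, [/\ 0 <= F1, 0 <= F2,
    forall s, `|s| <= c -> `|derive1 (pb_f pb) s| <= F1,
    forall s t, `|s| <= c -> `|t| <= c ->
      `|pb_f pb s - pb_f pb t| <= F1 * `|s - t| &
    forall s t, `|s| <= c -> `|t| <= c ->
      `|derive1 (pb_f pb) s - derive1 (pb_f pb) t| <= F2 * `|s - t|].
Proof.
move=> [df df' _ _ hB] c0; have [F2 hF2] := hB c.
have F20 : 0 <= F2 by apply: le_trans (hF2 0 _); rewrite ?normr0.
have lip2 := lipschitz_of_derive_bound df' hF2.
pose F1 := `|derive1 (pb_f pb) 0| + F2 * c.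
have b1 s : `|s| <= c -> `|derive1 (pb_f pb) s| <= F1.
  move=> sc; rewrite -(subrK (derive1 (pb_f pb) 0) (derive1 (pb_f pb) s)).
  rewrite (le_trans (ler_normD _ _))// addrC lerD//.
  apply: le_trans (lip2 s 0 sc _) _; first by rewrite normr0.
  by rewrite subr0 ler_wpM2l.
exists F1, F2; split => //.
- by rewrite addr_ge0// mulr_ge0.
- exact: lipschitz_of_derive_bound df b1.
Qed.

(** The numbers eps N converge, hence are bounded, and one interval contains the
    values of all the approximating states; this is why K is independent of N. *)
Lemma small_residual_approximants (zs : triple R m) uext cf HY HL HU
    (eps : nat -> R) : well_posed_data pb -> classical_KKT pb zs ->
  nonlinearity pb cf ->
  (forall N v, HY N v \/ HL N v \/ HU N v -> is_tanh_network v) ->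
  approximability pb zs uext (product_class HY HL HU) eps ->
  (forall N, 0 <= eps N) /\
  exists2 K, 0 <= K & forall N d, 0 < d <= 1 -> exists2 z,
    product_class HY HL HU N z & forall r p, residual_point pb r p ->
      `|resid pb z r p| <= K * (eps N + d).
Proof.
move=> [[oOm _ bOm _] [[_ hat hn [T0 nu0 al0]] _]] kkt nl net [cu uE ceps happ].
have sge0 := @sobolev_inf_norm_ge0 R m.+1.
have eps0 N : 0 <= eps N.
  rewrite -lee_fin; apply: le_trans (happ N).
  by apply: le_ereal_inf_tmp => _ [z _ <-]; rewrite !adde_ge0.
split => //.
have [Eb Eb0 hEb] : exists2 Eb, 0 <= Eb & forall N, eps N <= Eb.
  have /cvg_seq_bounded[M [_ hM]] : cvgn eps by apply: cvgP ceps.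
  exists (`|M| + 1); first by rewrite addr_ge0.
  move=> N; apply: le_trans (ler_norm _) (hM _ _ N I).
  by have := ler_norm M; lra.
have [[_ _ [cy cl] _] _] := kkt.
have [B1 B10 hB1] := bounded_on_closure bOm cy.
have [B2 B20 hB2] := bounded_on_closure bOm cl.
pose B := B1 + B2; have B0 : 0 <= B by exact: addr_ge0.
(* room for a network within eps N + d <= Eb + 1 of the reference state *)
pose c := B + (Eb + 1).
have [F1 [F2 [F10 F20 f1c fL f'L]]] : exists F1 F2, [/\ 0 <= F1, 0 <= F2,
    forall s, `|s| <= c -> `|derive1 (pb_f pb) s| <= F1,
    forall s t, `|s| <= c -> `|t| <= c ->
      `|pb_f pb s - pb_f pb t| <= F1 * `|s - t| &
    forall s t, `|s| <= c -> `|t| <= c ->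
      `|derive1 (pb_f pb) s - derive1 (pb_f pb) t| <= F2 * `|s - t|].
  by apply: nonlinearity_lipschitz nl _; rewrite /c; lra.
exists (residual_constant pb B F1 F2).
  have nu0' := ltW nu0; have al0' := ltW al0.
  by rewrite /residual_constant !addr_ge0 ?mulr_ge0 ?ler0n.
move=> N d /andP[d0 d1].
have [z [[zY zL zU] sY sL sU]] := ereal_inf_sum3_lt
  (fun z => sge0 2 (cylinder pb) (fun p => st zs p - st z p))
  (fun z => sge0 2 (cylinder pb) (fun p => adj zs p - adj z p))
  (fun z => sge0 1 (cylinder pb) (fun p => uext p - ctl z p)) (happ N)
  (ltac:(by rewrite ltrDl) : eps N < eps N + d).
exists z; first by split.
have netY : is_tanh_network (st z) by apply: (net N); left.
have netL : is_tanh_network (adj z) by apply: (net N); right; left.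
have netU : is_tanh_network (ctl z) by apply: (net N); right; right.
have e0 : 0 <= eps N + d by rewrite addr_ge0// ltW.
have Bec : B + (eps N + d) <= c by rewrite /c lerD2l; have := hEb N; lra.
have yB p : closure (cylinder pb) p -> `|st zs p| <= B.
  by move=> /hB1; rewrite /B; lra.
have lB p : closure (cylinder pb) p -> `|adj zs p| <= B.
  by move=> /hB2; rewrite /B; lra.
move=> r p rp.
apply: (residual_bound oOm T0 nu0 al0 hat hn kkt yB lB f1c fL f'L e0 Bec F10 F20
  B0 netY netL netU cu uE sY sL sU).
by move: rp; case: r.
Qed.

(** Compare with an approximant for each d, then let d tend to 0. *)
Lemma trained_loss_le (wt : residual -> R) (H : nat -> set (triple R m))
    (eps : nat -> R) K N d (W : measurableType d) (P : probability W R)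
    (S : collocation W) w (z0 : triple R m) (eo : R) :
  (forall r, 0 < wt r) -> 0 <= K -> 0 <= eps N ->
  (forall d, 0 < d <= 1 -> exists2 z, H N z & forall r p, residual_point pb r p ->
     `|resid pb z r p| <= K * (eps N + d)) ->
  (forall r, (0 < sample_size S r)%N) -> space_filling pb P S ->
  ((loss_ind pb wt S w z0)%:E <=
    ereal_inf [set (loss_ind pb wt S w z)%:E | z in H N] + (eo ^+ 2)%:E)%E ->
  loss_ind pb wt S w z0 <=
    (\sum_(r <- residuals) wt r) * K ^+ 2 * eps N ^+ 2 + eo ^+ 2.
Proof.
move=> wt0 K0 e0 happ nS sf hopt.
have Wt0 : 0 <= \sum_(r <- residuals) wt r by apply: sumr_ge0 => r _; exact: ltW.
apply: quadratic_limit => // [|dl hd]; first by rewrite mulr_ge0// sqr_ge0.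
have [z Hz hz] := happ dl hd.
rewrite -lee_fin EFinD; apply: (le_trans hopt); apply: leeD2r.
apply: (@le_trans _ _ (loss_ind pb wt S w z)%:E).
  by apply: ereal_inf_lbound; exists z.
have a0 : 0 <= K * (eps N + dl).
  by have /andP[/ltW ? _] := hd; rewrite mulr_ge0// addr_ge0.
rewrite lee_fin -mulrA -exprMn mulr_suml; apply: ler_sum => r _.
apply: ler_wpM2l; first exact: ltW.
apply: (loss_le w sf (nS r) a0); exact: hz.
Qed.

End Approximants.

(** Here q is a quadrature constant, l a loss and V a quadrature remainder; the
    square root of q l + V is at most ctr A + quad. *)
Lemma residual_norm_le (R : realType) (m : nat) (pb : problem R m)
    (z : triple R m) r (q l V ctr quad A : R) : well_posed_data pb ->
  0 <= q -> 0 <= l -> 0 <= V -> 0 <= ctr -> 0 <= quad -> 0 <= A ->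
  Num.sqrt q <= ctr -> l <= A ^+ 2 -> V <= quad ^+ 2 ->
  (residual_L2avsq pb z r <= (q * l + V)%:E)%E ->
  (residual_L2sq pb z r `^ 2^-1 <=
   (Num.sqrt (fine (residual_measure pb r)) * (ctr * A + quad))%:E)%E.
Proof.
move=> wp q0 l0 V0 ctr0 quad0 A0 qctr lA Vquad hav.
set D := fine _.
have D0 : 0 <= D by rewrite fine_ge0//; case: r {hav} @D => /=; exact: measure_ge0.
have h := residual_L2sq_le wp (addr_ge0 (mulr_ge0 q0 l0) V0) hav.
have sq0 : (0 <= residual_L2sq pb z r)%E.
  by case: r {hav D D0 h} => /=; apply: integral_ge0 => p _; rewrite lee_fin sqr_ge0.
have bnd : D * (q * l + V) <= (Num.sqrt D * (ctr * A)) ^+ 2 + (Num.sqrt D * quad) ^+ 2.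
  rewrite !exprMn sqr_sqrtr// -mulrDr ler_wpM2l// lerD// ler_pM//.
  by rewrite -[leLHS](sqr_sqrtr q0) lerXn2r ?nnegrE ?sqrtr_ge0.
rewrite mulrDr.
have := h; case: r sq0 {hav h} @D D0 bnd => sq0 D D0 bnd h; (apply: L2norm_le => //;
  [by rewrite !mulr_ge0 ?sqrtr_ge0|by rewrite mulr_ge0 ?sqrtr_ge0|]);
  apply: le_trans h _; rewrite lee_fin; exact: bnd.
Qed.

Unset Implicit Arguments.

Theorem corollary2 (R : realType) (m : nat) (pb : problem R m)
    (zs : triple R m) (uext : 'rV[R]_m.+1 * R -> R) (cf : R)
    (HY HL HU : nat -> set ('rV[R]_m.+1 * R -> R)) (eps_net : nat -> R)
    (wt : residual -> R)
    (C2 C3 : R -> set 'rV[R]_m.+1 -> R -> R -> R -> R) :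
  let H := product_class HY HL HU in
  let c2 := C2 (pb_nu pb) (pb_Omega pb) (pb_T pb) cf (M_a pb zs) in
  let c3 := C3 (pb_nu pb) (pb_Omega pb) (pb_T pb) cf (M_a pb zs) in
  well_posed_data pb ->
  reference_KKT_point pb zs ->
  regularity_and_compatibility pb (ctl zs) ->
  nonlinearity pb cf ->
  (forall N v, HY N v \/ HL N v \/ HU N v -> is_tanh_network v) ->
  approximability pb zs uext H eps_net ->
  (forall r, 0 < wt r) ->
  0 < c2 -> 0 < c3 ->
  alpha0 pb c2 c3 zs < pb_alpha pb ->
  exists C : R, 0 < C /\
  forall (Cstab Cstab' Cnl a b : R),
    0 < Cstab -> 0 < Cstab' -> 0 < Cnl ->
    lipschitz_interval pb zs a b ->
    stability_constants pb zs H Cstab Cstab' ->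
    stability_radius pb zs H a b Cstab Cstab' (2 * Cstab * Cnl)^-1 ->
  forall (Mbc rho eps_opt : R) (N : nat)
    (dW : measure_display) (W : measurableType dW) (P : probability W R)
    (S : collocation W) (zhat : W -> triple R m)
    (beta_r : residual -> R) (Cq : residual -> nat -> R)
    (Cq' : residual -> triple R m -> R),
    0 <= Mbc -> 0 < rho -> rho <= (2 * Cstab * Cnl)^-1 -> 0 <= eps_opt ->
    (forall r, (0 < sample_size S r)%N) ->
    space_filling pb P S ->
    quadrature_constants pb P S beta_r zhat Cq Cq' ->
    (forall w, [/\ H N (zhat w),
       trace_residual_bound pb Mbc (zhat w),
       local_neighborhood pb zs rho a b (zhat w) &
       ((loss_ind pb wt S w (zhat w))%:E <=
        ereal_inf [set (loss_ind pb wt S w z)%:E | z in H N]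
        + (eps_opt ^+ 2)%:E)%E]) ->
  exists E : set W,
    [/\ measurable E,
        ((1 - \sum_(r <- residuals) failure_probability (sample_size S r))%:E
         <= P E)%E &
        forall w, E w ->
          (triple_error pb zs (zhat w) <=
           (C * (Cstab * (C_train S Cq * (eps_net N + eps_opt)
                          + quad_error S beta_r Cq' (zhat w))
                 + Cstab' * Mbc))%:E)%E].
Proof.
move=> H c2 c3 wp kkt reg nl net happ wt0 _ _ _.
have [_ _ _ ckkt] := kkt.
have [eps0 [K K0 hK]] := small_residual_approximants wp ckkt nl net happ.
pose Ds := \sum_(r <- residuals) Num.sqrt (fine (residual_measure pb r)).
have Ds0 : 0 <= Ds by apply: sumr_ge0 => r _; exact: sqrtr_ge0.
pose Wt := \sum_(r <- residuals) wt r.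
have Wt0 : 0 <= Wt by apply: sumr_ge0 => r _; exact: ltW.
pose Wi := \sum_(r <- residuals) (wt r)^-1.
have Wi0 : 0 <= Wi by apply: sumr_ge0 => r _; rewrite invr_ge0 ltW.
(* k^2 converts the bound on the loss of the trained network, Wt and Wi
   accounting for the weights, into one on each unweighted loss *)
pose k := Num.max 1 (Num.sqrt Wi * Num.max 1 (Num.sqrt Wt * K)).
have k1 : 1 <= k by rewrite le_max lexx.
(* 10 = 2 * 5: the factor 2 of the stability estimate times its five norms *)
pose C := 2 + 10 * (Ds * k).
have Dk0 : 0 <= Ds * k by rewrite mulr_ge0// (le_trans ler01).
exists C; split; first by rewrite /C; lra.
move=> Cstab Cstab' Cnl a b Cs0 Cs'0 Cnl0 lip _ hrad Mbc rho eo N dW W P S zhat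
  beta_r Cq Cq' Mbc0 rho0 rhole eo0 nS sf hq hz.
have /choice[E0 hE0] : forall r, exists E : set W, [/\ measurable E,
    ((1 - failure_probability (sample_size S r))%:E <= P E)%E &
    forall w, E w -> (residual_L2avsq pb (zhat w) r <=
      (Cq r (sample_size S r) * loss pb S w (zhat w) r
       + Cq' r (zhat w) * quad_rate S beta_r r)%:E)%E].
  by move=> r; have [_ _ _] := hq r.
have [E [mE PE hE]] := @union_bound R _ W P E0
  (fun r => failure_probability (sample_size S r))
  (fun r => let: And3 h _ _ := hE0 r in h) (fun r => let: And3 _ h _ := hE0 r in h).
exists E; split => // w Ew.
have [Hz trz locz optz] := hz w.
have := trained_loss_le wt0 K0 (eps0 N) (hK N) nS sf optz; rewrite -/Wt => Lz.
pose ctr := C_train S Cq; pose quad := quad_error S beta_r Cq' (zhat w).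
have Cq0 r : 0 <= Cq r (sample_size S r) by have [_ [h _] _ _] := hq r; exact: h.
have Vq0 r : 0 <= Cq' r (zhat w) * quad_rate S beta_r r.
  by have [_ _ h _] := hq r; rewrite mulr_ge0 ?powR_ge0.
have ctrq r : Num.sqrt (Cq r (sample_size S r)) <= ctr.
  exact: (le_max_residuals (fun r => Num.sqrt (Cq r (sample_size S r)))).
have ctr0 : 0 <= ctr by apply: le_trans (ctrq Res_y); exact: sqrtr_ge0.
have quad0 : 0 <= quad by exact: sqrtr_ge0.
have quadV r : Cq' r (zhat w) * quad_rate S beta_r r <= quad ^+ 2.
  rewrite sqr_sqrtr; last by apply: sumr_ge0 => r' _; exact: Vq0.
  exact: (le_sum_residuals (F := fun r => Cq' r (zhat w) * quad_rate S beta_r r)).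
pose A := k * (eps_net N + eo).
have k0 : 0 <= k by apply: le_trans k1.
have eno0 : 0 <= eps_net N + eo by rewrite addr_ge0.
have A0 : 0 <= A by rewrite mulr_ge0.
have lA r : loss pb S w (zhat w) r <= A ^+ 2.
  apply: (le_trans (loss_le_loss_ind pb S w (zhat w) r wt0)); rewrite -/Wi.
  apply: (le_trans (ler_wpM2l Wi0 Lz)).
  set k2 := Num.max 1 (Num.sqrt Wt * K).
  have k2k : Num.sqrt Wi * k2 <= k by rewrite le_max lexx orbT.
  have k21 : 1 <= k2 by rewrite le_max lexx.
  have k20 : 0 <= k2 by apply: le_trans k21.
  have k22 : Num.sqrt Wt * K <= k2 by rewrite le_max lexx orbT.
  have h1 : Wt * K ^+ 2 * eps_net N ^+ 2 + eo ^+ 2 <= (k2 * (eps_net N + eo)) ^+ 2.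
    have -> : Wt * K ^+ 2 * eps_net N ^+ 2 = (Num.sqrt Wt * K * eps_net N) ^+ 2.
      by rewrite !exprMn sqr_sqrtr.
    have a1 : 0 <= Num.sqrt Wt * K * eps_net N by rewrite !mulr_ge0 ?sqrtr_ge0.
    apply: (@le_trans _ _ ((Num.sqrt Wt * K * eps_net N + eo) ^+ 2)).
      by rewrite sqrrD lerD2r lerDl mulrn_wge0// mulr_ge0.
    rewrite lerXn2r// ?nnegrE; [exact: addr_ge0|exact: mulr_ge0|].
    rewrite mulrDr; apply: lerD; first exact: ler_wpM2r.
    by rewrite ler_peMl.
  apply: (le_trans (ler_wpM2l Wi0 h1)).
  rewrite -[X in X * _](sqr_sqrtr Wi0) -exprMn mulrA.
  rewrite lerXn2r// ?nnegrE; last exact: ler_wpM2r.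
  by rewrite mulr_ge0// mulr_ge0// sqrtr_ge0.
pose X := ctr * (eps_net N + eo) + quad.
have X0 : 0 <= X by rewrite addr_ge0// mulr_ge0// addr_ge0.
have norm_le r : (residual_L2sq pb (zhat w) r `^ 2^-1 <= (Ds * k * X)%:E)%E.
  have [_ _ hav] := hE0 r.
  apply: le_trans (residual_norm_le wp (Cq0 r) (loss_ge0 pb S w (zhat w) r)
    (Vq0 r) ctr0 quad0 A0 (ctrq r) (lA r) (quadV r) (hav w (hE r w Ew))) _.
  rewrite lee_fin -mulrA; apply: ler_pM; rewrite ?sqrtr_ge0 ?addr_ge0 ?mulr_ge0//.
    apply: (le_sum_residuals (F := fun r => Num.sqrt (fine (residual_measure pb r)))).
    by move=> r'; exact: sqrtr_ge0.
  rewrite /X mulrDr /A mulrCA lerD2l; exact: ler_peMl.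
have errE : L2norm (lebesgue_rV m.+1) (pb_Omega pb) (err_y0 pb (zhat w)) =
    (residual_L2sq pb (zhat w) Res_ic_y `^ 2^-1)%E.
  rewrite /L2norm /residual_L2sq; congr (_ `^ _)%E; apply: eq_integral => x _.
  by rewrite /err_y0 sqrrN.
apply: le_trans (hrad N (zhat w) Mbc rho Hz trz locz rhole) _.
rewrite errE.
apply: (@le_trans _ _ ((2 * Cstab)%:E * (5 * (Ds * k * X))%:E
    + (2 * Cstab' * Mbc)%:E)%E).
  apply: leeD2r; apply: lee_wpmul2l; first by rewrite lee_fin mulr_ge0// ltW.
  have -> : 5 * (Ds * k * X) = Ds * k * X + Ds * k * X + Ds * k * X + Ds * k * X
      + Ds * k * X by ring.
  rewrite !EFinD; apply: leeD; last exact: (norm_le Res_bc_y).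
  apply: leeD; last exact: (norm_le Res_u).
  apply: leeD; last exact: (norm_le Res_lambda).
  by apply: leeD; [exact: (norm_le Res_ic_y)|exact: (norm_le Res_y)].
rewrite -EFinM -EFinD lee_fin -/X /C.
have h1 : 0 <= Cstab * X by rewrite mulr_ge0// ltW.
have h2 : 0 <= Ds * k * (Cstab' * Mbc) by rewrite !mulr_ge0// ltW.
have -> : 2 * Cstab * (5 * (Ds * k * X)) + 2 * Cstab' * Mbc =
  (2 + 10 * (Ds * k)) * (Cstab * X + Cstab' * Mbc) - 2 * (Cstab * X)
  - 10 * (Ds * k * (Cstab' * Mbc)) by ring.
by lra.
Qed.
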